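(* Let $(K,v)$ be a valued field with value group $\Gamma=v(K^\times)\subset\mathbb{R}$ and valuation ring $K^\circ$, and let $\mathbb{T}$ be the split torus of rank $n$ over $K^\circ$. If $v$ is not a discrete valuation, then the map $\sigma\mapsto \mathcal{V}_\sigma$ defines a bijection between the set of those $\Gamma$-admissible cones $\sigma$ in $\mathbb{R}^n\times\mathbb{R}_+$ for which the vertices of $\sigma\cap(\mathbb{R}^n\times\{1\})$ are contained in $\Gamma^n\times\{1\}$ and the set of isomorphism classes of normal affine $\mathbb{T}$-toric varieties over $K^\circ$.
   Context: A valued field $(K,v)$ means a field $K$ with a valuation $v$ with value group $\Gamma:=v(K^\times)\subset\mathbb{R}$ (not necessarily complete or algebraically closed), and $K^\circ=\{x\in K\mid v(x)\ge 0\}$. $\mathbb{R}_+$ denotes the non-negative real numbers. Let $M$ be a free abelian group of rank $n$ with dual $N=\mathrm{Hom}(M,\mathbb{Z})$ and pairing $\langle u,\omega\rangle=\omega(u)$; $N_{\mathbb{R}}=N\otimes_{\mathbb Z}\mathbb{R}$ is identified with $\mathbb{R}^n$ by choosing a basis (so $N_\Gamma=N\otimes_{\mathbb Z}\Gamma$ is identified with $\Gamma^n$). The split torus is $\mathbb{T}=\mathrm{Spec}(K^\circ[M])$, with generic fibre $T=\mathrm{Spec}(K[M])$; $\chi^u$ denotes the character of $u\in M$. A $\mathbb{T}$-toric scheme over $K^\circ$ is an integral separated flat scheme $\mathcal{Y}$ over $K^\circ$ whose generic fibre contains $T$ as an open subset and such that the translation action $T\times_K T\to T$ extends to an algebraic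 action $\mathbb{T}\times_{K^\circ}\mathcal{Y}\to\mathcal{Y}$ over $K^\circ$. It is called a $\mathbb{T}$-toric variety if it is of finite type over $K^\circ$. It is normal if all its local rings are integrally closed. An isomorphism of $\mathbb{T}$-toric schemes is an equivariant isomorphism which restricts to the identity on $T$. A cone $\sigma\subset N_{\mathbb{R}}\times\mathbb{R}_+$ is called $\Gamma$-admissible if it contains no line and can be written as $\sigma=\bigcap_{i=1}^k\{(\omega,s)\in N_{\mathbb{R}}\times\mathbb{R}_+\mid\langle u_i,\omega\rangle+sc_i\ge 0\}$ with $u_1,\dots,u_k\in M$ and $c_1,\dots,c_k\in\Gamma$. For such $\sigma$ put $$K[M]^\sigma:=\Big\{\sum_{u\in M}\alpha_u\chi^u\in K[M]\ \Big|\ c\,v(\alpha_u)+\langle u,\omega\rangle\ge 0\ \text{ for all }(\omega,c)\in\sigma\text{ and all }u\text{ with }\alpha_u\neq0\Big\}$$ and $\mathcal{V}_\sigma:=\mathrm{Spec}(K[M]^\sigma)$, with the $\mathbb{T}$-action given by the $M$-grading of $K[M]^\sigma$; this is a normal $\mathbb{T}$-toric scheme over $K^\circ$. *)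

(* Defs.v *)
From HB Require Import structures.
From mathcomp Require Import all_boot all_order all_algebra finmap.
From mathcomp Require Import all_classical reals constructive_ereal ereal.

Set Implicit Arguments.
Unset Strict Implicit.
Unset Printing Implicit Defensive.

Import Order.TTheory GRing.Theory Num.Theory.
Local Open Scope classical_set_scope.
Local Open Scope ring_scope.

Record valuation (K : fieldType) (R : realType) := Valuation {
  valuation_fun :> K -> \bar R;
  valuation0 : valuation_fun 0 = +oo%E;
  valuation_fin : forall x, x != 0 -> valuation_fun x \is a fin_num;
  valuationM : forall x y,
    valuation_fun (x * y) = (valuation_fun x + valuation_fun y)%E;
  valuationD : forall x y,
    (Order.min (valuation_fun x) (valuation_fun y) <= valuation_fun (x + y))%E
}.

Definition value_group (K : fieldType) (R : realType) (v : valuation K R) :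
  set R := [set r | exists2 x : K, x != 0 & v x = r%:E].

(* The value group is infinite cyclic; in particular the trivial valuation is
   not counted as discrete. *)
Definition discrete_valuation (K : fieldType) (R : realType)
    (v : valuation K R) : Prop :=
  exists g : R, 0 < g /\ value_group v = [set m%:~R * g | m in [set: int]].

Section ValuationRing.
Context (K : fieldType) (R : realType) (v : valuation K R).

Lemma valuation1 : v 1 = 0%E.
Proof.
have := valuationM v 1 1; rewrite mulr1.
have /fineK <- := valuation_fin v (oner_neq0 K).
by rewrite -EFinD => -[/eqP]; rewrite -subr_eq subrr => /eqP <-.
Qed.

Lemma valuationN1 : v (-1) = 0%E.
Proof.
have nz : (-1 : K) != 0 by rewrite oppr_eq0 oner_neq0.
have := valuationM v (-1) (-1); rewrite mulrNN mulr1 valuation1.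
have /fineK <- := valuation_fin v nz.
rewrite -EFinD => -[/esym/eqP]; rewrite -mulr2n mulrn_eq0 /= => /eqP ->.
by [].
Qed.

Lemma valuationN x : v (- x) = v x.
Proof. by rewrite -mulN1r valuationM valuationN1 add0e. Qed.

Definition valring_pred : {pred K} := [pred x | (0 <= v x)%E].

Lemma valring_subring_closed : subring_closed valring_pred.
Proof.
split; first by rewrite inE valuation1.
- move=> x y; rewrite !inE => hx hy.
  apply: le_trans (valuationD v x (- y)).
  by rewrite le_min hx valuationN.
- by move=> x y; rewrite !inE valuationM => hx hy; apply: adde_ge0.
Qed.

HB.instance Definition _ :=
  GRing.isSubringClosed.Build K valring_pred valring_subring_closed.

Record valring : Type :=
  ValRing { valring_val : K; _ : valring_val \in valring_pred }.

HB.instance Definition _ := [isSub for valring_val].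
HB.instance Definition _ := [Choice of valring by <:].
HB.instance Definition _ := [SubChoice_isSubComNzRing of valring by <:].

End ValuationRing.

(* The group algebra A[M] as finitely supported functions M -> A.             *)
Record grpalg (A : comNzRingType) (M : zmodType) : Type :=
  GrpAlg { grpalg_val : {fsfun M -> A with 0} }.

HB.instance Definition _ A M := [isNew for @grpalg_val A M].
HB.instance Definition _ A M := [Choice of grpalg A M by <:].

Section GroupAlgebra.
Context {A : comNzRingType} {M : zmodType}.
Implicit Types (x y z : grpalg A M) (a b : A) (u w : M).

Definition coef x u : A := grpalg_val x u.
Definition supp x : {fset M} := finsupp (grpalg_val x).
Definition mkgrpalg (D : {fset M}) (E : M -> A) : grpalg A M :=
  GrpAlg [fsfun u in D => E u | 0].
Definition monom a u : grpalg A M := mkgrpalg [fset u]%fset (fun=> a).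

Lemma grpalgP x y : (forall u, coef x u = coef y u) <-> x = y.
Proof.
by case: x y => [f] [g]; split=> [h|->//]; congr GrpAlg; apply/fsfunP/h.
Qed.

Lemma coef_mk D E u : coef (mkgrpalg D E) u = if u \in D then E u else 0.
Proof. exact/fsfun_fun. Qed.

Lemma coef_neq0 x u : (coef x u != 0) = (u \in supp x).
Proof. by rewrite mem_finsupp. Qed.

Lemma coef_outdom x u : u \notin supp x -> coef x u = 0.
Proof. exact: fsfun_dflt. Qed.

Lemma coef_monom a u w : coef (monom a u) w = a *+ (u == w).
Proof. by rewrite coef_mk inE eq_sym; case: eqP. Qed.

Lemma supp_monom a u : (supp (monom a u) `<=` [fset u])%fset.
Proof.
apply/fsubsetP=> w; rewrite -coef_neq0 coef_monom inE.
by case: (eqVneq u w) => //; rewrite eqxx.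
Qed.

Definition gzero : grpalg A M := mkgrpalg fset0 (fun=> 0).
Definition gopp x := mkgrpalg (supp x) (fun u => - coef x u).
Definition gadd x y :=
  mkgrpalg (supp x `|` supp y)%fset (fun u => coef x u + coef y u).

Lemma gzeroE u : coef gzero u = 0.
Proof. by rewrite coef_mk. Qed.

Lemma goppE x u : coef (gopp x) u = - coef x u.
Proof.
by rewrite coef_mk; case: ifPn => // /coef_outdom ->; rewrite oppr0.
Qed.

Lemma gaddE x y u : coef (gadd x y) u = coef x u + coef y u.
Proof.
rewrite coef_mk in_fsetU; case: ifPn => //.
by rewrite negb_or => /andP[/coef_outdom -> /coef_outdom ->]; rewrite addr0.
Qed.

Lemma gaddA : associative gadd.
Proof. by move=> x y z; apply/grpalgP=> u; rewrite !gaddE addrA. Qed.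

Lemma gaddC : commutative gadd.
Proof. by move=> x y; apply/grpalgP=> u; rewrite !gaddE addrC. Qed.

Lemma gadd0 : left_id gzero gadd.
Proof. by move=> x; apply/grpalgP=> u; rewrite gaddE gzeroE add0r. Qed.

Lemma gaddN : left_inverse gzero gopp gadd.
Proof.
by move=> x; apply/grpalgP=> u; rewrite gaddE gzeroE goppE addNr.
Qed.

HB.instance Definition _ :=
  GRing.isZmodule.Build (grpalg A M) gaddA gaddC gadd0 gaddN.

Lemma coef0 u : coef 0 u = 0. Proof. exact: gzeroE. Qed.
Lemma coefD x y u : coef (x + y) u = coef x u + coef y u.
Proof. exact: gaddE. Qed.
Lemma coefN x u : coef (- x) u = - coef x u. Proof. exact: goppE. Qed.
Lemma coefB x y u : coef (x - y) u = coef x u - coef y u.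
Proof. by rewrite coefD coefN. Qed.

Lemma coef_sum (I : Type) (r : seq I) (P : pred I) (F : I -> grpalg A M) u :
  coef (\sum_(i <- r | P i) F i) u = \sum_(i <- r | P i) coef (F i) u.
Proof. exact: (big_morph (coef^~ u) (fun x y => coefD x y u) (coef0 u)). Qed.

Lemma monom0 u : monom 0 u = 0.
Proof. by apply/grpalgP=> w; rewrite coef_monom mul0rn coef0. Qed.

Lemma monomD a b u : monom (a + b) u = monom a u + monom b u.
Proof. by apply/grpalgP=> w; rewrite coefD !coef_monom mulrnDl. Qed.

Lemma grpalgEw x (D : {fset M}) : (supp x `<=` D)%fset ->
  x = \sum_(u <- D) monom (coef x u) u.
Proof.
move=> /fsubsetP sD; apply/grpalgP => u; rewrite coef_sum.
have [uD|uD] := boolP (u \in D).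
  rewrite (big_fsetD1 u) //= coef_monom eqxx big1_fset ?addr0 // => w.
  by rewrite in_fsetD1 coef_monom; case: eqP.
rewrite big1_fset; first by rewrite coef_outdom //; apply: contra uD => /sD.
by move=> w wD _; rewrite coef_monom; case: eqP uD wD => // -> /negbTE ->.
Qed.

Lemma grpalgE x : x = \sum_(u <- supp x) monom (coef x u) u.
Proof. exact/grpalgEw. Qed.

Lemma grpalg_ind (P : grpalg A M -> Prop) :
  (forall a u, P (monom a u)) -> P 0 ->
  (forall x y, P x -> P y -> P (x + y)) -> forall x, P x.
Proof.
move=> Pm P0 PD x; rewrite [x]grpalgE.
by apply: (big_ind P) => // u _; apply: Pm.
Qed.

Definition gmul x y : grpalg A M :=
  \sum_(u <- supp x) \sum_(w <- supp y) monom (coef x u * coef y w) (u + w).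

Lemma gmulw (D E : {fset M}) x y :
  (supp x `<=` D)%fset -> (supp y `<=` E)%fset ->
  gmul x y = \sum_(u <- D) \sum_(w <- E) monom (coef x u * coef y w) (u + w).
Proof.
move=> sD sE; rewrite /gmul (big_fset_incl _ sD) /=.
  apply/eq_bigr=> u _; apply/big_fset_incl => // w _ /coef_outdom ->.
  by rewrite mulr0 monom0.
move=> u _ /coef_outdom xu.
by rewrite big1 // => w _; rewrite xu mul0r monom0.
Qed.

Lemma gmulC : commutative gmul.
Proof.
move=> x y; rewrite /gmul exchange_big /=; apply: eq_bigr => w _.
by apply: eq_bigr => u _; rewrite mulrC addrC.
Qed.

Lemma gmulDl : left_distributive gmul +%R.
Proof.
move=> x y z; pose D := (supp x `|` supp y)%fset.
have sD : (supp (x + y)%R `<=` D)%fset.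
  apply/fsubsetP => u; rewrite -coef_neq0 coefD in_fsetU; apply: contraR.
  by rewrite negb_or => /andP[/coef_outdom -> /coef_outdom ->]; rewrite addr0.
rewrite (gmulw sD (fsubset_refl _)).
rewrite (gmulw (fsubsetUl (supp x) (supp y)) (fsubset_refl _)).
rewrite (gmulw (fsubsetUr (supp x) (supp y)) (fsubset_refl _)).
rewrite -big_split /=; apply: eq_bigr => u _.
rewrite -big_split /=; apply: eq_bigr => w _.
by rewrite coefD mulrDl monomD.
Qed.

Lemma gmulDr : right_distributive gmul +%R.
Proof. by move=> x y z; rewrite !(gmulC x) gmulDl. Qed.

Lemma gmulUU a b u w : gmul (monom a u) (monom b w) = monom (a * b) (u + w).
Proof.
by rewrite (gmulw (supp_monom _ _) (supp_monom _ _)) !big_seq_fset1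
  !coef_monom !eqxx.
Qed.

Lemma gmul0 x : gmul 0 x = 0.
Proof. by have /eqP := gmulDl 0 0 x; rewrite addr0 -subr_eq subrr => /eqP. Qed.

Lemma gmul1 : left_id (monom 1 0) gmul.
Proof.
move=> x; elim/grpalg_ind: x => [a u||x y hx hy].
- by rewrite gmulUU mul1r add0r.
- by rewrite gmulC gmul0.
- by rewrite gmulDr hx hy.
Qed.

Lemma gmulA : associative gmul.
Proof.
move=> x y z; elim/grpalg_ind: x => [a u||x x' hx hx'].
- elim/grpalg_ind: y => [b w||y y' hy hy'].
  + elim/grpalg_ind: z => [c t||z z' hz hz'].
    * by rewrite !gmulUU mulrA addrA.
    * by rewrite !(gmulC _ 0) !gmul0 gmulC gmul0.
    * by rewrite !gmulDr hz hz'.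
  + by rewrite (gmulC _ 0) !gmul0 (gmulC _ 0) gmul0.
  + by rewrite gmulDl !gmulDr hy hy' gmulDl.
- by rewrite !gmul0.
- by rewrite !gmulDl hx hx'.
Qed.

Lemma gone_neq0 : monom 1 0 != 0 :> grpalg A M.
Proof.
apply/eqP => /grpalgP/(_ 0)/eqP.
by rewrite coef0 coef_monom eqxx oner_eq0.
Qed.

HB.instance Definition _ := GRing.Zmodule_isComNzRing.Build (grpalg A M)
  gmulA gmulC gmul1 gmulDl gone_neq0.

Lemma monomM a b u w : monom a u * monom b w = monom (a * b) (u + w).
Proof. exact: gmulUU. Qed.

Lemma coefM x y u : coef (x * y) u =
  \sum_(k <- supp x) \sum_(l <- supp y) (coef x k * coef y l) *+ (k + l == u).
Proof.
rewrite coef_sum; apply: eq_bigr => k _; rewrite coef_sum.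
by apply: eq_bigr => l _; rewrite coef_monom.
Qed.

Definition gconst a : grpalg A M := monom a 0.

Definition counit x : A := \sum_(u <- supp x) coef x u.

End GroupAlgebra.
Arguments grpalg_ind : clear implicits.

Section Coaction.
Context {A : comNzRingType} {M : zmodType}.
Implicit Types (x y z : grpalg A M) (a b : A) (u w : M).

(* The coaction A[M] -> A[M] (x) Z[M] = A[M][M], chi^u |-> chi^u (x) chi^u.    *)
Definition comul x : grpalg (grpalg A M) M :=
  mkgrpalg (supp x) (fun u => monom (coef x u) u).

Lemma coef_comul x u : coef (comul x) u = monom (coef x u) u.
Proof.
rewrite coef_mk; case: ifPn => // /coef_outdom ->.
by rewrite monom0.
Qed.

Lemma comulD x y : comul (x + y) = comul x + comul y.
Proof.
by apply/grpalgP=> u; rewrite coefD !coef_comul coefD monomD.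
Qed.

Lemma comulU a u : comul (monom a u) = monom (monom a u) u.
Proof.
apply/grpalgP=> w; rewrite coef_comul !coef_monom.
by case: eqP => [->//|_]; rewrite mulr0n monom0.
Qed.

Lemma comul0 : comul 0 = 0.
Proof. by apply/grpalgP=> u; rewrite coef_comul !coef0 monom0. Qed.

Lemma comulM x y : comul (x * y) = comul x * comul y.
Proof.
elim/grpalg_ind: x => [a u||x x' hx hx'].
- elim/grpalg_ind: y => [b w||y y' hy hy'].
  + by rewrite monomM !comulU !monomM.
  + by rewrite mulr0 comul0 mulr0.
  + by rewrite mulrDr !comulD mulrDr hy hy'.
- by rewrite mul0r comul0 mul0r.
- by rewrite mulrDl !comulD mulrDl hx hx'.
Qed.

Lemma comul1 : comul 1 = 1.
Proof. exact: comulU. Qed.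

End Coaction.

Section MapGroupAlgebra.
Context {A B : comNzRingType} {M : zmodType} (f : A -> B).

Definition gmap (x : grpalg A M) : grpalg B M :=
  mkgrpalg (supp x) (fun u => f (coef x u)).

Hypothesis f0 : f 0 = 0.
Hypothesis fD : {morph f : x y / x + y}.
Hypothesis f1 : f 1 = 1.
Hypothesis fM : {morph f : x y / x * y}.

Lemma coef_gmap x u : coef (gmap x) u = f (coef x u).
Proof. by rewrite coef_mk; case: ifPn => // /coef_outdom ->. Qed.

Lemma gmapU a u : gmap (monom a u) = monom (f a) u.
Proof.
by apply/grpalgP=> w; rewrite coef_gmap !coef_monom; case: eqP.
Qed.

Lemma gmap0 : gmap 0 = 0.
Proof. by apply/grpalgP=> w; rewrite coef_gmap !coef0. Qed.

Lemma gmapD x y : gmap (x + y) = gmap x + gmap y.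
Proof. by apply/grpalgP=> w; rewrite coefD !coef_gmap coefD fD. Qed.

Lemma gmapM x y : gmap (x * y) = gmap x * gmap y.
Proof.
elim/grpalg_ind: x => [a u||x x' hx hx'].
- elim/grpalg_ind: y => [b w||y y' hy hy'].
  + by rewrite monomM !gmapU monomM fM.
  + by rewrite mulr0 gmap0 mulr0.
  + by rewrite mulrDr !gmapD mulrDr hy hy'.
- by rewrite mul0r gmap0 mul0r.
- by rewrite mulrDl !gmapD mulrDl hx hx'.
Qed.

Lemma gmap1 : gmap 1 = 1.
Proof. by rewrite gmapU f1. Qed.

Lemma gmap_inj : injective f -> injective gmap.
Proof.
move=> finj x y /grpalgP xy; apply/grpalgP => u; apply: finj.
by rewrite -!coef_gmap.
Qed.

End MapGroupAlgebra.

Section GroupAlgebraDomain.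
Context (A : idomainType) (n : nat).
Local Notation M := 'rV[int]_n.
Implicit Types (u w : M).

Let lexlt u w : Prop :=
  exists i : 'I_n, (forall j : 'I_n, (j < i)%N -> u 0 j = w 0 j)
                   /\ u 0 i < w 0 i.

Let lexlt_irr u : ~ lexlt u u.
Proof. by case=> i [_]; rewrite ltxx. Qed.

Let lexlt_trans u w t : lexlt u w -> lexlt w t -> lexlt u t.
Proof.
move=> [i [hi li]] [k [hk lk]]; have [ik|ki|ik] := ltngtP i k.
- exists i; split=> [j ji|]; last by rewrite -hk.
  by rewrite hi // hk // (ltn_trans ji).
- exists k; split=> [j jk|]; last by rewrite hi.
  by rewrite hi ?hk // (ltn_trans jk).
- have {}ik : i = k by apply: val_inj.
  subst k; exists i; split=> [j ji|]; last exact: lt_trans lk.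
  by rewrite hi ?hk.
Qed.

Let lexltD2r u w t : lexlt u w -> lexlt (u + t) (w + t).
Proof.
case=> i [hi li]; exists i; split=> [j ji|]; rewrite !mxE.
  by rewrite hi.
by rewrite ltrD2r.
Qed.

Let lexlt_total u w : [\/ u = w, lexlt u w | lexlt w u].
Proof.
have [->|/eqP uw] := eqVneq u w; first by constructor 1.
have [i0 hi0] : exists i, u 0 i != w 0 i.
  apply/existsP; apply: contra_notT uw; rewrite negb_exists => /forallP h.
  by apply/rowP => i; apply/eqP; rewrite -[_ == _]negbK.
have [i hi mi] := @arg_minnP _ i0 (fun i => u 0 i != w 0 i) val hi0.
have eqi (j : 'I_n) : (j < i)%N -> u 0 j = w 0 j.
  move=> ji; apply/eqP; apply: contraLR ji => hj.
  by rewrite -leqNgt mi.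
have [h|h|h] := ltgtP (u 0 i) (w 0 i); last by rewrite h eqxx in hi.
  by constructor 2; exists i.
by constructor 3; exists i; split=> // j /eqi.
Qed.

Let lexle u w := u = w \/ lexlt u w.

Let lex_max (s : seq M) : s != [::] ->
  exists2 m, m \in s & forall u, u \in s -> lexle u m.
Proof.
elim: s => [//|a [|b s] IH] _.
  by exists a; rewrite ?inE // => u; rewrite inE => /eqP ->; left.
have [//|m ms hm] := IH; have [am|am|ma] := lexlt_total a m.
- exists m; first by rewrite inE ms orbT.
  by move=> u; rewrite inE => /orP[/eqP ->|/hm//]; left.
- exists m; first by rewrite inE ms orbT.
  by move=> u; rewrite inE => /orP[/eqP ->|/hm//]; right.
- exists a; first by rewrite inE eqxx.
  move=> u; rewrite inE => /orP[/eqP ->|/hm]; first by left.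
  by case=> [->|um]; right => //; apply: lexlt_trans um ma.
Qed.

Lemma grpalg_integral (x y : grpalg A M) : x * y = 0 -> x = 0 \/ y = 0.
Proof.
move=> xy; have [->|xn] := eqVneq x 0; first by left.
have [->|yn] := eqVneq y 0; first by right.
have nzs (z : grpalg A M) : z != 0 -> (supp z : seq M) != [::].
  apply: contra_neq => sz; rewrite [z]grpalgE sz big_nil //.
have [m mx hm] := lex_max (nzs x xn); have [l ly hl] := lex_max (nzs y yn).
have := congr1 (coef^~ (m + l)) xy; rewrite coef0 coefM.
rewrite (big_fsetD1 m) //= (big_fsetD1 l) //= eqxx mulr1n.
rewrite big1_fset => [|k]; last first.
  rewrite in_fsetD1 => /andP[/eqP kl /hl[//|lk]] _.
  case: eqP => // /addrI kl'; case: kl; exact: kl'.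
rewrite addr0 big1_fset => [|k]; last first.
  rewrite in_fsetD1 => /andP[/eqP km /hm[//|lk]] _.
  rewrite big1_fset // => t /hl tl _; case: eqP => // e.
  case: (@lexlt_irr (m + l)); rewrite -{1}e.
  case: tl => [->|tl]; first exact: lexltD2r.
  by apply: (@lexlt_trans _ (m + t)); [|rewrite ![m + _]addrC]; apply: lexltD2r.
rewrite addr0 => /eqP; rewrite mulf_eq0.
have /negbTE -> : coef x m != 0 by rewrite coef_neq0.
have /negbTE -> : coef y l != 0 by rewrite coef_neq0.
by [].
Qed.

End GroupAlgebraDomain.

Section Spectrum.

Definition prime_ideal (A : comNzRingType) (p : set A) : Prop :=
  [/\ p 0, (forall x y, p x -> p y -> p (x + y)),
      (forall a x, p x -> p (a * x)), ~ p 1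
    & (forall x y, p (x * y) -> p x \/ p y)].

Definition spec (A : comNzRingType) : Type := {p : set A | prime_ideal p}.

Definition zariski_open (A : comNzRingType) (U : set (spec A)) : Prop :=
  exists E : set A, U = [set p | exists2 f, E f & ~ sval p f].

Context {A B : comNzRingType} (phi : {rmorphism A -> B}).

Lemma prime_preimage (q : spec B) : prime_ideal (phi @^-1` sval q).
Proof.
case: q => q [/= q0 qD qM q1 qP]; split=> /=.
- by rewrite rmorph0.
- by move=> x y hx hy; rewrite rmorphD; apply: qD.
- by move=> a x hx; rewrite rmorphM; apply: qM.
- by rewrite rmorph1.
- by move=> x y; rewrite rmorphM; apply: qP.
Qed.

Definition spec_map (q : spec B) : spec A := exist _ _ (prime_preimage q).

End Spectrum.

(* Equality of the fractions x.1 / x.2 and y.1 / y.2 in the localization at p. *)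
Definition local_eq (A : comNzRingType) (p : spec A) (x y : A * A) : Prop :=
  exists2 t, ~ sval p t & t * (x.1 * y.2 - y.1 * x.2) = 0.

(* The map of local rings A_(phi^-1 q) -> B_q, a/s |-> phi a / phi s, is
   bijective. *)
Definition stalk_bijective (A B : comNzRingType) (phi : {rmorphism A -> B})
    (q : spec B) : Prop :=
  (forall x y : A * A,
     ~ sval (spec_map phi q) x.2 -> ~ sval (spec_map phi q) y.2 ->
     local_eq q (phi x.1, phi x.2) (phi y.1, phi y.2) ->
     local_eq (spec_map phi q) x y) /\
  (forall z : B * B, ~ sval q z.2 ->
     exists2 x : A * A, ~ sval (spec_map phi q) x.2
                      & local_eq q (phi x.1, phi x.2) z).

(* Spec phi : Spec B -> Spec A is a homeomorphism onto an open subset (the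
   continuity of Spec phi is automatic) inducing isomorphisms on stalks. *)
Definition open_immersion (A B : comNzRingType) (phi : {rmorphism A -> B}) :
    Prop :=
  [/\ injective (spec_map phi),
      (forall U : set (spec B), zariski_open U ->
         zariski_open (spec_map phi @` U))
    & (forall q : spec B, stalk_bijective phi q)].

(* B, with i and j, is the tensor product of A and C over R0.                 *)
Definition is_pushout (R0 A C B : comNzRingType)
    (f : {rmorphism R0 -> A}) (g : {rmorphism R0 -> C})
    (i : {rmorphism A -> B}) (j : {rmorphism C -> B}) : Prop :=
  (forall r, i (f r) = j (g r)) /\
  (forall (D : comPzRingType) (h : {rmorphism A -> D}) (k : {rmorphism C -> D}),
     (forall r, h (f r) = k (g r)) ->
     exists l : {rmorphism B -> D},
       [/\ (forall a, l (i a) = h a), (forall c, l (j c) = k c)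
         & (forall l' : {rmorphism B -> D},
              (forall a, l' (i a) = h a) -> (forall c, l' (j c) = k c) ->
              l' =1 l)]).

Section Flat.
Context {R0 A : comNzRingType} (f : {rmorphism R0 -> A}).

Definition bilinear_map (N P : lmodType R0) (b : N -> A -> P) : Prop :=
  [/\ (forall x y a, b (x + y) a = b x a + b y a),
      (forall x a c, b x (a + c) = b x a + b x c),
      (forall r x a, b (r *: x) a = r *: b x a)
    & (forall r x a, b x (f r * a) = r *: b x a)].

(* The element \sum_i x_i (x) a_i of N (x) A is zero, where s lists the pairs
   (x_i, a_i): by the universal property, it is killed by every bilinear map. *)
Definition tensor_eq0 (N : lmodType R0) (s : seq (N * A)) : Prop :=
  forall (P : lmodType R0) (b : N -> A -> P), bilinear_map b ->
    \sum_(xa <- s) b xa.1 xa.2 = 0.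

(* Tensoring with A preserves the injectivity of linear maps.                 *)
Definition flat : Prop :=
  forall (N N' : lmodType R0) (h : {linear N -> N'}), injective h ->
  forall s : seq (N * A),
    tensor_eq0 [seq (h xa.1, xa.2) | xa <- s] -> tensor_eq0 s.

Definition finite_type : Prop :=
  exists s : seq A, forall S : set A,
    (forall r, S (f r)) -> (forall x, x \in s -> S x) ->
    (forall x y, S x -> S y -> S (x + y)) ->
    (forall x y, S x -> S y -> S (x * y)) ->
    forall x, S x.

End Flat.

Definition local_ring (A : idomainType) (p : spec A) : set {fraction A} :=
  [set x | exists a s : A, ~ sval p s /\ x = tofrac a / tofrac s].

Definition normal (A : idomainType) : Prop :=
  forall (p : spec A) (x : {fraction A}),
    (exists q : {poly {fraction A}},
       [/\ q \is monic, (forall i, local_ring p q`_i) & root q x]) ->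
    local_ring p x.

Section Toric.
Context (K : fieldType) (R : realType) (v : valuation K R) (n : nat).

Local Notation M := 'rV[int]_n.
Local Notation KM := (grpalg K M).

(* The raw data of an integral affine scheme Y = Spec A over the valuation ring,
   with a morphism T -> Y and a morphism TT x Y -> Y, where TT x Y = Spec A[M];
   every arrow is given by the ring map in the opposite direction. Affine
   schemes are separated. *)
Record affine_scheme_data : Type := AffineSchemeData {
  coord_ring :> idomainType;
  structure_map : {rmorphism valring v -> coord_ring};
  torus_map : {rmorphism coord_ring -> KM};
  coaction : {rmorphism coord_ring -> grpalg coord_ring M}
}.

(* Together with the typing of Y, these are the conditions for an affine toric
   scheme. The ring B is the coordinate ring of the generic fibre of Y. *)
Record toric_scheme (Y : affine_scheme_data) : Prop := ToricScheme {
  toric_flat : flat (structure_map Y);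
  toric_open : exists (B : comNzRingType) (i : {rmorphism Y -> B})
      (j : {rmorphism K -> B}) (phi : {rmorphism B -> KM}),
      [/\ is_pushout (structure_map Y) (val : {rmorphism valring v -> K}) i j,
          (forall a, phi (i a) = torus_map Y a),
          (forall c, phi (j c) = gconst c)
        & open_immersion phi];
  coaction_over : forall r,
    coaction Y (structure_map Y r) = gconst (structure_map Y r);
  coaction_assoc : forall a,
    gmap (coaction Y) (coaction Y a) = comul (coaction Y a);
  coaction_unit : forall a, counit (coaction Y a) = a;
  coaction_extends : forall a,
    gmap (torus_map Y) (coaction Y a) = comul (torus_map Y a)
}.

Definition normal_toric_variety (Y : affine_scheme_data) : Prop :=
  [/\ toric_scheme Y, finite_type (structure_map Y) & normal Y].

Definition toric_iso (Y Z : affine_scheme_data) : Prop :=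
  exists psi : {rmorphism Z -> Y},
    [/\ bijective psi,
        (forall r, psi (structure_map Z r) = structure_map Y r),
        (forall a, gmap psi (coaction Z a) = coaction Y (psi a))
      & (forall a, torus_map Y (psi a) = torus_map Z a)].

Definition pairing (u : M) (w : 'rV[R]_n) : R :=
  \sum_(i < n) (u 0 i)%:~R * w 0 i.

Definition contains_line (sigma : set ('rV[R]_n * R)) : Prop :=
  exists x d : 'rV[R]_n * R,
    d <> 0 /\ forall t : R, sigma (x.1 + t *: d.1, x.2 + t * d.2).

Definition admissible (sigma : set ('rV[R]_n * R)) : Prop :=
  ~ contains_line sigma /\
  exists (k : nat) (u : 'I_k -> M) (c : 'I_k -> R),
    (forall i, value_group v (c i)) /\
    sigma = [set x | 0 <= x.2 /\ forall i, 0 <= pairing (u i) x.1 + x.2 * c i].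

(* The vertices of the polyhedron P, that is, its faces of dimension 0 (for
   a = 0 and b = 0 the face is P itself). *)
Definition vertex (P : set 'rV[R]_n) (w : 'rV[R]_n) : Prop :=
  exists (a : 'rV[R]_n) (b : R),
    (forall x, P x -> b <= \sum_(i < n) a 0 i * x 0 i) /\
    [set x | P x /\ \sum_(i < n) a 0 i * x 0 i = b] = [set w].

Definition height1 (sigma : set ('rV[R]_n * R)) : set 'rV[R]_n :=
  [set w | sigma (w, 1)].

Section ConeRing.
Variable sigma : set ('rV[R]_n * R).

(* The condition 0 <= x.2 is redundant for sigma in the closed upper half
   space; it makes the following a subring for every sigma. *)
Definition cone_ring_cond (f : KM) : Prop :=
  forall x, sigma x -> 0 <= x.2 -> forall u, coef f u != 0 ->
    (0 <= x.2%:E * v (coef f u) + (pairing u x.1)%:E)%E.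

Definition cone_ring_pred : {pred KM} := [pred f | `[< cone_ring_cond f >]].

Lemma pairing0 w : pairing 0 w = 0.
Proof. by rewrite /pairing big1 // => i _; rewrite mxE mul0r. Qed.

Lemma pairingD u u' w : pairing (u + u') w = pairing u w + pairing u' w.
Proof.
rewrite /pairing -big_split; apply: eq_bigr => i _.
by rewrite !mxE intrD mulrDl.
Qed.

Let term (x : 'rV[R]_n * R) (a : K) (u : M) : bool :=
  (a == 0) || (0 <= x.2%:E * v a + (pairing u x.1)%:E)%E.

Let termD x a b u : 0 <= x.2 -> term x a u -> term x b u -> term x (a + b) u.
Proof.
rewrite /term => x0 /predU1P[->|ha]; first by rewrite add0r.
move=> /predU1P[->|hb]; first by rewrite addr0 ha orbT.
apply/orP; right; have h := valuationD v a b.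
apply: (@le_trans _ _ (x.2%:E * Order.min (v a) (v b) + (pairing u x.1)%:E)%E).
  by case: (leP (v a) (v b)).
by rewrite leeD2r // lee_wpmul2l // lee_fin.
Qed.

Let termM x a b u w : 0 <= x.2 -> term x a u -> term x b w ->
  term x (a * b) (u + w).
Proof.
rewrite /term mulf_eq0 => x0.
have [//|an] := eqVneq a 0; have [//|bn] := eqVneq b 0; rewrite /= => ha hb.
rewrite valuationM pairingD.
move: ha hb; have /fineK <- := valuation_fin v an.
have /fineK <- := valuation_fin v bn.
rewrite -!EFinD !lee_fin => ha hb.
by rewrite mulrDr addrACA addr_ge0.
Qed.

Let cone_ringP (f : KM) : reflect
  (forall x, sigma x -> 0 <= x.2 -> forall u, term x (coef f u) u)
  (f \in cone_ring_pred).
Proof.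
apply: (iffP (asboolP _)) => h x sx x0 u.
  by rewrite /term; case: eqVneq => //= n0; apply: h.
by have := h x sx x0 u; rewrite /term => /orP[->//|].
Qed.

Lemma monom_cone_ring a u (f : KM) : f \in cone_ring_pred ->
  a = coef f u -> monom a u \in cone_ring_pred.
Proof.
move=> /cone_ringP h ->; apply/cone_ringP => x sx x0 w; rewrite coef_monom.
by case: eqP => [<-|_]; [rewrite mulr1n; apply: h | rewrite /term eqxx].
Qed.

Lemma gconst_cone_ring (r : valring v) :
  gconst (val r : K) \in cone_ring_pred.
Proof.
apply/cone_ringP => x sx x0 u; rewrite coef_monom /term.
case: (eqVneq 0 u) => [<-|_]; last by rewrite eqxx.
rewrite pairing0 adde0 mulr1n mule_ge0 ?orbT ?lee_fin //.
by have := valP r; rewrite inE.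
Qed.

Lemma cone_ring_subring_closed : subring_closed cone_ring_pred.
Proof.
have c1 : (1 : KM) \in cone_ring_pred by exact: (gconst_cone_ring 1).
have cM : {in cone_ring_pred &, forall f g, f * g \in cone_ring_pred}.
  move=> f g /cone_ringP hf /cone_ringP hg; apply/cone_ringP => x sx x0 u.
  have tD : forall a b, term x a u -> term x b u -> term x (a + b) u.
    by move=> a b; apply: termD.
  have t0 : term x 0 u by rewrite /term eqxx.
  rewrite coefM; apply: (big_ind (fun a => term x a u)) => // k _.
  apply: (big_ind (fun a => term x a u)) => // l _.
  case: eqP => [<-|_]; last exact: t0.
  by rewrite mulr1n; apply: termM => //; [apply: hf | apply: hg].
split=> // f g /cone_ringP hf /cone_ringP hg; apply/cone_ringP => x sx x0 u.
rewrite coefB; apply: termD => //; first exact: hf.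
by have := hg x sx x0 u; rewrite /term oppr_eq0 valuationN.
Qed.

HB.instance Definition _ :=
  GRing.isSubringClosed.Build KM cone_ring_pred cone_ring_subring_closed.

Record cone_ring : Type :=
  ConeRing { cone_ring_val : KM; _ : cone_ring_val \in cone_ring_pred }.

HB.instance Definition _ := [isSub for cone_ring_val].
HB.instance Definition _ := [Choice of cone_ring by <:].
HB.instance Definition _ := [SubChoice_isSubComNzRing of cone_ring by <:].

(* mathcomp integral domains come with a (here classical) unit test. *)
Definition cone_ring_unit : {pred cone_ring} :=
  [pred x | `[< exists y, y * x = 1 >]].

Definition cone_ring_inv (x : cone_ring) : cone_ring :=
  if pselect (exists y, y * x = 1) is left h then sval (cid h) else x.

Lemma cone_ring_mulVx : {in cone_ring_unit, left_inverse 1 cone_ring_inv *%R}.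
Proof.
move=> x /asboolP h; rewrite /cone_ring_inv; case: pselect => // h'.
exact: svalP (cid h').
Qed.

Lemma cone_ring_unitP (x y : cone_ring) : y * x = 1 -> x \in cone_ring_unit.
Proof. by move=> h; apply/asboolP; exists y. Qed.

Lemma cone_ring_inv_out : {in [predC cone_ring_unit], cone_ring_inv =1 id}.
Proof.
move=> x /asboolPn h; rewrite /cone_ring_inv; case: pselect => //.
Qed.

HB.instance Definition _ := GRing.ComNzRing_hasMulInverse.Build cone_ring
  cone_ring_mulVx cone_ring_unitP cone_ring_inv_out.

Lemma cone_ring_integral (x y : cone_ring) :
  x * y = 0 -> (x == 0) || (y == 0).
Proof.
move=> /(congr1 val); rewrite rmorphM rmorph0 => /grpalg_integral.
by case=> h; apply/orP; [left|right]; apply/eqP/val_inj; rewrite h rmorph0.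
Qed.

HB.instance Definition _ :=
  GRing.ComUnitRing_isIntegral.Build cone_ring cone_ring_integral.

Definition cone_structure (r : valring v) : cone_ring :=
  ConeRing (gconst_cone_ring r).

Definition cone_component (f : cone_ring) (u : M) : cone_ring :=
  ConeRing (monom_cone_ring (valP f) (erefl (coef (val f) u))).

(* The coaction of the M-grading: f |-> \sum_u f_u (x) chi^u.                 *)
Definition cone_coaction (f : cone_ring) : grpalg cone_ring M :=
  mkgrpalg (supp (val f)) (cone_component f).

Lemma cone_structure_zmod : zmod_morphism cone_structure.
Proof.
move=> r s; apply/val_inj/grpalgP => u.
by rewrite [RHS]coefB !coef_monom mulrnBl.
Qed.

Lemma cone_structure_monoid : monoid_morphism cone_structure.
Proof.
split=> [|r s]; apply/val_inj => //=.
by rewrite /gconst monomM addr0.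
Qed.

HB.instance Definition _ := GRing.isZmodMorphism.Build
  (valring v) cone_ring cone_structure cone_structure_zmod.
HB.instance Definition _ := GRing.isMonoidMorphism.Build
  (valring v) cone_ring cone_structure cone_structure_monoid.

Let gval : grpalg cone_ring M -> grpalg KM M := gmap val.
Let gval_inj : injective gval.
Proof. by apply: gmap_inj; [exact: rmorph0 | exact: val_inj]. Qed.

Lemma gmap_cone_coaction f : gmap val (cone_coaction f) = comul (val f).
Proof.
apply/grpalgP => u; rewrite coef_gmap ?rmorph0 // coef_comul coef_mk.
by case: ifPn => // /coef_outdom ->; rewrite rmorph0 monom0.
Qed.

Let gvalD f g : gval (f + g) = gval f + gval g.
Proof. by apply: gmapD; [exact: rmorph0 | exact: rmorphD]. Qed.

Lemma cone_coaction_zmod : zmod_morphism cone_coaction.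
Proof.
have D f g : cone_coaction (f + g) = cone_coaction f + cone_coaction g.
  apply: gval_inj; rewrite gvalD /gval !gmap_cone_coaction.
  by rewrite rmorphD comulD.
by move=> f g; apply/eqP; rewrite -subr_eq0 opprB addrA -D subrK subrr.
Qed.

Lemma cone_coaction_monoid : monoid_morphism cone_coaction.
Proof.
split=> [|f g]; apply: gval_inj; rewrite /gval ?gmap_cone_coaction.
  by rewrite rmorph1 comul1 gmap1 ?rmorph0 ?rmorph1.
rewrite gmapM ?gmap_cone_coaction ?rmorphM ?comulM //.
Qed.

HB.instance Definition _ := GRing.isZmodMorphism.Build
  cone_ring (grpalg cone_ring M) cone_coaction cone_coaction_zmod.
HB.instance Definition _ := GRing.isMonoidMorphism.Build
  cone_ring (grpalg cone_ring M) cone_coaction cone_coaction_monoid.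

Definition cone_scheme : affine_scheme_data :=
  @AffineSchemeData cone_ring cone_structure
    (val : {rmorphism cone_ring -> KM}) cone_coaction.

End ConeRing.

End Toric.

(* Main.v *)
(* An affine toric variety Y embeds, by its torus map, as an M-graded subring
   of K[M]. Choose homogeneous algebra generators a_i chi^(u_i) and let sigma be
   the cone of all (omega, s) with s >= 0 and <u_i, omega> + s v(a_i) >= 0. A
   monomial a chi^u of K[M]^sigma has <u, -> bounded below by - v(a) on the
   polyhedron at height 1; the bound is attained at a vertex w, and Farkas' lemma
   over the rationals writes a multiple of u as a sum of the u_i tight at w, so
   that a power of a chi^u lies in Y. As Y is normal, it equals K[M]^sigma.
   (If the polyhedron is empty, both rings contain K and only u matters.)

   A monomial chi^u with u in the normal cone of a vertex w has
   coefficients of valuation >= - <u, w>. If <u, w> is in the value group, this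
   bound is attained and Gordan's argument gives finite generation; conversely,
   when the value group is dense, finite generation forces <u, w> into it.

   K[M]^sigma is normal because it is completely integrally closed: the Gauss
   valuation attached to each point of sigma reduces this to K[M], where a
   fraction a / b almost integral over K[M] is expanded along lexicographically
   leading terms; Gauss valuations confine the exponents to a finite box. *)

From HB Require Import structures.
From mathcomp Require Import all_boot all_order all_algebra finmap generic_quotient.
From mathcomp Require Import all_classical reals constructive_ereal ereal.
From mathcomp Require Import ring lra zify.
Require Import Defs.
Set Implicit Arguments.
Unset Strict Implicit.
Unset Printing Implicit Defensive.
Import Order.TTheory GRing.Theory Num.Theory.
Local Open Scope classical_set_scope.
Local Open Scope ring_scope.

(** * Farkas' lemma and rational polyhedra *)

Section Farkas.
Context (E : realFieldType) (T : finType) (q : {rmorphism rat -> E}).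
Hypothesis q_gt0 : forall x, (0 < q x) = (0 < x).

Let q_ge0 x : 0 <= x -> 0 <= q x.
Proof. by rewrite le0r => /predU1P[->|]; rewrite ?rmorph0 // -q_gt0 => /ltW. Qed.

(* Bartl's induction: if the implication fails at x0 once the inequality i0 is
   dropped, project along x0 onto the hyperplane a i0 = 0. *)
Lemma farkas_seq (I : eqType) (s : seq I) (a : I -> T -> rat) (c : T -> E) :
  uniq s ->
  (forall x : T -> rat, (forall i, i \in s -> 0 <= \sum_j a i j * x j) ->
     0 <= \sum_j c j * q (x j)) ->
  exists2 w : I -> E, (forall i, 0 <= w i) &
    forall j, c j = \sum_(i <- s) w i * q (a i j).
Proof.
elim: s a c => [|i0 s IH] a c.
  move=> _ h; exists (fun=> 0) => // j; rewrite big_nil.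
  have e (y : rat) : \sum_k c k * q (if k == j then y else 0) = c j * q y.
    rewrite (bigD1 j) //= eqxx big1 ?addr0 // => k /negbTE ->.
    by rewrite rmorph0 mulr0.
  have h1 := h (fun k => if k == j then 1 else 0).
  have h2 := h (fun k => if k == j then -1 else 0).
  rewrite !e rmorphN rmorph1 in h1 h2.
  by apply/eqP; rewrite eq_le; move: (h1 (fun _ _ => ltac:(by []))) (h2 (fun _ _ => ltac:(by []))); lra.
move=> /= /andP[i0s us] h.
have [hs|/existsNP[x0 /not_implyP[x0s /negP]]] := pselect (forall x : T -> rat,
  (forall i, i \in s -> 0 <= \sum_j a i j * x j) -> 0 <= \sum_j c j * q (x j)).
  have [w w0 hw] := IH a c us hs.
  exists (fun i => if i == i0 then 0 else w i) => [i|j].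
    by case: eqP.
  rewrite big_cons eqxx mul0r add0r hw.
  apply: eq_big_seq => i iS; case: eqP => // ei; by rewrite -ei iS in i0s.
rewrite -ltNge => cx0.
pose d := \sum_j a i0 j * x0 j.
have d0 : d < 0.
  rewrite ltNge; apply/negP => d0; move: cx0; rewrite ltNge h // => i.
  by rewrite inE => /predU1P[->//|]; apply: x0s.
pose x1 j := x0 j / - d.
pose al i := \sum_j a i j * x1 j.
have al0 i : i \in s -> 0 <= al i.
  move=> /x0s hi; rewrite /al /x1; under eq_bigr do rewrite mulrA.
  by rewrite -mulr_suml mulr_ge0 // invr_ge0 oppr_ge0 ltW.
have ali0 : al i0 = -1.
  rewrite /al /x1; under eq_bigr do rewrite mulrA.
  by rewrite -mulr_suml -/d; field; rewrite lt_eqF.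
pose g := \sum_j c j * q (x1 j).
have g0 : g < 0.
  rewrite /g /x1; under eq_bigr do rewrite rmorphM mulrA.
  by rewrite -mulr_suml nmulr_rlt0 // q_gt0 invr_gt0 oppr_gt0.
have [|w w0 hw] := IH (fun i j => a i j + al i * a i0 j)
    (fun j => c j + g * q (a i0 j)) us.
  move=> x hx; pose b := \sum_j a i0 j * x j.
  have ey i : \sum_j a i j * (x j + b * x1 j) = \sum_j a i j * x j + b * al i.
    under eq_bigr do rewrite mulrDr.
    rewrite big_split /=; congr (_ + _); rewrite /al mulr_sumr.
    by apply: eq_bigr => j _; ring.
  have -> : \sum_j (c j + g * q (a i0 j)) * q (x j) =
            \sum_j c j * q (x j + b * x1 j).
    transitivity (\sum_j c j * q (x j) + g * q b).
      under eq_bigr do rewrite mulrDl.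
      rewrite big_split /=; congr (_ + _); rewrite /b rmorph_sum mulr_sumr.
      by apply: eq_bigr => j _; rewrite rmorphM mulrA.
    under [RHS]eq_bigr do rewrite rmorphD rmorphM mulrDr.
    rewrite big_split /=; congr (_ + _); rewrite /g mulr_suml.
    by apply: eq_bigr => j _; ring.
  apply: h => i; rewrite ey inE => /predU1P[->|iS].
    by rewrite ali0 -/b; lra.
  have := hx i iS; congr (0 <= _).
  under eq_bigr do rewrite mulrDl.
  rewrite big_split /=; congr (_ + _); rewrite /b mulr_suml.
  by apply: eq_bigr => j _; ring.
pose w1 := \sum_(i <- s) w i * q (al i) - g.
exists (fun i => if i == i0 then w1 else w i) => [i|j].
  case: eqP => // _; rewrite subr_ge0 (le_trans (ltW g0)) // big_seq.
  by apply: sumr_ge0 => i' i's; rewrite mulr_ge0 // q_ge0 // al0.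
have := hw j; move=> /(canRL (addrK _)) ->.
rewrite big_cons eqxx /w1.
have -> : \sum_(i <- s) (if i == i0 then w1 else w i) * q (a i j) =
          \sum_(i <- s) w i * q (a i j).
  apply: eq_big_seq => i iS; case: eqP => // ei; by rewrite -ei iS in i0s.
under eq_bigr do rewrite rmorphD rmorphM mulrDr.
rewrite big_split /= mulrBl mulr_suml.
have -> : \sum_(i <- s) w i * (q (al i) * q (a i0 j)) =
          \sum_(i <- s) w i * q (al i) * q (a i0 j).
  by apply: eq_bigr => i _; rewrite mulrA.
by rewrite mulr_suml; ring.
Qed.

Lemma farkas (I : finType) (a : I -> T -> rat) (c : T -> E) :
  (forall x : T -> rat, (forall i, 0 <= \sum_j a i j * x j) ->
     0 <= \sum_j c j * q (x j)) ->
  exists2 w : I -> E, (forall i, 0 <= w i) &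
    forall j, c j = \sum_i w i * q (a i j).
Proof.
move=> h; apply: (@farkas_seq I (index_enum I) a c); first exact: index_enum_uniq.
by move=> x hx; apply: h => i; apply: hx; rewrite mem_index_enum.
Qed.

End Farkas.

Lemma ratr_sum (R : numFieldType) (I : Type) (s : seq I) (P : pred I) (F : I -> rat) :
  ratr (\sum_(i <- s | P i) F i) = \sum_(i <- s | P i) ratr (F i) :> R.
Proof. exact: (rmorph_sum (ratr : {rmorphism rat -> R})). Qed.

Section Pairing.
Context (R : realType) (n : nat).
Implicit Types (u : 'rV[int]_n) (x d : 'rV[R]_n).

Lemma pairing_line u x d t : pairing u (x + t *: d) = pairing u x + t * pairing u d.
Proof.
rewrite /pairing mulr_sumr -big_split; apply: eq_bigr => i _.
rewrite !mxE /=; ring.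
Qed.

Lemma pairingB u x d : pairing u (x - d) = pairing u x - pairing u d.
Proof. by rewrite -scaleN1r pairing_line mulN1r. Qed.

Lemma pairingZr u x t : pairing u (t *: x) = t * pairing u x.
Proof. by rewrite -[t *: x]add0r pairing_line /pairing big1 ?add0r // => i _; rewrite mxE mulr0. Qed.

Lemma pairing0r u : pairing u (0 : 'rV[R]_n) = 0.
Proof. by rewrite -(scale0r 0) pairingZr mul0r. Qed.

Lemma pairingNr u x : pairing u (- x) = - pairing u x.
Proof. by rewrite -scaleN1r pairingZr mulN1r. Qed.

Lemma pairingN u x : pairing (- u) x = - pairing u x.
Proof.
by rewrite /pairing -sumrN; apply: eq_bigr => i _; rewrite mxE intrN mulNr.
Qed.

Lemma pairing_sum (I : Type) (s : seq I) (P : pred I) (F : I -> 'rV[int]_n) x :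
  pairing (\sum_(i <- s | P i) F i) x = \sum_(i <- s | P i) pairing (F i) x.
Proof.
by apply: (big_morph (fun u => pairing u x)) => [u w|]; rewrite ?pairingD ?pairing0.
Qed.

Lemma pairingMn u m x : pairing (u *+ m) x = m%:R * pairing u x.
Proof.
elim: m => [|m IH]; first by rewrite mulr0n pairing0 mul0r.
by rewrite mulrS pairingD IH -natr1; ring.
Qed.

Lemma pairing_ratr (I : finType) (u : I -> 'rV[int]_n) (l : I -> rat) u0 x :
  (forall j, (u0 0 j)%:~R = \sum_i l i * (u i 0 j)%:~R) ->
  pairing u0 x = \sum_i ratr (l i) * pairing (u i) x.
Proof.
move=> h; rewrite /pairing; under [RHS]eq_bigr do rewrite mulr_sumr.
rewrite exchange_big; apply: eq_bigr => j _.
rewrite -[(u0 0 j)%:~R](ratr_int R) h ratr_sum mulr_suml.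
by apply: eq_bigr => i _; rewrite rmorphM /= ratr_int mulrA.
Qed.

Lemma pairing_delta j x : pairing (delta_mx 0 j) x = x 0 j.
Proof.
rewrite /pairing (bigD1 j) //= mxE !eqxx mul1r big1 ?addr0 // => i ij.
by rewrite mxE (negbTE ij) mul0r.
Qed.

End Pairing.

Lemma finite_pos_bound (R : realFieldType) (I : finType) (e : I -> R) :
  (forall i, 0 < e i) -> exists2 t, 0 < t & forall i, t <= e i.
Proof.
move=> e0; suff [t t0 ht] : exists2 t, 0 < t & forall i, i \in index_enum I -> t <= e i.
  by exists t => // i; apply: ht; rewrite mem_index_enum.
elim: (index_enum I) => [|i s [t t0 ht]]; first by exists 1.
exists (Num.min t (e i)); first by rewrite lt_min t0 e0.
move=> j; rewrite inE ge_min => /predU1P[->|/ht ->//]; by rewrite lexx orbT.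
Qed.

Lemma seq_argmin (R : realDomainType) (T : eqType) (s : seq T) (Q : T -> Prop) (f : T -> R) :
  (exists2 x, x \in s & Q x) ->
  exists2 x, Q x & forall y, y \in s -> Q y -> f x <= f y.
Proof.
elim: s => [[x]//|a s IH] [x xs Qx].
have [hs|hs] := pselect (exists2 x, x \in s & Q x).
  have [y Qy hy] := IH hs; have [[Qa fa]|ha] := pselect (Q a /\ f a < f y).
    exists a => // z; rewrite inE => /predU1P[->//|zs Qz].
    by rewrite (le_trans (ltW fa)) // hy.
  exists y => // z; rewrite inE => /predU1P[->|]; last exact: hy.
  by move=> Qa; rewrite leNgt; apply/negP => fa; apply: ha.
exists x => // z; rewrite inE => /predU1P[->|zs Qz].
  by move: xs; rewrite inE => /predU1P[->//|xs]; case: hs; exists x.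
by case: hs; exists z.
Qed.

Section RationalCones.
Context (R : realType) (n : nat) (I : finType) (u : I -> 'rV[int]_n).

Lemma cone_rat (A : pred I) (u0 : 'rV[int]_n) :
  (forall d : 'rV[R]_n, (forall i, A i -> 0 <= pairing (u i) d) -> 0 <= pairing u0 d) ->
  exists l : I -> rat, [/\ forall i, 0 <= l i, forall i, l i != 0 -> A i
    & forall j, (u0 0 j)%:~R = \sum_i l i * (u i 0 j)%:~R].
Proof.
move=> h.
have hd (w : 'rV[int]_n) (x : 'I_n -> rat) : pairing w (\row_j ratr (x j) : 'rV[R]_n) =
    ratr (\sum_j (w 0 j)%:~R * x j).
  rewrite ratr_sum /pairing; apply: eq_bigr => j _.
  by rewrite mxE -(ratr_int R) -rmorphM.
have [|w w0 hw] := @farkas rat 'I_n idfun (fun=> erefl) I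
  (fun i j => if A i then (u i 0 j)%:~R else 0) (fun j => (u0 0 j)%:~R).
  move=> x hx; have := h (\row_j ratr (x j)).
  rewrite hd ler0q; apply => i Ai; rewrite hd ler0q.
  by have := hx i; rewrite Ai.
exists (fun i => if A i then w i else 0); split => [i|i|j].
- by case: ifP.
- by case: ifP; rewrite ?eqxx.
- by rewrite hw; apply: eq_bigr => i _ /=; case: ifP; rewrite ?mulr0 ?mul0r.
Qed.

Lemma empty_polyhedron_cert (c : I -> R) :
  (forall w : 'rV[R]_n, ~ forall i, 0 <= pairing (u i) w + c i) ->
  exists l : I -> rat, [/\ forall i, 0 <= l i,
      forall j, \sum_i l i * (u i 0 j)%:~R = 0 & \sum_i ratr (l i) * c i < 0].
Proof.
move=> P0; apply: contrapT => nl.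
pose a (s : I + ('I_n * bool)) (i : I) : rat := match s with
  | inl i' => (i' == i)%:R | inr (j, b) => (-1) ^+ b * (u i 0 j)%:~R end.
have q0 (x : rat) : (0 < ratr x :> R) = (0 < x) by rewrite ltr0q.
have [|w w0 hw] := @farkas R I (ratr : {rmorphism rat -> R}) q0 _ a c.
  move=> x hx; rewrite leNgt; apply/negP => lt0; apply: nl; exists x; split.
  - move=> i; have := hx (inl i); rewrite /= (bigD1 i) //= eqxx mul1r.
    by rewrite big1 ?addr0 // => i'; rewrite eq_sym => /negbTE ->; rewrite mul0r.
  - move=> j; have h1 := hx (inr (j, false)); have h2 := hx (inr (j, true)).
    move: h1 h2; rewrite /= expr0 expr1.
    under eq_bigr do rewrite mul1r.
    under [in X in _ -> X -> _]eq_bigr do rewrite mulN1r mulNr.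
    rewrite sumrN oppr_ge0 => h1 h2; apply/eqP; rewrite eq_le.
    by under eq_bigr do rewrite mulrC; rewrite h1 h2.
  - by under eq_bigr do rewrite mulrC.
apply: (P0 (\row_j (w (inr (j, true)) - w (inr (j, false))))) => i.
rewrite hw big_sumType /= (bigD1 i) //= eqxx rmorph1 mulr1.
rewrite big1 ?addr0; last by move=> i' /negbTE ->; rewrite rmorph0 mulr0.
have -> : \sum_(p : 'I_n * bool) w (inr p) *
    ratr (let '(j, b) := p in (-1) ^+ b * (u i 0 j)%:~R) =
    - pairing (u i) (\row_j (w (inr (j, true)) - w (inr (j, false)))).
  pose G j b := w (inr (j, b)) * ratr ((-1) ^+ b * (u i 0 j)%:~R).
  rewrite (eq_bigr (fun p => G p.1 p.2)) => [|[]//].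
  rewrite -(pair_bigA _ G) /G.
  rewrite /pairing -sumrN; apply: eq_bigr => j _.
  rewrite big_bool /= expr1 expr0 mulN1r mul1r rmorphN /= ratr_int mxE; ring.
by rewrite addrCA subrr addr0.
Qed.

End RationalCones.

Lemma clear_denominators (I : finType) (l : I -> rat) : (forall i, 0 <= l i) ->
  exists N : nat, exists m : I -> nat, (0 < N)%N /\ forall i, N%:R * l i = (m i)%:R.
Proof.
move=> l0; pose N := (\prod_i `|denq (l i)|)%N.
exists N, (fun i => (`|numq (l i)| * \prod_(j | j != i) `|denq (l j)|)%N).
split; first by rewrite prodn_gt0 // => i; rewrite absz_gt0 denq_neq0.
move=> i; rewrite /N (bigD1 i) //= !natrM mulrAC; congr (_ * _).
rewrite -[X in _ * X]divq_num_den mulrCA.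
rewrite !natr_absz ger0_norm ?denq_ge0 // ger0_norm ?numq_ge0 //.
by rewrite divff ?mulr1 // intr_eq0 denq_neq0.
Qed.

Lemma spanning_int (R : realType) n (I : finType) (u : I -> 'rV[int]_n) (u0 : 'rV[int]_n) :
  (forall d : 'rV[R]_n, (forall i, pairing (u i) d = 0) -> d = 0) ->
  exists N : nat, exists2 z : I -> int, (0 < N)%N & u0 *+ N = \sum_i u i *~ z i.
Proof.
move=> sp.
have [|l [l0 _ hl]] := @cone_rat R n (I * bool)%type (fun p => (-1) ^+ p.2 *: u p.1) xpredT u0.
  move=> d hd; rewrite (sp d) ?pairing0r // => i; apply/eqP; rewrite eq_le.
  have := hd (i, false) isT; have := hd (i, true) isT.
  by rewrite /= expr0 expr1 scale1r scaleN1r pairingN oppr_ge0 => -> ->.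
have [N [m [N0 hm]]] := clear_denominators l0.
exists N, (fun i => (m (i, false))%:Z - (m (i, true))%:Z) => //.
apply/rowP => j; rewrite mulmxnE summxE; apply: (@intr_inj rat).
rewrite rmorphMn /= -mulr_natl hl mulr_sumr.
pose G i b : rat := (m (i, b))%:R * (((-1) ^+ b *: u i) 0 j)%:~R.
rewrite (eq_bigr (fun p => G p.1 p.2)) => [|[i b] _]; last by rewrite mulrA hm.
rewrite -(pair_bigA _ G) /G.
rewrite rmorph_sum; apply: eq_bigr => i _.
rewrite big_bool /= expr0 expr1 scale1r scaleN1r mxE -scaler_int mxE /= intrM.
by rewrite intz intrB intrN /=; ring.
Qed.

Section Polyhedron.
Context (R : realType) (n k : nat) (u : 'I_k -> 'rV[int]_n) (c : 'I_k -> R).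
Implicit Types (w d : 'rV[R]_n).

Definition polyhedron : set 'rV[R]_n := [set w | forall i, 0 <= pairing (u i) w + c i].

Definition tight w : pred 'I_k := fun i => pairing (u i) w + c i == 0.

Definition basic w : Prop :=
  polyhedron w /\ forall d, (forall i, tight w i -> pairing (u i) d = 0) -> d = 0.

Definition spanning : Prop := forall d, (forall i, pairing (u i) d = 0) -> d = 0.

Lemma feasible_dir w d : polyhedron w ->
  (forall i, tight w i -> 0 <= pairing (u i) d) ->
  exists2 t, 0 < t & polyhedron (w + t *: d).
Proof.
move=> Pw hd.
pose e i := if tight w i then 1 else (pairing (u i) w + c i) / (1 + `|pairing (u i) d|).
have [|t t0 ht] := @finite_pos_bound R _ e.
  move=> i; rewrite /e; case: ifPn => // ti; apply: divr_gt0.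
    by rewrite lt0r ti Pw.
  by rewrite ltr_pwDl.
exists t => // i; rewrite pairing_line; have := ht i; rewrite /e.
case: ifPn => [ti _|ti].
  by move: (ti) => /eqP; have := mulr_ge0 (ltW t0) (hd i ti); lra.
have p0 : 0 < 1 + `|pairing (u i) d| by rewrite ltr_pwDl.
rewrite ler_pdivlMr // mulrDr mulr1 => h.
have : t * - pairing (u i) d <= t * `|pairing (u i) d|.
  by rewrite ler_pM2l // -normrN ler_norm.
by rewrite mulrN; lra.
Qed.

Lemma vertex_basic w : vertex polyhedron w <-> basic w.
Proof.
split=> [[a [b [hb hw]]]|[Pw hw]].
  have [Pw wb] : [set x | polyhedron x /\ \sum_(i < n) a 0 i * x 0 i = b] w by rewrite hw.
  split=> // d hd.
  have al (x y : 'rV[R]_n) t : \sum_(i < n) a 0 i * (x + t *: y) 0 i =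
      \sum_(i < n) a 0 i * x 0 i + t * \sum_(i < n) a 0 i * y 0 i.
    rewrite mulr_sumr -big_split; apply: eq_bigr => i _; rewrite !mxE /=; ring.
  have [t t0 Pt] : exists2 t, 0 < t & polyhedron (w + t *: d).
    by apply: feasible_dir => // i /hd ->.
  have [s s0 Ps] : exists2 t, 0 < t & polyhedron (w + t *: - d).
    by apply: feasible_dir => // i /hd; rewrite pairingNr => ->; rewrite oppr0.
  have ad : \sum_(i < n) a 0 i * d 0 i = 0.
    have := hb _ Pt; have := hb _ Ps; rewrite scalerN -scaleNr !al wb.
    rewrite !lerDl mulNr oppr_ge0 pmulr_rle0 // pmulr_rge0 // => h1 h2.
    by apply/eqP; rewrite eq_le h1 h2.
  have : [set x | polyhedron x /\ \sum_(i < n) a 0 i * x 0 i = b] (w + t *: d).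
    by split; rewrite ?al ?ad ?mulr0 ?addr0.
  rewrite hw => /eqP; rewrite -subr_eq0 addrC addKr scaler_eq0 gt_eqF //= => /eqP //.
exists (\row_j \sum_(i | tight w i) (u i 0 j)%:~R), (- \sum_(i | tight w i) c i).
have ea (x : 'rV[R]_n) : \sum_(j < n) (\row_j \sum_(i | tight w i) (u i 0 j)%:~R) 0 j * x 0 j =
    \sum_(i | tight w i) pairing (u i) x.
  under eq_bigr do rewrite mxE mulr_suml.
  by rewrite exchange_big.
split=> [x Px|].
  rewrite ea -sumrN; apply: ler_sum => i _.
  by have := Px i; lra.
apply/seteqP; split=> x /=; last first.
  move=> ->; split=> //; rewrite ea -sumrN; apply: eq_bigr => i /eqP; lra.
move=> [Px]; rewrite ea => /eqP; rewrite -addr_eq0 -big_split /= => h0.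
apply/eqP; rewrite -subr_eq0; apply/eqP/hw => i ti; rewrite pairingB.
move: h0; rewrite psumr_eq0 => [/allP/(_ i)|j _]; last exact: Px.
rewrite mem_index_enum ti => /(_ isT)/eqP.
by move: ti => /eqP; lra.
Qed.

Lemma basic_inj w w' : basic w -> tight w =1 tight w' -> w = w'.
Proof.
move=> [_ hw] e; apply/eqP; rewrite -subr_eq0; apply/eqP/hw => i ti.
rewrite pairingB; move: (ti); rewrite e => /eqP; move: ti => /eqP; lra.
Qed.

Lemma basic_seq : exists s : seq 'rV[R]_n, forall w, basic w -> w \in s.
Proof.
exists [seq xget 0 [set w | basic w /\ tight w =1 (fun i => i \in A)] | A : {set 'I_k}].
move=> w bw; apply/mapP; exists [set i | tight w i]%SET; first by rewrite mem_enum.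
case: xgetP => [w' _ [bw' e]|/(_ w) []]; last by split=> // i; rewrite inE.
by apply: basic_inj => // i; rewrite e inE.
Qed.

Section Optimum.
Variables (u0 : 'rV[int]_n) (b : R).
Hypothesis ub : forall w, polyhedron w -> b <= pairing u0 w.
Hypothesis sp : spanning.

Lemma tighten w d i : polyhedron w -> (forall i, tight w i -> pairing (u i) d = 0) ->
  pairing u0 d <= 0 -> pairing (u i) d < 0 ->
  exists w', [/\ polyhedron w', pairing u0 w' <= pairing u0 w,
    forall j, tight w j -> tight w' j & exists2 j, ~~ tight w j & tight w' j].
Proof.
move=> Pw hd u0d id.
have [i0 i0d imin] := @Order.TotalTheory.arg_minP _ _ _ i (fun i => pairing (u i) d < 0)
  (fun i => (pairing (u i) w + c i) / - pairing (u i) d) id.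
set t := (pairing (u i0) w + c i0) / - pairing (u i0) d in imin.
have t0 : 0 <= t by rewrite /t mulr_ge0 // invr_ge0 oppr_ge0 ltW.
have ti0 : tight (w + t *: d) i0.
  rewrite /tight pairing_line /t; apply/eqP; field.
  by rewrite lt_eqF.
exists (w + t *: d); split.
- move=> j; rewrite pairing_line; have [jd|jd] := ltP (pairing (u j) d) 0.
    have := imin _ jd; rewrite ler_pdivlMr ?oppr_gt0 // mulrN; lra.
  by have := mulr_ge0 t0 jd; have := Pw j; lra.
- by rewrite pairing_line gerDl mulr_ge0_le0.
- by move=> j tj; rewrite /tight pairing_line hd // mulr0 addr0.
- exists i0 => //; apply/negP => /hd; by move/eqP; rewrite lt_eqF.
Qed.

Lemma exists_basic w : polyhedron w ->
  exists2 w', basic w' & pairing u0 w' <= pairing u0 w.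
Proof.
have [m] := ubnP #|[predC tight w]|; elim: m w => // m IH w hm Pw.
have [bw|nb] := pselect (basic w); first by exists w.
have [d [hd d0]] : exists d, (forall i, tight w i -> pairing (u i) d = 0) /\ d <> 0.
  apply: contrapT => nd; apply: nb; split=> // d hd; apply: contrapT => d0.
  by apply: nd; exists d.
wlog u0d : d hd d0 / pairing u0 d <= 0.
  move=> wl; case: (leP (pairing u0 d) 0) => [|p]; first exact: wl.
  apply: (wl (- d)); rewrite ?pairingNr ?oppr_le0 ?ltW //.
    by move=> i /hd; rewrite pairingNr => ->; rewrite oppr0.
  by move/eqP; rewrite oppr_eq0 => /eqP.
suff [d' [i [hd' u0d' id]]] : exists d' i, [/\ forall i, tight w i -> pairing (u i) d' = 0,
    pairing u0 d' <= 0 & pairing (u i) d' < 0].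
  have [w' [Pw' le' tt [j tj tj']]] := tighten Pw hd' u0d' id.
  have [|//|w'' bw'' le''] := IH w'; last by exists w'' => //; apply: le_trans le'.
  rewrite -ltnS (leq_trans _ hm) // ltnS; apply: proper_card; apply/properP; split.
    by apply/fintype.subsetP => l; rewrite !inE; apply: contra; apply: tt.
  by exists j; rewrite !inE //; apply/negPn.
have [[i id]|nid] := pselect (exists i, pairing (u i) d < 0).
  by exists d, i; split.
have pd i : 0 <= pairing (u i) d by rewrite leNgt; apply/negP => id; apply: nid; exists i.
have u00 : pairing u0 d = 0.
  apply/eqP; rewrite eq_le u0d /= leNgt; apply/negP => lt0.
  pose t := (pairing u0 w - b + 1) / - pairing u0 d.
  have t0 : 0 <= t.
    by rewrite mulr_ge0 ?invr_ge0 ?oppr_ge0 //; have := ub Pw; lra.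
  have /ub : polyhedron (w + t *: d).
    by move=> i; rewrite pairing_line; have := mulr_ge0 t0 (pd i); have := Pw i; lra.
  rewrite pairing_line.
  have -> : t * pairing u0 d = - (pairing u0 w - b + 1).
    by rewrite /t; field; rewrite lt_eqF.
  lra.
have [i id] : exists i, pairing (u i) d != 0.
  apply: contrapT => ni; apply: d0; apply: sp => i; apply/eqP; apply: contrapT => id.
  by apply: ni; exists i; apply/negP.
exists (- d), i; split.
- by move=> j /hd; rewrite pairingNr => ->; rewrite oppr0.
- by rewrite pairingNr u00 oppr0.
- by rewrite pairingNr oppr_lt0 lt0r id pd.
Qed.

Lemma optimal_basic : polyhedron !=set0 ->
  exists2 w, basic w & forall w', polyhedron w' -> pairing u0 w <= pairing u0 w'.
Proof.
move=> [w1 Pw1]; have [s hs] := basic_seq.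
have [w0 bw0 _] := exists_basic Pw1.
have [|w bw hw] := @seq_argmin R _ s basic (fun w => pairing u0 w).
  by exists w0; [apply: hs|].
exists w => // w' Pw'; have [w'' bw'' le''] := exists_basic Pw'.
by apply: le_trans le''; apply: hw => //; apply: hs.
Qed.

End Optimum.

Lemma optimal_cone (u0 : 'rV[int]_n) w : polyhedron w ->
  (forall w', polyhedron w' -> pairing u0 w <= pairing u0 w') ->
  exists l : 'I_k -> rat, [/\ forall i, 0 <= l i, forall i, l i != 0 -> tight w i
    & forall j, (u0 0 j)%:~R = \sum_i l i * (u i 0 j)%:~R].
Proof.
move=> Pw hw; apply: (@cone_rat R) => d hd.
have [t t0 /hw] := feasible_dir Pw hd.
by rewrite pairing_line lerDl pmulr_rge0.
Qed.

Lemma tight_value (u0 : 'rV[int]_n) w (l : 'I_k -> rat) :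
  (forall i, l i != 0 -> tight w i) ->
  (forall j, (u0 0 j)%:~R = \sum_i l i * (u i 0 j)%:~R) ->
  pairing u0 w = - \sum_i ratr (l i) * c i.
Proof.
move=> tl hl; rewrite (pairing_ratr w hl) -sumrN; apply: eq_bigr => i _.
have [->|/tl/eqP h] := eqVneq (l i) 0; first by rewrite rmorph0 !mul0r oppr0.
by rewrite -mulrN; congr (_ * _); lra.
Qed.

End Polyhedron.

(** * Real valuations and Gauss valuations of Laurent polynomials *)

Section RealValuation.
Context (K : fieldType) (R : realType) (v : valuation K R).
Implicit Types x y : K.

Definition vr x : R := fine (v x).

Lemma vrE x : x != 0 -> v x = (vr x)%:E.
Proof. by move=> x0; rewrite /vr fineK // valuation_fin. Qed.

Lemma vrM x y : x != 0 -> y != 0 -> vr (x * y) = vr x + vr y.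
Proof.
move=> x0 y0; have := valuationM v x y.
by rewrite !vrE ?mulf_neq0 // -EFinD => -[].
Qed.

Lemma vr1 : vr 1 = 0.
Proof. by rewrite /vr valuation1. Qed.

Lemma vrV x : x != 0 -> vr x^-1 = - vr x.
Proof.
move=> x0; apply/eqP; rewrite -addr_eq0 -vrM ?invr_eq0 //.
by rewrite mulVf // vr1.
Qed.

Lemma vrX x m : x != 0 -> vr (x ^+ m) = m%:R * vr x.
Proof.
move=> x0; elim: m => [|m IH]; first by rewrite expr0 vr1 mul0r.
by rewrite exprS vrM ?expf_neq0 // IH -natr1; ring.
Qed.

Lemma vr_prod (I : Type) (s : seq I) (P : pred I) (F : I -> K) :
  (forall i, F i != 0) ->
  vr (\prod_(i <- s | P i) F i) = \sum_(i <- s | P i) vr (F i).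
Proof.
move=> F0; elim: s => [|i s IH]; first by rewrite !big_nil vr1.
rewrite !big_cons; case: ifP => // _; rewrite vrM ?IH //.
by apply: (big_ind (fun x => x != 0)) => [||//]; [exact: oner_neq0 | exact: mulf_neq0].
Qed.

Lemma vrD x y : x != 0 -> y != 0 -> x + y != 0 -> Num.min (vr x) (vr y) <= vr (x + y).
Proof.
move=> x0 y0 xy0; have := valuationD v x y; rewrite !vrE //.
by rewrite -EFin_min lee_fin.
Qed.

Lemma vrN x : vr (- x) = vr x.
Proof. by rewrite /vr valuationN. Qed.

Lemma vrD_gt x y : x != 0 -> y != 0 -> vr x < vr y ->
  x + y != 0 /\ vr (x + y) = vr x.
Proof.
move=> x0 y0 xy; have xy0 : x + y != 0.
  by apply: contraTneq xy => /eqP; rewrite addr_eq0 => /eqP ->; rewrite vrN ltxx.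
split=> //; have := vrD x0 y0 xy0; rewrite (min_idPl (ltW xy)) => h.
apply/eqP; rewrite eq_le h andbT.
have yN : - y != 0 by rewrite oppr_eq0.
have := vrD xy0 yN; rewrite addrK => /(_ x0); rewrite vrN ge_min => /orP[//|].
by move=> /le_lt_trans/(_ xy); rewrite ltxx.
Qed.

Lemma valringE x : (x \in valring_pred v) = (x == 0) || (0 <= vr x).
Proof.
rewrite inE; have [->|x0] := eqVneq x 0; first by rewrite valuation0 leey.
by rewrite vrE // lee_fin.
Qed.

Lemma value_groupP x : x != 0 -> value_group v (vr x).
Proof. by move=> x0; exists x => //; rewrite vrE. Qed.

Lemma value_groupE r : value_group v r -> exists2 x, x != 0 & vr x = r.
Proof. by move=> [x x0 e]; exists x => //; rewrite /vr e. Qed.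

Lemma value_group0 : value_group v 0.
Proof. by rewrite -vr1; apply: value_groupP; apply: oner_neq0. Qed.

Lemma value_groupD r s : value_group v r -> value_group v s -> value_group v (r + s).
Proof.
move=> /value_groupE[x x0 <-] /value_groupE[y y0 <-]; rewrite -vrM //.
by apply: value_groupP; rewrite mulf_neq0.
Qed.

Lemma value_groupN r : value_group v r -> value_group v (- r).
Proof.
by move=> /value_groupE[x x0 <-]; rewrite -vrV //; apply: value_groupP; rewrite invr_eq0.
Qed.

Lemma value_groupB r s : value_group v r -> value_group v s -> value_group v (r - s).
Proof. by move=> hr hs; apply: value_groupD => //; apply: value_groupN. Qed.

Lemma value_groupMz r z : value_group v r -> value_group v (z%:~R * r).
Proof.
move=> hr; have hn m : value_group v (m%:R * r).
  elim: m => [|m IH]; first by rewrite mul0r; apply: value_group0.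
  by rewrite -natr1 mulrDl mul1r; apply: value_groupD.
case: z => m; first exact: hn.
by rewrite NegzE rmorphN /= mulNr; apply: value_groupN; apply: hn.
Qed.

Lemma value_group_sum (I : Type) (s : seq I) (F : I -> R) :
  (forall i, value_group v (F i)) -> value_group v (\sum_(i <- s) F i).
Proof.
move=> h; apply: (big_ind (value_group v)) => //; first exact: value_group0.
exact: value_groupD.
Qed.

Lemma value_group_pairing n (u : 'rV[int]_n) (w : 'rV[R]_n) :
  (forall i, value_group v (w 0 i)) -> value_group v (pairing u w).
Proof. by move=> h; apply: value_group_sum => i; apply: value_groupMz. Qed.

Lemma value_group_dense : ~ discrete_valuation v ->
  (exists2 x, x != 0 & vr x != 0) ->
  forall e, 0 < e -> exists2 r, value_group v r & 0 < r < e.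
Proof.
move=> nd [x0 x00 vx0] e e0; apply: contrapT => ne; apply: nd.
pose G := [set r | value_group v r /\ 0 < r].
have G0 : G !=set0.
  exists `|vr x0|; split; last by rewrite normr_gt0.
  have [_|_] := ger0P (vr x0); first exact: value_groupP.
  by apply: value_groupN; apply: value_groupP.
have Ge r : G r -> e <= r.
  by move=> [gr r0]; rewrite leNgt; apply/negP => re; apply: ne; exists r; rewrite ?r0.
have Glb : has_inf G by split=> //; exists e => r /Ge.
have infe : e <= inf G by apply: lb_le_inf => // r /Ge.
have i0 : 0 < inf G by apply: lt_le_trans infe.
have [g Gg glt] : exists2 g, G g & g < inf G + inf G.
  by apply: inf_adherent.
have gmin r : G r -> g <= r.
  move=> Gr; rewrite leNgt; apply/negP => rg.
  have : G (g - r) by split; [apply: value_groupB; [case: Gg|case: Gr]|rewrite subr_gt0].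
  by move=> /(ge_inf Glb.2); have := ge_inf Glb.2 Gr; lra.
exists g; split; first by case: Gg.
have g0 : 0 < g by case: Gg.
apply/seteqP; split=> [r vr0|r [z _ <-]]; last first.
  by apply: value_groupMz; case: Gg.
exists (Num.floor (r / g)) => //; apply/eqP; rewrite eq_sym -subr_eq0.
have hf : (Num.floor (r / g))%:~R * g <= r by rewrite -ler_pdivlMr // ge_floor.
have hc : r < (Num.floor (r / g) + 1)%:~R * g by rewrite -ltr_pdivrMr // lt_succ_floor.
rewrite eq_le subr_ge0 hf andbT leNgt; apply/negP => h.
have : G (r - (Num.floor (r / g))%:~R * g).
  by split=> //; apply: value_groupB => //; apply: value_groupMz; case: Gg.
by move=> /gmin; move: hc; rewrite intrD mulrDl mul1r; lra.
Qed.

End RealValuation.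

Section LexicographicOrder.
Context (n : nat).
Implicit Types u w d : 'rV[int]_n.

Definition lexpos d := exists i : 'I_n, (forall j : 'I_n, (j < i)%N -> d 0 j = 0) /\ 0 < d 0 i.

Lemma lexpos0 : ~ lexpos 0.
Proof. by case=> i [_]; rewrite mxE ltxx. Qed.

Lemma lexposD d e : lexpos d -> lexpos e -> lexpos (d + e).
Proof.
move=> [i [hi di]] [l [hl el]]; have [il|li|il] := ltngtP i l.
- exists i; split=> [j ji|]; rewrite mxE.
    by rewrite hi // hl ?addr0 // (ltn_trans ji).
  by rewrite hl // addr0.
- exists l; split=> [j jl|]; rewrite mxE.
    by rewrite hl // hi ?addr0 // (ltn_trans jl).
  by rewrite hi // add0r.
- have {}il : i = l by apply: val_inj.
  subst l; exists i; split=> [j ji|]; rewrite mxE; last exact: addr_gt0.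
  by rewrite hi // hl ?addr0.
Qed.

Lemma lexpos_total d : d != 0 -> lexpos d \/ lexpos (- d).
Proof.
move=> d0; have [i0 hi0] : exists i, d 0 i != 0.
  apply/existsP; apply: contra_neqT d0; rewrite negb_exists => /forallP h.
  by apply/rowP => i; rewrite mxE; apply/eqP; rewrite -[_ == _]negbK.
have [i hi mi] := @arg_minnP _ i0 (fun i => d 0 i != 0) val hi0.
have eqi (j : 'I_n) : (j < i)%N -> d 0 j = 0.
  by move=> ji; apply/eqP; apply: contraLR ji => hj; rewrite -leqNgt mi.
have [h|h|h] := ltgtP (d 0 i) 0; last by rewrite h eqxx in hi.
  by right; exists i; split=> [j /eqi|]; rewrite mxE ?oppr_gt0 // => ->; rewrite oppr0.
by left; exists i; split=> // j /eqi.
Qed.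

Lemma lexpos_max (s : seq 'rV[int]_n) (Q : 'rV[int]_n -> Prop) :
  (exists2 x, x \in s & Q x) ->
  exists x, [/\ x \in s, Q x & forall y, y \in s -> Q y -> y != x -> lexpos (x - y)].
Proof.
elim: s => [[x]//|a s IH] ex.
have [hs|hs] := pselect (exists2 x, x \in s & Q x); last first.
  have [x xs Qx] := ex; move: xs; rewrite inE => /predU1P[xa|xs]; last by case: hs; exists x.
  subst x; exists a; split; rewrite ?inE ?eqxx // => y; rewrite inE => /predU1P[->|ys Qy].
    by rewrite eqxx.
  by case: hs; exists y.
have [x [xs Qx hx]] := IH hs.
have [[Qa ax]|na] := pselect (Q a /\ lexpos (a - x)).
  exists a; split; rewrite ?inE ?eqxx // => y; rewrite inE => /predU1P[->|ys Qy _].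
    by rewrite eqxx.
  have [->//|yx] := eqVneq y x; have -> : a - y = a - x + (x - y) by rewrite addrA subrK.
  by apply: lexposD => //; apply: hx.
exists x; split; rewrite ?inE ?xs ?orbT // => y; rewrite inE => /predU1P[->|]; last exact: hx.
move=> Qa; rewrite -subr_eq0 => /lexpos_total[h|]; last by rewrite opprB.
by case: na.
Qed.

End LexicographicOrder.

Lemma int_box n (N : nat) : exists s : seq 'rV[int]_n,
  forall m : 'rV[int]_n, (forall i, `|m 0 i| <= N%:Z) -> m \in s.
Proof.
exists [seq (\row_i ((f i)%:Z - N%:Z)) | f : {ffun 'I_n -> 'I_(2 * N).+1}].
move=> m hm; apply/mapP.
have h0 i : 0 <= m 0 i + N%:Z by have := hm i; lia.
exists [ffun i => inord `|(m 0 i + N%:Z)%R|%N]; first by rewrite mem_enum.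
apply/rowP => i; rewrite mxE ffunE inordK ?gez0_abs ?addrK //.
by have := hm i; lia.
Qed.

Section GaussValuation.
Context (K : fieldType) (R : realType) (v : valuation K R) (n : nat).
Local Notation M := 'rV[int]_n.
Local Notation KM := (grpalg K M).
Implicit Types (f g : KM) (u w : M) (x : 'rV[R]_n * R).

Lemma coefM_split (Q : K -> Prop) f g u0 w0 :
  Q 0 -> (forall a b, Q a -> Q b -> Q (a + b)) ->
  u0 \in supp f -> w0 \in supp g ->
  (forall u w, u \in supp f -> w \in supp g -> u + w = u0 + w0 -> u != u0 ->
     Q (coef f u * coef g w)) ->
  exists2 r, Q r & coef (f * g) (u0 + w0) = coef f u0 * coef g w0 + r.
Proof.
move=> Q0 QD u0f w0g hQ; rewrite coefM (big_fsetD1 u0) //= (big_fsetD1 w0) //= eqxx mulr1n.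
rewrite [X in _ + X + _]big1_fset ?addr0; last first.
  move=> w; rewrite in_fsetD1 => /andP[ww _] _; case: eqP => // /addrI e.
  by rewrite e eqxx in ww.
eexists; last by [].
rewrite big_seq; apply: (big_ind Q) => // u; rewrite in_fsetD1 => /andP[uu uf].
rewrite big_seq; apply: (big_ind Q) => // w wg; case: eqP => // e.
by rewrite mulr1n; apply: hQ.
Qed.

Lemma supp_neq0 f : f != 0 -> exists u, u \in supp f.
Proof.
move=> f0; apply: contrapT => nu; move/eqP: f0; apply; apply/grpalgP => u.
by rewrite coef0 coef_outdom //; apply/negP => us; apply: nu; exists u.
Qed.

Lemma grpalg_mulf_neq0 f g : f != 0 -> g != 0 -> f * g != 0.
Proof.
by move=> f0 g0; apply/eqP => /grpalg_integral[] /eqP; apply/negP.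
Qed.

Lemma grpalg_expf_neq0 f m : f != 0 -> f ^+ m != 0.
Proof.
move=> f0; elim: m => [|m IH]; first by rewrite expr0 oner_eq0.
by rewrite exprS grpalg_mulf_neq0.
Qed.

Definition lead f : M :=
  xget 0 [set u | u \in supp f /\ forall w, w \in supp f -> w != u -> lexpos (u - w)].

Lemma leadP f : f != 0 ->
  lead f \in supp f /\ forall w, w \in supp f -> w != lead f -> lexpos (lead f - w).
Proof.
move=> /supp_neq0[u us]; rewrite /lead; case: xgetP => [? _ //|nP].
have [|x [xs _ hx]] := @lexpos_max n (supp f) (fun=> True); first by exists u.
by case: (nP x); split=> // w ws wx; apply: hx.
Qed.

Lemma lead_unique f u : u \in supp f ->
  (forall w, w \in supp f -> w != u -> lexpos (u - w)) -> lead f = u.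
Proof.
move=> us hu; have f0 : f != 0 by apply: contraTneq us => ->; rewrite -coef_neq0 coef0 eqxx.
have [ls hl] := leadP f0; apply/eqP; apply: contrapT => /negP h.
have := lexposD (hu _ ls h) (hl _ us _); rewrite eq_sym => /(_ h).
by rewrite addrA subrK subrr => /lexpos0.
Qed.

Lemma coef_leadM f g : f != 0 -> g != 0 ->
  coef (f * g) (lead f + lead g) = coef f (lead f) * coef g (lead g).
Proof.
move=> /leadP[lf hf] /leadP[lg hg].
have [||//|_ -> ->] := @coefM_split (fun a => a = 0) _ _ _ _ _ _ lf lg _ => //.
- by move=> a b -> ->; rewrite addr0.
- move=> u w us ws e uu; exfalso; have h := hf u us uu.
  have ww : w != lead g by apply: contra_neq uu => ww; move: e; rewrite ww => /addIr.
  have := lexposD h (hg w ws ww); rewrite addrACA -opprD -e subrr; exact: lexpos0.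
- by rewrite addr0.
Qed.

Lemma leadM f g : f != 0 -> g != 0 -> lead (f * g) = lead f + lead g.
Proof.
move=> f0 g0; have [lf hf] := leadP f0; have [lg hg] := leadP g0.
apply: lead_unique.
  by rewrite -coef_neq0 coef_leadM // mulf_neq0 // coef_neq0.
move=> t; rewrite -coef_neq0 coefM => ht te.
have [u [w [us ws e]]] : exists u w, [/\ u \in supp f, w \in supp g & u + w = t].
  apply: contrapT => nuw; move/eqP: ht; apply.
  rewrite big1_fset // => u us _; rewrite big1_fset // => w ws _.
  by case: eqP => // e; case: nuw; exists u, w.
rewrite -e opprD addrACA.
have [uu|uu] := eqVneq u (lead f); have [ww|ww] := eqVneq w (lead g).
- by move: te; rewrite -e uu ww eqxx.
- by rewrite uu subrr add0r; apply: hg.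
- by rewrite ww subrr addr0; apply: hf.
- by apply: lexposD; [apply: hf|apply: hg].
Qed.

(* x = (omega, s) is a point of the cone; s = 0 gives a degree in M. *)
Definition weight x (a : K) u : R := x.2 * vr v a + pairing u x.1.

Lemma weightM x a b u w : a != 0 -> b != 0 ->
  weight x (a * b) (u + w) = weight x a u + weight x b w.
Proof. by move=> a0 b0; rewrite /weight vrM // pairingD; ring. Qed.

Definition gauss x f : R :=
  xget 0 [set r | (exists2 u, u \in supp f & weight x (coef f u) u = r) /\
                  forall u, u \in supp f -> r <= weight x (coef f u) u].

Lemma gaussP x f : f != 0 ->
  (exists2 u, u \in supp f & weight x (coef f u) u = gauss x f) /\
  forall u, u \in supp f -> gauss x f <= weight x (coef f u) u.
Proof.
move=> /supp_neq0[u us]; rewrite /gauss; case: xgetP => [? _ //|nP].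
have [|w ws hw] := @seq_argmin R _ (supp f) (fun w => w \in supp f)
  (fun u => weight x (coef f u) u).
  by exists u.
case: (nP (weight x (coef f w) w)); split; first by exists w.
by move=> t ts; apply: hw.
Qed.

Lemma gauss_le x f u : u \in supp f -> gauss x f <= weight x (coef f u) u.
Proof.
move=> us; apply: (gaussP _ _).2 => //.
by apply: contraTneq us => ->; rewrite -coef_neq0 coef0 eqxx.
Qed.

(* The product of the lexicographically largest terms of minimal weight has a
   weight which no other product of two terms with the same exponent attains. *)
Lemma gaussM x f g : 0 <= x.2 -> f != 0 -> g != 0 ->
  gauss x (f * g) = gauss x f + gauss x g.
Proof.
move=> s0 f0 g0; have fg0 := grpalg_mulf_neq0 f0 g0.
have cn (h : KM) u : u \in supp h -> coef h u != 0 by rewrite coef_neq0.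
have top h : h != 0 -> exists u, [/\ u \in supp h, weight x (coef h u) u = gauss x h &
    forall w, w \in supp h -> w != u -> gauss x h < weight x (coef h w) w \/ lexpos (u - w)].
  move=> h0; have [[u us ue] hu] := gaussP x h0.
  have [|t [ts te ht]] := @lexpos_max n (supp h) (fun u => weight x (coef h u) u = gauss x h).
    by exists u.
  exists t; split=> // w ws wt; have := hu w ws; rewrite le_eqVlt => /orP[/eqP e|]; last by left.
  by right; apply: ht.
have [u0 [us ue hu]] := top f f0; have [w0 [ws we hw]] := top g g0.
pose Q r := r = 0 \/ gauss x f + gauss x g < weight x r (u0 + w0).
have [||u w uf wg e uu|r Qr er] := @coefM_split Q f g u0 w0 _ _ us ws.
- by left.
- move=> a b [->|ha]; first by rewrite add0r.
  move=> [->|hb]; first by rewrite addr0; right.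
  have [->|a0] := eqVneq a 0; first by rewrite add0r; right.
  have [->|b0] := eqVneq b 0; first by rewrite addr0; right.
  have [->|ab0] := eqVneq (a + b) 0; first by left.
  right; have := vrD v a0 b0 ab0; move: ha hb; rewrite /weight => ha hb; rewrite ge_min.
  by case/orP => /(ler_wpM2l s0); lra.
- right; rewrite -e weightM ?cn //.
  have ww : w != w0 by apply: contra_neq uu => ww; move: e; rewrite ww => /addIr.
  have := gauss_le x uf; have := gauss_le x wg.
  case: (hu u uf uu) => [|lu]; first by lra.
  case: (hw w wg ww) => [|lw]; first by lra.
  by have := lexposD lu lw; rewrite addrACA -opprD -e subrr => /lexpos0.
have eab : weight x (coef f u0 * coef g w0) (u0 + w0) = gauss x f + gauss x g.
  by rewrite weightM ?cn // ue we.
have [nz ew] : coef (f * g) (u0 + w0) != 0 /\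
    weight x (coef (f * g) (u0 + w0)) (u0 + w0) = gauss x f + gauss x g.
  have ab0 : coef f u0 * coef g w0 != 0 by rewrite mulf_neq0 ?cn.
  rewrite er; case: Qr => [->|hr]; first by rewrite addr0.
  have [->|r0] := eqVneq r 0; first by rewrite addr0.
  move: hr; rewrite -eab /weight ltrD2r => hr.
  have sp : 0 < x.2 by rewrite lt0r s0 andbT; apply: contraTneq hr => ->; rewrite !mul0r ltxx.
  by move: hr; rewrite ltr_pM2l // => /(vrD_gt ab0 r0)[? ->].
apply/eqP; rewrite eq_le; apply/andP; split.
  by rewrite -ew; apply: gauss_le; rewrite -coef_neq0.
have [[t ts <-] _] := gaussP x fg0.
pose Q' r := r = 0 \/ gauss x f + gauss x g <= weight x r t.
have Q'D a b : Q' a -> Q' b -> Q' (a + b).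
  move=> [->|ha]; first by rewrite add0r.
  move=> [->|hb]; first by rewrite addr0; right.
  have [->|a0] := eqVneq a 0; first by rewrite add0r; right.
  have [->|b0] := eqVneq b 0; first by rewrite addr0; right.
  have [->|ab0] := eqVneq (a + b) 0; first by left.
  right; have := vrD v a0 b0 ab0; move: ha hb; rewrite /weight => ha hb; rewrite ge_min.
  by case/orP => /(ler_wpM2l s0); lra.
have : Q' (coef (f * g) t).
  rewrite coefM big_seq; apply: (big_ind Q') => //; first by left.
  move=> u uf; rewrite big_seq; apply: (big_ind Q') => //; first by left.
  move=> w wg; case: eqP => [e|_]; last by left.
  by right; rewrite mulr1n -e weightM ?cn // lerD // gauss_le.
by case=> [/eqP|//]; rewrite -[_ == 0]negbK coef_neq0 ts.
Qed.

Lemma gaussX x f m : 0 <= x.2 -> f != 0 -> gauss x (f ^+ m) = m%:R * gauss x f.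
Proof.
move=> s0 f0; elim: m => [|m IH]; last first.
  by rewrite exprS gaussM ?grpalg_expf_neq0 // IH -natr1; ring.
have := gaussM s0 (oner_neq0 KM) (oner_neq0 KM); rewrite mulr1 expr0; lra.
Qed.

End GaussValuation.

Lemma count_sub_lt (T : eqType) (P Q : pred T) (s : seq T) (t : T) :
  subpred P Q -> t \in s -> Q t -> ~~ P t -> (count P s < count Q s)%N.
Proof.
move=> PQ + Qt Pt; elim: s => //= a s IH; rewrite inE => /predU1P[<-|/IH lt].
  by rewrite Qt (negbTE Pt) add0n add1n ltnS; apply: sub_count.
rewrite -addnS leq_add //.
by case Pa: (P a) => //; rewrite (PQ _ Pa).
Qed.

Lemma archi_affine_ge0 (R : realType) (E d : R) :
  (forall k : nat, 0 <= E + k%:R * d) -> 0 <= d.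
Proof.
move=> h; rewrite leNgt; apply/negP => d0.
have nd : 0 < - d by rewrite oppr_gt0.
have := h (Num.truncn (`|E| / - d)).+1; have := truncnS_gt (`|E| / - d).
rewrite ltr_pdivrMr // mulrN; have := ler_norm E; lra.
Qed.

Section LaurentDivision.
Context (K : fieldType) (R : realType) (v : valuation K R) (n : nat).
Local Notation KM := (grpalg K 'rV[int]_n).
Local Notation gs w := (gauss v (w, 0)).
Variables (b c : KM).
Hypotheses (b0 : b != 0) (c0 : c != 0).
Implicit Types (a : KM) (w : 'rV[R]_n).

Let almost a := forall k, exists g, c * a ^+ k = b ^+ k * g.

Let almostB a h : almost a -> almost (a - b * h).
Proof.
move=> /choice[g hg] k; exists (\sum_(i < k.+1) (g (k - i)%N * (- h) ^+ i) *+ 'C(k, i)).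
rewrite exprDn !mulr_sumr; apply: eq_bigr => i _.
have e : b ^+ k = b ^+ (k - i) * b ^+ i by rewrite -exprD subnK // -ltnS.
rewrite !mulrnAr [c * _]mulrA hg -mulrN exprMn e; congr (_ *+ _).
by rewrite -!mulrA; congr (_ * _); rewrite mulrCA.
Qed.

Let lead_bound a w : a != 0 -> almost a ->
  gs w a - gs w b <= pairing (lead a - lead b) w.
Proof.
move=> a0 aa; rewrite -subr_ge0.
apply: (@archi_affine_ge0 _ (pairing (lead c) w - gs w c)) => k.
have [g hg] := aa k.
have ak := grpalg_expf_neq0 k a0; have bk := grpalg_expf_neq0 k b0.
have g0 : g != 0.
  by apply: contraTneq (grpalg_mulf_neq0 c0 ak) => e; rewrite hg e mulr0 eqxx.
have leadX (f : KM) : f != 0 -> lead (f ^+ k) = lead f *+ k.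
  move=> f0; elim: k {hg ak bk g g0} => [|k IH].
    have := leadM (oner_neq0 KM) (oner_neq0 KM).
    by rewrite mulr1 => /eqP; rewrite -subr_eq0 opprD addrA subrr add0r oppr_eq0 expr0 => /eqP.
  by rewrite exprS (leadM f0 (grpalg_expf_neq0 _ f0)) IH mulrS.
have s0 : 0 <= (w, 0 : R).2 by rewrite /=.
have el := congr1 (@lead K n) hg; have eg := congr1 (gs w) hg.
rewrite (leadM c0 ak) (leadM bk g0) (leadX _ a0) (leadX _ b0) in el.
rewrite (gaussM _ s0 c0 ak) (gaussM _ s0 bk g0) (gaussX _ _ s0 a0) (gaussX _ _ s0 b0) in eg.
have := gauss_le v (w, 0) (leadP g0).1; rewrite /weight /= mul0r add0r.
have := congr1 (fun u => pairing u w) el; rewrite !pairingD !pairingN !pairingMn.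
rewrite mulrBr mulrBr mulrDr; lra.
Qed.

Let reduce a : a != 0 -> exists h, lead h = lead a - lead b /\
  let a' := a - b * h in a' != 0 -> lexpos (lead a - lead a') /\ forall w, almost a -> gs w a <= gs w a'.
Proof.
move=> a0; have [la ha] := leadP a0; have [lb hb] := leadP b0.
rewrite -coef_neq0 in la; rewrite -coef_neq0 in lb.
pose m := lead a - lead b; pose al := coef a (lead a) / coef b (lead b).
have al0 : al != 0 by rewrite mulf_neq0 // invr_eq0.
have sh : supp (monom al m) = [fset m]%fset.
  apply/eqP; rewrite eqEfsubset supp_monom; apply/fsubsetP => u.
  by rewrite inE => /eqP ->; rewrite -coef_neq0 coef_monom eqxx.
have h0 : monom al m != 0 :> KM.
  by apply/eqP => /(congr1 (coef^~ m))/eqP; rewrite coef_monom eqxx coef0 (negbTE al0).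
have lh : lead (monom al m) = m.
  by have := (leadP h0).1; rewrite sh inE => /eqP.
exists (monom al m); rewrite lh; split=> // a' a'0.
have lbh : lead (b * monom al m) = lead a by rewrite leadM // lh addrC subrK.
have bh0 := grpalg_mulf_neq0 b0 h0.
have ca' : coef a' (lead a) = 0.
  rewrite coefB -{2}lbh leadM // coef_leadM // lh coef_monom eqxx mulr1n /al mulrC.
  by rewrite divfK // subrr.
have sa' u : u \in supp a' -> u \in supp a \/ u \in supp (b * monom al m).
  rewrite -coef_neq0 coefB => h; case: (boolP (u \in supp a)) => [|ua]; [by left|right].
  by rewrite -coef_neq0; move: h; rewrite (coef_outdom ua) sub0r oppr_eq0.
split.
  have [la' _] := leadP a'0.
  have ne : lead a' != lead a.
    by apply: contraTneq la' => ->; rewrite -coef_neq0 ca' eqxx.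
  have [/ha|hs] := sa' _ la'; first exact.
  by rewrite -lbh; apply: (leadP bh0).2 => //; rewrite lbh.
move=> w aa; have [[u us <-] _] := gaussP v (w, 0) a'0.
rewrite /weight /= mul0r add0r.
have [ua|ub] := sa' _ us.
  by have := gauss_le v (w, 0) ua; rewrite /weight /= mul0r add0r.
apply: (@le_trans _ _ (gs w (b * monom al m))).
  rewrite (gaussM v (x := (w, 0)) (lexx 0) b0 h0) addrC -lerBlDr; apply: le_trans (lead_bound w a0 aa) _.
  have [[u' us' <-] _] := gaussP v (w, 0) h0; move: us'; rewrite sh inE => /eqP ->.
  by rewrite /weight /= mul0r add0r.
by have := gauss_le v (w, 0) ub; rewrite /weight /= mul0r add0r.
Qed.

(* Dividing along the lexicographic leading terms, the exponents of the quotient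
   stay in a box, because gauss is a valuation for every weight. *)
Lemma laurent_division a : almost a -> exists q, a = b * q.
Proof.
move=> aa; have [->|a0] := eqVneq a 0; first by exists 0; rewrite mulr0.
pose e (i : 'I_n) : 'rV[R]_n := delta_mx 0 i.
pose L w := gs w a - gs w b.
pose N := (Num.truncn (\sum_i (`|L (e i)| + `|L (- e i)|))).+1.
have hN i : - L (e i) <= N%:R /\ - L (- e i) <= N%:R.
  have : \sum_i (`|L (e i)| + `|L (- e i)|) <= N%:R by apply/ltW/truncnS_gt.
  rewrite (bigD1 i) //= => le.
  have s0 : 0 <= \sum_(j | j != i) (`|L (e j)| + `|L (- e j)|).
    by apply: sumr_ge0 => j _; rewrite addr_ge0.
  have := normr_ge0 (L (e i)); have := normr_ge0 (L (- e i)).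
  by have := ler_norm (- L (e i)); have := ler_norm (- L (- e i)); rewrite !normrN; split; lra.
have [B hB] := int_box n N.
have inB f : f != 0 -> almost f -> (forall w, gs w a <= gs w f) -> lead f - lead b \in B.
  move=> f0 af le; apply: hB => i; have [h1 h2] := hN i.
  have pe (u : 'rV[int]_n) : pairing u (e i) = (u 0 i)%:~R.
    rewrite /pairing (bigD1 i) //= mxE !eqxx mulr1 big1 ?addr0 // => j ji.
    by rewrite mxE (negbTE ji) andbF mulr0.
  have := lead_bound (e i) f0 af; have := lead_bound (- e i) f0 af.
  have := le (e i); have := le (- e i); move: h1 h2; rewrite /L pairingNr pe => h1 h2 h3 h4 h5 h6.
  rewrite -(ler_int R) intr_norm ler_norml; apply/andP; split; rewrite /= ?mulrz_nat; lra.
pose mu (f : KM) := count (fun t => `[< lexpos (lead f - lead b - t) >]) B.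
suff rec m (f : KM) : (mu f < m)%N -> f != 0 -> almost f -> (forall w, gs w a <= gs w f) ->
    exists q, f = b * q.
  exact: (rec (mu a).+1).
elim: m f => // m IH f mf f0 af le; have [h [lh hh]] := reduce f0.
have [e0|f'0] := eqVneq (f - b * h) 0.
  by exists h; apply/eqP; rewrite -subr_eq0 e0.
have [lt le'] := hh f'0.
have af' : almost (f - b * h) by apply: almostB.
have lle w : gs w a <= gs w (f - b * h) by apply: le_trans (le w) (le' w af).
have [|q hq] := IH (f - b * h) _ f'0 af' lle; last first.
  by exists (q + h); rewrite mulrDr -hq subrK.
rewrite -ltnS (leq_trans _ mf) // ltnS.
apply: (@count_sub_lt _ _ _ _ (lead (f - b * h) - lead b)) => [t /asboolP ht|||].
- apply/asboolP; have := lexposD lt ht; congr lexpos.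
  by rewrite !addrA subrK.
- exact: inB.
- by apply/asboolP; rewrite opprB addrA subrK.
- by apply/asboolPn; rewrite subrr; apply: lexpos0.
Qed.

End LaurentDivision.

(** * Prime ideals and integral fractions *)

Lemma fracE (A : idomainType) (x : {fraction A}) :
  exists a b : A, b != 0 /\ x = tofrac a / tofrac b.
Proof.
elim/quotW: x => x; exists (frac x).1, (frac x).2; split; first exact: denom_ratioP.
apply: (canRL (mulfK _)); first by rewrite tofrac_eq0 denom_ratioP.
rewrite -[x in LHS]Ratio_numden; unlock FracField.tofrac.
rewrite -[LHS]FracField.pi_mul; apply/eqmodP => /=.
rewrite FracField.equivfE /FracField.mulf.
by rewrite !numden_Ratio ?mulr1 ?mul1r ?oner_neq0 ?denom_ratioP //= mulrC.
Qed.

Section PrimeIdeals.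
Context (A : comNzRingType).

Lemma exists_prime_ideal (I : set A) : I 0 -> (forall x y, I x -> I y -> I (x + y)) ->
  (forall a x, I x -> I (a * x)) -> ~ I 1 -> exists p : spec A, I `<=` sval p.
Proof.
move=> I0 ID IM I1.
pose good (X : set A) := [/\ I `<=` X, forall x y, X x -> X y -> X (x + y),
  forall a x, X x -> X (a * x) & ~ X 1].
have [|J [gJ Jmax]] := @Zorn_bigcup A (fun X => X = set0 \/ good X).
  move=> F FP Ft; have [[X FX gX]|ng] := pselect (exists2 X, F X & good X).
    right; have [IX _ _ _] := gX; split.
    - by move=> x Ix; exists X => //; apply: IX.
    - move=> x y [Y FY Yx] [Z FZ Zy].
      have cl (W : set A) : F W -> W x -> W y -> W (x + y).
        by move=> /FP[->//|[_ h _ _]] Wx Wy; apply: h.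
      by case: (Ft Y Z FY FZ) => s; [exists Z => //; apply: cl|exists Y => //; apply: cl] => //; apply: s.
    - move=> a x [Y FY Yx]; exists Y => //.
      by move: Yx; case: (FP Y FY) => [->//|[_ _ h _]]; apply: h.
    - by move=> [Y FY]; case: (FP Y FY) => [->//|[]].
  left; apply/seteqP; split=> // x [X FX]; case: (FP X FX) => [->//|gX].
  by case: ng; exists X.
have gI : good I by split.
case: gJ => [J0|[IJ JD JM J1]].
  case: (Jmax I); last by right.
  by rewrite J0; split=> // h; case: (h _ I0).
suff pJ : prime_ideal J by exists (exist _ J pJ).
split=> //; first exact: (IJ _ I0).
move=> x y Jxy; apply: contrapT => /not_orP[Jx Jy].
pose Jp z := [set t | exists j a, J j /\ t = j + a * z].
have Jp1 z : ~ J z -> Jp z 1.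
  move=> Jz; apply: contrapT => n1; apply: (Jmax (Jp z)); last first.
    right; split=> //.
    - by move=> t /IJ Jt; exists t, 0; rewrite mul0r addr0.
    - move=> _ _ [j [a [Jj ->]]] [l [b [Jl ->]]]; exists (j + l), (a + b).
      by split; [apply: JD|rewrite mulrDl addrACA].
    - move=> c _ [j [a [Jj ->]]]; exists (c * j), (c * a).
      by split; [apply: JM|rewrite mulrDr mulrA].
  split; first by move=> t Jt; exists t, 0; rewrite mul0r addr0.
  by move=> h; apply: Jz; apply: h; exists 0, 1; rewrite mul1r add0r; split=> //; exact: (IJ _ I0).
have [j [a [Jj ea]]] := Jp1 x Jx; have [l [b [Jl eb]]] := Jp1 y Jy.
apply: J1; rewrite -[1]mulr1 {1}ea eb mulrDl; apply: (JD); first by rewrite mulrC; apply: (JM).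
by rewrite mulrDr; apply: JD; [apply: (JM)|rewrite mulrACA; apply: JM].
Qed.

End PrimeIdeals.

Section Normality.
Context (A : idomainType).
Implicit Types (p : spec A) (x y : {fraction A}).

(* The denominators of an integral fraction form an ideal contained in no prime. *)
Lemma normal_integral x (q : {poly {fraction A}}) : normal A -> q \is monic ->
  (forall i, exists a : A, q`_i = tofrac a) -> root q x -> exists z : A, x = tofrac z.
Proof.
move=> nA qm qA qx; apply: contrapT => nx.
have [||||p Ip] := @exists_prime_ideal A [set d | exists z : A, tofrac d * x = tofrac z].
- by exists 0; rewrite rmorph0 mul0r.
- by move=> d e [z hz] [w hw]; exists (z + w); rewrite !rmorphD /= mulrDl hz hw.
- by move=> a d [z hz]; exists (a * z); rewrite !rmorphM /= -mulrA hz.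
- by case=> z; rewrite rmorph1 mul1r => h; apply: nx; exists z.
have [p0 _ _ p1 _] := svalP p.
have [|a [s [sp xe]]] := nA p x.
  exists q; split=> // i; have [a ->] := qA i; exists a, 1; rewrite rmorph1 divr1.
  by [].
apply: (sp); apply: Ip; exists a; rewrite xe mulrC divfK // tofrac_eq0.
by apply/eqP => s0; apply: sp; rewrite s0.
Qed.

Lemma integral_denominator p x (q : {poly {fraction A}}) : q \is monic ->
  (forall i, local_ring p q`_i) -> root q x ->
  exists s, ~ sval p s /\ exists d (c : nat -> A),
    (tofrac s * x) ^+ d = \sum_(i < d) tofrac (c i) * (tofrac s * x) ^+ i.
Proof.
move=> qm qp qx; have [p0 pD pM p1 pP] := svalP p.
have [s [sp hs]] : exists s, ~ sval p s /\
    forall i, (i < size q)%N -> exists z, tofrac s * q`_i = tofrac z.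
  elim: (size q) => [|N [s [sp hs]]]; first by exists 1.
  have [a [t [tp ha]]] := qp N.
  have t0 : tofrac t != 0.
    by rewrite tofrac_eq0; apply/eqP => t0; apply: tp; rewrite t0.
  exists (s * t); split; first by case/pP.
  move=> i; rewrite ltnS leq_eqVlt => /predU1P[->|/hs[z hz]].
    by exists (s * a); rewrite ha !rmorphM /= -mulrA [_ * (_ / _)]mulrC divfK.
  by exists (t * z); rewrite !rmorphM /= [_ * tofrac t]mulrC -mulrA hz.
exists s; split=> //; exists (size q).-1.
have sz : (0 < size q)%N by rewrite lt0n size_poly_eq0 monic_neq0.
have /choice[c hc] : forall i, exists c : A, (i < (size q).-1)%N ->
    tofrac s ^+ ((size q).-1 - i) * q`_i = - tofrac c.
  move=> i; case: (ltnP i (size q).-1) => [lt|]; last by exists 0.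
  have [|z hz] := hs i; first by rewrite (leq_trans lt) // leq_pred.
  exists (- (s ^+ ((size q).-1 - i).-1 * z)) => _.
  rewrite rmorphN opprK rmorphM rmorphXn /= -hz mulrA -exprSr prednK //.
  by rewrite subn_gt0.
exists c; move: qx; rewrite /root horner_coef -(prednK sz) big_ord_recr /=.
have -> : q`_(size q).-1 = 1 by move/eqP: qm.
rewrite mul1r addr_eq0 => /eqP /(congr1 (fun t => - (tofrac s ^+ (size q).-1 * t))).
rewrite mulrN opprK -exprMn => <-; rewrite mulr_sumr -sumrN; apply: eq_bigr => i _.
have -> : tofrac s ^+ (size q).-1 = tofrac s ^+ ((size q).-1 - i) * tofrac s ^+ i.
  by rewrite -exprD subnK // ltnW.
rewrite exprMn mulrACA hc // !mulNr opprK //.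
Qed.

Lemma integral_almost (a b : A) d (c : nat -> A) : b != 0 ->
  let y := tofrac a / tofrac b in y ^+ d = \sum_(i < d) tofrac (c i) * y ^+ i ->
  forall k, exists z, tofrac (b ^+ d) * y ^+ k = tofrac z.
Proof.
move=> b0 y hy k; have tb0 : tofrac b != 0 by rewrite tofrac_eq0.
have [m] := ubnP k; elim: m k => // m IH k km.
have [kd|dk] := ltnP k d.
  exists (b ^+ (d - k) * a ^+ k); rewrite rmorphM !rmorphXn /= /y exprMn exprVn.
  rewrite -{1}(subnK (ltnW kd)) exprD -mulrA; congr (_ * _).
  by rewrite mulrCA mulfV ?mulr1 // expf_neq0.
rewrite -(subnK dk) exprD hy mulr_sumr mulr_sumr.
have /choice[z hz] : forall i : 'I_d, exists z,
    tofrac (b ^+ d) * (y ^+ (k - d) * (tofrac (c i) * y ^+ i)) = tofrac z.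
  move=> i; have [|z hz] := IH (k - d + i)%N.
    rewrite -ltnS (leq_trans _ km) // ltnS -{2}(subnK dk) -addnS leq_add2l; exact: ltn_ord.
  by exists (c i * z); rewrite rmorphM /= -hz exprD; ring.
exists (\sum_i z i); rewrite rmorph_sum; apply: eq_bigr => i _; exact: hz.
Qed.

End Normality.

(** * Normality and flatness of cone rings *)

Section ConeRingTheory.
Context (K : fieldType) (R : realType) (v : valuation K R) (n : nat).
Variable sigma : set ('rV[R]_n * R).
Local Notation M := 'rV[int]_n.
Local Notation KM := (grpalg K M).
Local Notation A := (cone_ring v sigma).

Lemma cone_ringP (f : KM) : f \in cone_ring_pred v sigma <->
  (forall x, sigma x -> 0 <= x.2 -> forall u, u \in supp f -> 0 <= weight v x (coef f u) u).
Proof.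
have e x u : coef f u != 0 ->
    (0 <= x.2%:E * v (coef f u) + (pairing u x.1)%:E)%E = (0 <= weight v x (coef f u) u).
  by move=> f0; rewrite vrE // -EFinM -EFinD lee_fin.
split=> [/asboolP h x sx x0 u us|h].
  by rewrite -e ?coef_neq0 //; apply: h => //; rewrite coef_neq0.
by apply/asboolP => x sx x0 u us; rewrite e //; apply: h => //; rewrite -coef_neq0.
Qed.

Lemma monom_in_cone_ring a u : a != 0 -> (monom a u \in cone_ring_pred v sigma) <->
  (forall x, sigma x -> 0 <= x.2 -> 0 <= weight v x a u).
Proof.
move=> a0; rewrite cone_ringP; split=> h x sx x0.
  have := h x sx x0 u; rewrite -coef_neq0 coef_monom eqxx mulr1n; exact.
move=> w /(fsubsetP (supp_monom a u)); rewrite inE => /eqP ->.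
by rewrite coef_monom eqxx mulr1n; apply: h.
Qed.

Lemma gauss_cone_ring (f : KM) : f != 0 -> f \in cone_ring_pred v sigma <->
  (forall x, sigma x -> 0 <= x.2 -> 0 <= gauss v x f).
Proof.
move=> f0; rewrite cone_ringP; split=> h x sx x0.
  by have [[u us <-] _] := gaussP v x f0; apply: h.
by move=> u us; apply: le_trans (gauss_le v x us); apply: h.
Qed.

Lemma cone_ring_almost (c f : KM) : c != 0 ->
  (forall k, c * f ^+ k \in cone_ring_pred v sigma) -> f \in cone_ring_pred v sigma.
Proof.
move=> c0 h; have [->|f0] := eqVneq f 0; first exact: rpred0.
apply/(gauss_cone_ring f0) => x sx x0; apply: (@archi_affine_ge0 _ (gauss v x c)) => k.
have fk := grpalg_expf_neq0 k f0.
rewrite -(gaussX v k x0 f0) -(gaussM v x0 c0 fk).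
exact: (gauss_cone_ring (grpalg_mulf_neq0 c0 fk)).1 (h k) x sx x0.
Qed.

Lemma normal_cone_ring : normal A.
Proof.
move=> p x [q [qm qp qx]].
have [s [sp [d [c hc]]]] := integral_denominator qm qp qx.
have [a [b [b0 e]]] := fracE (tofrac s * x).
have val0 (f : A) : f != 0 -> val f != 0 :> KM.
  by apply: contra_neq => e0; apply/val_inj; rewrite e0 rmorph0.
have vb := val0 _ b0; have vbd := grpalg_expf_neq0 d vb.
rewrite e in hc; have hk := integral_almost b0 hc.
have vk k : exists z : A, val b ^+ d * val a ^+ k = val b ^+ k * val z.
  have [z hz] := hk k; exists z; rewrite -!rmorphXn -!rmorphM; congr (val _).
  apply/eqP; rewrite -tofrac_eq !rmorphM /= -hz !rmorphXn /= exprMn exprVn.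
  by rewrite [eqbRHS]mulrC -!mulrA mulVf ?mulr1 // expf_neq0 // tofrac_eq0.
have [g hg] := laurent_division v vb vbd (fun k => let: ex_intro z hz := vk k in ex_intro _ (val z) hz).
have gA : g \in cone_ring_pred v sigma.
  apply: (cone_ring_almost vbd) => k; have [z hz] := vk k.
  suff -> : val b ^+ d * g ^+ k = val z by apply: valP.
  apply/eqP; rewrite -subr_eq0; apply/eqP.
  have : val b ^+ k * (val b ^+ d * g ^+ k - val z) = 0.
    by rewrite mulrBr -hz hg exprMn mulrCA subrr.
  by case/grpalg_integral => // /eqP; rewrite (negbTE (grpalg_expf_neq0 k vb)).
have ae : a = b * ConeRing gA by apply: val_inj; rewrite rmorphM /= hg.
have p0 : sval p 0 by case: (svalP p).
have s0 : tofrac s != 0.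
  by rewrite tofrac_eq0; apply/eqP => s0; apply: sp; rewrite s0.
have tb0 : tofrac b != 0 by rewrite tofrac_eq0.
have xe : tofrac s * x = tofrac (ConeRing gA).
  by rewrite e ae tofracM mulrC mulKf.
exists (ConeRing gA), s; split; first exact: sp.
by apply: (canRL (mulfK s0)); rewrite mulrC; exact: xe.
Qed.

End ConeRingTheory.

Section QuotientModule.
Context (R0 : comNzRingType) (V : lmodType R0) (W : set V).
Hypotheses (W0 : W 0) (WB : forall x y, W x -> W y -> W (x - y)) (WZ : forall a x, W x -> W (a *: x)).

Let W_pred : {pred V} := [pred x | `[< W x >]].

Let W_zmod : zmod_closed W_pred.
Proof.
split; first by apply/asboolP.
by move=> x y /asboolP hx /asboolP hy; apply/asboolP/WB.
Qed.

HB.instance Definition _ := GRing.isZmodClosed.Build V W_pred W_zmod.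

Local Notation Q := (Quotient.quot W_pred).

Let pi (x : V) : Q := (\pi_Q x)%qT.

Let piK q : pi (repr q) = q.
Proof. exact: reprK. Qed.

Let eqQ (x y : V) : pi x = pi y <-> W (x - y).
Proof.
split=> [/eqP|h]; first by rewrite -Quotient.idealrBE => /asboolP.
by apply/eqP; rewrite -Quotient.idealrBE; apply/asboolP.
Qed.

Let qscale (a : R0) (q : Q) : Q := pi (a *: repr q).

Let qscaleE a x : qscale a (pi x) = pi (a *: x).
Proof. by apply/eqQ; rewrite -scalerBr; apply: WZ; apply/eqQ; rewrite piK. Qed.

Let piD (x y : V) : pi (x + y) = pi x + pi y.
Proof. by rewrite /pi !piE. Qed.

Let qscaleA a b q : qscale a (qscale b q) = qscale (a * b) q.
Proof. by rewrite -[q]piK !qscaleE scalerA. Qed.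

Let qscale1 : left_id 1 qscale.
Proof. by move=> q; rewrite -[q]piK !qscaleE scale1r. Qed.

Let qscaleDr : right_distributive qscale +%R.
Proof.
by move=> a q r; rewrite -[q]piK -[r]piK -piD !qscaleE scalerDr piD.
Qed.

Let qscaleDl q : {morph qscale^~ q : a b / a + b}.
Proof. by move=> a b; rewrite -[q]piK !qscaleE scalerDl piD. Qed.

HB.instance Definition _ := GRing.Zmodule_isLmodule.Build R0 Q
  qscaleA qscale1 qscaleDr qscaleDl.

Lemma exists_quotient_module : exists (P : lmodType R0) (p : V -> P),
  [/\ {morph p : x y / x + y}, forall a x, p (a *: x) = a *: p x
    & forall x, p x = 0 <-> W x].
Proof.
exists Q, pi; split.
- exact: piD.
- by move=> a x; rewrite -qscaleE.
- move=> x; have pi0 : pi 0 = 0 by rewrite /pi piE.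
  by rewrite -pi0 eqQ subr0.
Qed.

End QuotientModule.

Section ConeRingFlat.
Context (K : fieldType) (R : realType) (v : valuation K R) (n : nat).
Variable sigma : set ('rV[R]_n * R).
Local Notation M := 'rV[int]_n.
Local Notation KM := (grpalg K M).
Local Notation A := (cone_ring v sigma).
Local Notation O := (valring v).

Let valB (x y : O) : val (x - y) = val x - val y :> K.
Proof. exact: (rmorphB (val : {rmorphism O -> K})). Qed.

Let valD (x y : O) : val (x + y) = val x + val y :> K.
Proof. exact: (rmorphD (val : {rmorphism O -> K})). Qed.

Let valM (x y : O) : val (x * y) = val x * val y :> K.
Proof. exact: (rmorphM (val : {rmorphism O -> K})). Qed.

Let cvalD (x y : A) : val (x + y) = val x + val y :> KM.
Proof. exact: (rmorphD (val : {rmorphism A -> KM})). Qed.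

Let cvalM (x y : A) : val (x * y) = val x * val y :> KM.
Proof. exact: (rmorphM (val : {rmorphism A -> KM})). Qed.

Definition to_valring (x : K) : O := insubd 0 x.

Lemma val_to_valring x : x = 0 \/ 0 <= vr v x -> val (to_valring x) = x.
Proof.
move=> h; apply: insubdK; rewrite valringE.
by case: h => [->|->]; rewrite ?eqxx ?orbT.
Qed.

Let good u x := x != 0 /\ monom x u \in cone_ring_pred v sigma.

Let bilin0 (N P : lmodType O) (b : N -> A -> P) x :
  bilinear_map (@cone_structure K R v n sigma) b -> b x 0 = 0.
Proof. by move=> [_ bD _ _]; apply: (addrI (b x 0)); rewrite -bD !addr0. Qed.

Let component_coef (a : A) u : coef (val a) u != 0 -> good u (coef (val a) u).
Proof. by move=> c0; split=> //; apply: monom_cone_ring (valP a) _. Qed.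

(* (K -> N) modulo negligible functions plays the role of the tensor product of
   N with the degree u part of A: the class of x |-> (a / x) y represents y (x) a. *)
Let negligible (N : lmodType O) u : set (K -> N) :=
  [set phi | exists2 t, good u t & forall x, good u x -> vr v x <= vr v t -> phi x = 0].

Lemma cone_ring_flat : flat (@cone_structure K R v n sigma).
Proof.
move=> N N' h hinj s H P b bb; have b0 x : b x 0 = 0 by exact: bilin0.
have [bDl bDr bZ bf] := bb.
pose D : {fset M} := (\big[fsetU/fset0]_(xa <- s) supp (val xa.2))%fset.
have hD xa : xa \in s -> (supp (val xa.2) `<=` D)%fset.
  move=> xs; exact: (bigfcup_sup (fun xa : N * A => supp (val xa.2)) xs isT).
have dec xa : xa \in s -> b xa.1 xa.2 = \sum_(u <- D) b xa.1 (cone_component xa.2 u).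
  move=> xs; rewrite -(big_morph (b xa.1) (fun y z => bDr xa.1 y z) (b0 _)); congr (b _ _).
  by apply: val_inj; rewrite rmorph_sum /= [LHS](grpalgEw (hD _ xs)).
rewrite (eq_big_seq _ dec) exchange_big /= big1_seq // => u _.
have [[t0 gt0]|nt] := pselect (exists t, good u t); last first.
  rewrite big1_seq // => xa _; rewrite (_ : cone_component _ _ = 0) //.
  apply: val_inj => /=; have [->|c0] := eqVneq (coef (val xa.2) u) 0; first exact: monom0.
  by case: nt; exists (coef (val xa.2) u); apply: component_coef.
pose tt (a : A) := if coef (val a) u == 0 then t0 else coef (val a) u.
have gtt a : good u (tt a) by rewrite /tt; case: ifPn => // c0; apply: component_coef.
have div a x : good u x -> vr v x <= vr v (tt a) ->
    val (to_valring (coef (val a) u / x)) = coef (val a) u / x.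
  move=> [x0 _]; rewrite /tt; case: ifPn => [/eqP -> _|c0 le].
    by apply: val_to_valring; rewrite mul0r; left.
  by apply: val_to_valring; right; rewrite vrM ?invr_eq0 // vrV // subr_ge0.
have small (r : seq K) : (forall t, t \in r -> good u t) ->
    exists2 t, good u t & forall t', t' \in r -> vr v t <= vr v t'.
  elim: r => [|t r IH] hr; first by exists t0.
  have [|t1 g1 h1] := IH; first by move=> t' t'r; apply: hr; rewrite inE t'r orbT.
  have gt : good u t by apply: hr; rewrite inE eqxx.
  have [le|lt] := leP (vr v t1) (vr v t).
    by exists t1 => // t'; rewrite inE => /predU1P[->//|/h1].
  exists t => // t'; rewrite inE => /predU1P[->//|/h1]; exact: le_trans (ltW lt).
have [|||Q [p [pD pZ p0]]] := @exists_quotient_module O (K -> N') (negligible u).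
- by exists t0.
- move=> f g [t gt ht] [t' gt' ht'].
  have [|t1 g1 h1] := small [:: t; t'].
    by move=> ?; rewrite !inE => /orP[] /eqP ->.
  have le1 : vr v t1 <= vr v t by apply: h1; rewrite !inE eqxx.
  have le2 : vr v t1 <= vr v t' by apply: h1; rewrite !inE eqxx orbT.
  exists t1 => // x gx le; transitivity (f x - g x); first by [].
  by rewrite (ht _ gx (le_trans le le1)) (ht' _ gx (le_trans le le2)) subrr.
- by move=> a f [t gt ht]; exists t => // x gx le; transitivity (a *: f x) => //; rewrite ht // scaler0.
have peq f g : negligible u (f - g) -> p f = p g.
  move=> /p0 e; rewrite -[f](subrK g) pD e add0r //.
pose b' (y : N') (a : A) : Q := p (fun x => to_valring (coef (val a) u / x) *: y).
have b'b : bilinear_map (@cone_structure K R v n sigma) b'.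
  split.
  - move=> x y a; rewrite /b' -pD; congr p; apply/funext => z; exact: scalerDr.
  - move=> x a c; rewrite /b' -pD; apply: peq.
    have [|t gt ht] := small [:: tt a; tt c; tt (a + c)].
      by move=> t; rewrite !inE => /or3P[] /eqP ->.
    exists t => // z gz le.
    have dz a' ta := div a' z gz (le_trans le (ht _ ta)).
    transitivity (to_valring (coef (val (a + c)) u / z) *: x -
      (to_valring (coef (val a) u / z) *: x + to_valring (coef (val c) u / z) *: x)) => //.
    rewrite -scalerDl -scalerBl (_ : _ - _ = 0) ?scale0r //; apply: val_inj.
    rewrite valB valD !dz ?inE ?eqxx ?orbT //.
    by rewrite cvalD coefD mulrDl subrr.
  - move=> r x a; rewrite /b' -pZ; congr p; apply/funext => z.
    by rewrite scalerA mulrC -scalerA.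
  - move=> r x a; rewrite /b' -pZ; apply: peq.
    have [|t gt ht] := small [:: tt a; tt (cone_structure sigma r * a)].
      by move=> t; rewrite !inE => /orP[] /eqP ->.
    exists t => // z gz le.
    have dz a' ta := div a' z gz (le_trans le (ht _ ta)).
    transitivity (to_valring (coef (val (cone_structure sigma r * a)) u / z) *: x -
      r *: (to_valring (coef (val a) u / z) *: x)) => //.
    rewrite scalerA -scalerBl (_ : _ - _ = 0) ?scale0r //; apply: val_inj.
    rewrite valB valM !dz ?inE ?eqxx ?orbT //.
    rewrite cvalM /= /gconst.
    have -> : coef (monom (val r) 0 * val a) u = val r * coef (val a) u.
      rewrite [val a]grpalgE mulr_sumr !coef_sum mulr_sumr; apply: eq_bigr => w _.
      by rewrite monomM add0r !coef_monom mulrnAr.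
    by rewrite mulrA subrr.
have := H Q b' b'b; rewrite big_map /= /b' => e.
have {}e : p (fun x => \sum_(xa <- s) to_valring (coef (val xa.2) u / x) *: h xa.1) = 0.
  have p00 : p 0 = 0 by apply: (p0 0).2; exists t0.
  rewrite -e -(big_morph p pD p00).
  by congr p; rewrite fct_sumE.
have [t gt ht] := (p0 _).1 e.
have [|x gx hx] := small (t :: [seq tt xa.2 | xa <- s]).
  by move=> t'; rewrite inE => /predU1P[->//|/mapP[xa _ ->]].
have hxt : vr v x <= vr v t by apply: hx; rewrite inE eqxx.
have hxa xa : xa \in s -> vr v x <= vr v (tt xa.2).
  by move=> xs; apply: hx; rewrite inE (map_f (fun xa => tt xa.2)) ?orbT.
have /= := ht x gx hxt.
have -> : \sum_(xa <- s) to_valring (coef (val xa.2) u / x) *: h xa.1 =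
    h (\sum_(xa <- s) to_valring (coef (val xa.2) u / x) *: xa.1).
  by rewrite linear_sum; apply: eq_bigr => xa _; rewrite linearZ.
rewrite -[X in _ = X -> _](linear0 h) => /hinj ey.
pose ex : A := ConeRing gx.2.
have bDl0 : b 0 ex = 0 by apply: (addrI (b 0 ex)); rewrite -bDl !addr0.
rewrite -[RHS]bDl0 -ey (big_morph (b^~ ex) (fun y z => bDl y z ex) bDl0).
apply: eq_big_seq => xa xs; rewrite bZ -bf; congr (b _ _); apply: val_inj.
rewrite cvalM /= /gconst (div _ _ gx (hxa _ xs)) monomM add0r divfK //; exact: gx.1.
Qed.

End ConeRingFlat.

(** * The generic fibre *)

Lemma spec_inj (A : comNzRingType) (p q : spec A) : sval p = sval q -> p = q.
Proof. by case: p q => [p hp] [q hq] /= e; subst q; congr exist; apply: Prop_irrelevance. Qed.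

Lemma rmorphism_of (B D : pzRingType) (f : B -> D) :
  zmod_morphism f -> monoid_morphism f -> exists g : {rmorphism B -> D}, g =1 f.
Proof.
move=> fB fM.
pose mB := GRing.isZmodMorphism.Build B D f fB.
pose mM := GRing.isMonoidMorphism.Build B D f fM.
pose g : {rmorphism B -> D} := HB.pack f mB mM.
by exists g.
Qed.

(* Spec C -> Spec B is the inclusion of the basic open set of g. *)
Lemma localization_open_immersion (B C : comNzRingType) (phi : {rmorphism B -> C})
    (g : B) (g' : C) : injective phi -> phi g * g' = 1 ->
  (forall c, exists N b, phi b = phi g ^+ N * c) -> open_immersion phi.
Proof.
move=> inj gg' loc.
have canc N c : c = g' ^+ N * (phi g ^+ N * c).
  by rewrite mulrA -exprMn [g' * _]mulrC gg' expr1n mul1r.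
have in_gN (P : spec C) N c : sval P (phi g ^+ N * c) -> sval P c.
  by move=> h; rewrite (canc N c); case: (svalP P) => _ _ + _ _; apply.
have sub (P Q : spec C) : spec_map phi P = spec_map phi Q -> sval P `<=` sval Q.
  move=> e c Pc; have [N [b hb]] := loc c; apply: (in_gN Q N).
  have : sval (spec_map phi P) b by rewrite /= hb; case: (svalP P) => _ _ + _ _; apply.
  by rewrite e /= hb.
split.
- by move=> P Q e; apply: spec_inj; apply/seteqP; split; apply: sub.
- move=> U [E ->]; exists [set t | exists f N b, [/\ E f, phi b = phi g ^+ N * f & t = b * g]].
  apply/seteqP; split=> [_ [P [f Ef Pf] <-]|q [_ [f [N [b [Ef hb ->]]]] qbg]] /=.
    have [N [b hb]] := loc f; exists (b * g); first by exists f, N, b.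
    rewrite /= rmorphM hb mulrC mulrA -exprS => /in_gN; exact: Pf.
  have [q0 qD qM q1 qP] := svalP q.
  have ng : ~ sval q g by move=> qg; apply: qbg; apply: qM.
  have nb : ~ sval q b by move=> qb; apply: qbg; rewrite mulrC; apply: qM.
  have ngN k : ~ sval q (g ^+ k).
    by elim: k => [|k IH]; rewrite ?expr0 // exprS => /qP[].
  pose P c := exists k a, sval q a /\ phi a = phi g ^+ k * c.
  have Pphi a : P (phi a) -> sval q a.
    move=> [k [a' [qa']]]; rewrite -rmorphXn -rmorphM => /inj e.
    by move: qa'; rewrite e => /qP[/ngN|].
  have pP : prime_ideal P.
    split.
    - by exists 0%N, 0; rewrite rmorph0 mulr0.
    - move=> x y [k [a [qa ha]]] [l [a' [qa' ha']]]; exists (k + l)%N, (g ^+ l * a + g ^+ k * a').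
      split; first by apply: qD; apply: qM.
      by rewrite rmorphD !rmorphM !rmorphXn /= ha ha' exprD; ring.
    - move=> c x [k [a [qa ha]]]; have [l [a' ha']] := loc c; exists (l + k)%N, (a' * a).
      by split; [apply: qM|rewrite rmorphM ha ha' exprD; ring].
    - by rewrite -(rmorph1 phi) => /Pphi.
    - move=> x y [k [a [qa ha]]]; have [l [b1 h1]] := loc x; have [l' [b2 h2]] := loc y.
      have e : g ^+ k * (b1 * b2) = g ^+ (l + l') * a.
        by apply: inj; rewrite !rmorphM !rmorphXn /= h1 h2 ha exprD; ring.
      have : sval q (g ^+ k * (b1 * b2)) by rewrite e; apply: qM.
      case/qP => [/ngN//|/qP[qb|qb]]; [left|right].
        by exists l, b1.
      by exists l', b2.
  exists (exist _ P pP).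
    exists f => // - [k [a [qa ha]]]; apply: (nb).
    have e : g ^+ N * a = g ^+ k * b.
      by apply: inj; rewrite !rmorphM !rmorphXn /= ha hb; ring.
    by have : sval q (g ^+ N * a) by [apply: qM]; rewrite e => /qP[/ngN|].
  apply: spec_inj; apply/seteqP; split=> a /=; first exact: Pphi.
  by move=> qa; exists 0%N, a; rewrite expr0 mul1r.
- move=> q; have [q0 qD qM q1 qP] := svalP q; split.
    move=> x y _ _ [t qt]; rewrite /= -!rmorphM -rmorphB => e.
    have [N [t' ht']] := loc t; exists t'; first by rewrite /= ht' => /in_gN.
    by apply: inj; rewrite rmorphM ht' -mulrA e mulr0 rmorph0.
  move=> [z1 z2] /= qz; have [N [b1 h1]] := loc z1; have [N' [b2 h2]] := loc z2.
  exists (g ^+ N' * b1, g ^+ N * b2); rewrite /= ?rmorphM ?rmorphXn /= ?h1 ?h2.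
    by move/in_gN/in_gN.
  by exists 1 => //=; ring.
Qed.

Section GenericFibre.
Context (K : fieldType) (R : realType) (v : valuation K R) (n : nat).
Variable sigma : set ('rV[R]_n * R).
Local Notation M := 'rV[int]_n.
Local Notation KM := (grpalg K M).
Local Notation A := (cone_ring v sigma).
Local Notation O := (valring v).

Lemma coef_gconstM (a : K) (f : KM) u : coef (gconst a * f) u = a * coef f u.
Proof.
rewrite [f]grpalgE mulr_sumr !coef_sum mulr_sumr; apply: eq_bigr => w _.
by rewrite monomM add0r !coef_monom mulrnAr.
Qed.

Lemma gconstM (a b : K) : gconst (a * b) = gconst a * gconst b :> KM.
Proof. by rewrite /gconst monomM addr0. Qed.

Lemma gconst_scale (a b : K) (f : KM) : a != 0 -> b != 0 -> vr v a <= vr v b ->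
  gconst a * f \in cone_ring_pred v sigma -> gconst b * f \in cone_ring_pred v sigma.
Proof.
move=> a0 b0 ab fA; have rO : b / a \in valring_pred v.
  by rewrite valringE vrM ?invr_eq0 // vrV // subr_ge0 ab orbT.
rewrite -[b](divfK a0) gconstM -mulrA; apply: rpredM => //.
exact: (gconst_cone_ring sigma (ValRing rO)).
Qed.

Definition fibre_pred : {pred KM} :=
  [pred f | `[< exists2 c : K, c != 0 & gconst c * f \in cone_ring_pred v sigma >]].

Lemma fibre_common (f g : KM) : f \in fibre_pred -> g \in fibre_pred ->
  exists c, [/\ c != 0, gconst c * f \in cone_ring_pred v sigma
    & gconst c * g \in cone_ring_pred v sigma].
Proof.
move=> /asboolP[a a0 ha] /asboolP[b b0 hb]; have [le|/ltW le] := leP (vr v a) (vr v b).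
  by exists b; split=> //; apply: gconst_scale ha.
by exists a; split=> //; apply: gconst_scale hb.
Qed.

Lemma fibre_subring_closed : subring_closed fibre_pred.
Proof.
split.
- by apply/asboolP; exists 1; rewrite ?oner_eq0 // mul1r rpred1.
- move=> f g hf hg; have [c [c0 cf cg]] := fibre_common hf hg.
  by apply/asboolP; exists c => //; rewrite mulrBr rpredB.
- move=> f g /asboolP[a a0 ha] /asboolP[b b0 hb]; apply/asboolP; exists (a * b).
    by rewrite mulf_neq0.
  by rewrite gconstM mulrACA rpredM.
Qed.

HB.instance Definition _ :=
  GRing.isSubringClosed.Build KM fibre_pred fibre_subring_closed.

Record fibre_ring : Type := FibreRing { fibre_val : KM; _ : fibre_val \in fibre_pred }.

HB.instance Definition _ := [isSub for fibre_val].
HB.instance Definition _ := [Choice of fibre_ring by <:].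
HB.instance Definition _ := [SubChoice_isSubComNzRing of fibre_ring by <:].

Let fvalB (x y : fibre_ring) : val (x - y) = val x - val y :> KM.
Proof. exact: (rmorphB (val : {rmorphism fibre_ring -> KM})). Qed.

Let fvalM (x y : fibre_ring) : val (x * y) = val x * val y :> KM.
Proof. exact: (rmorphM (val : {rmorphism fibre_ring -> KM})). Qed.

Let cvalB (x y : A) : val (x - y) = val x - val y :> KM.
Proof. exact: (rmorphB (val : {rmorphism A -> KM})). Qed.

Let cvalM (x y : A) : val (x * y) = val x * val y :> KM.
Proof. exact: (rmorphM (val : {rmorphism A -> KM})). Qed.

Lemma cone_in_fibre (a : A) : val a \in fibre_pred.
Proof.
apply/asboolP; exists 1; first exact: oner_neq0.
rewrite (_ : gconst 1 * val a = val a); first exact: valP.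
exact: mul1r.
Qed.

Lemma gconst_in_fibre (c : K) : gconst c \in fibre_pred.
Proof.
have [->|c0] := eqVneq c 0; first by rewrite /gconst monom0 rpred0.
apply/asboolP; exists c^-1; first by rewrite invr_eq0.
by rewrite -gconstM mulVf // rpred1.
Qed.

Lemma fibre_pushout : exists (i : {rmorphism A -> fibre_ring}) (j : {rmorphism K -> fibre_ring}),
  [/\ is_pushout (@cone_structure K R v n sigma) (val : {rmorphism O -> K}) i j,
      forall a, val (i a) = val a & forall c, val (j c) = gconst c].
Proof.
have [||i hi] := @rmorphism_of A fibre_ring (fun a => FibreRing (cone_in_fibre a)) _ _.
- by move=> a b; apply: val_inj; rewrite fvalB; exact: cvalB.
- by split=> [|a b]; apply: val_inj; rewrite ?fvalM //; exact: cvalM.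
have [||j hj] := @rmorphism_of K fibre_ring (fun c => FibreRing (gconst_in_fibre c)) _ _.
- move=> a b; apply: val_inj; rewrite fvalB /=; apply/grpalgP => u.
  by rewrite coefB !coef_monom mulrnBl.
- by split=> [|a b]; apply: val_inj; rewrite ?fvalM //= gconstM.
have vi a : val (i a) = val a by rewrite hi.
have vj c : val (j c) = gconst c by rewrite hj.
exists i, j; split=> //; split=> [r|D h k hk].
  by apply: val_inj; rewrite vi vj.
have fr (b : fibre_ring) : exists p : K * A, p.1 != 0 /\ val p.2 = gconst p.1 * val b.
  by have /asboolP[c c0 hc] := valP b; exists (c, ConeRing hc).
pose ch b := sval (cid (fr b)).
have chP b : (ch b).1 != 0 /\ val (ch b).2 = gconst (ch b).1 * val b by apply: svalP (cid (fr b)).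
pose l b := k (ch b).1^-1 * h (ch b).2.
have kV c : c != 0 -> k c * k c^-1 = 1 by move=> c0; rewrite -rmorphM mulfV // rmorph1.
have hs (c d : K) (a b : A) : c != 0 -> d != 0 -> gconst d * val a = gconst c * val b ->
    k d * h a = k c * h b.
  wlog le : c d a b / vr v c <= vr v d.
    move=> wl c0 d0 e; case: (leP (vr v c) (vr v d)) => [|/ltW] le; first exact: wl.
    by apply/esym; apply: (wl d c b a).
  move=> c0 d0 e; have rO : d / c \in valring_pred v.
    by rewrite valringE vrM ?invr_eq0 // vrV // subr_ge0 le orbT.
  have -> : b = cone_structure sigma (ValRing rO) * a.
    apply: val_inj; rewrite cvalM /=; apply/grpalgP => u.
    have := congr1 (coef^~ u) e; rewrite !coef_gconstM => e'.
    by apply: (mulfI c0); rewrite -e' mulrA; congr (_ * _); rewrite mulrC divfK.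
  by rewrite rmorphM hk mulrA -rmorphM /= [c * _]mulrC divfK.
have lE b c (a : A) : c != 0 -> val a = gconst c * val b -> l b = k c^-1 * h a.
  move=> c0 ha; have [d0 hd] := chP b.
  have e : k c * h (ch b).2 = k (ch b).1 * h a.
    by apply: hs => //; rewrite hd ha !mulrA -!gconstM [c * _]mulrC.
  transitivity (k (ch b).1^-1 * k c^-1 * (k c * h (ch b).2)).
    by rewrite /l -mulrA [k c^-1 * _]mulrA [k c^-1 * k c]mulrC kV // mul1r.
  by rewrite e mulrACA [_ * k (ch b).1]mulrC kV // mul1r.
have lB : zmod_morphism l.
  move=> x y; have [c [c0 hx hy]] := fibre_common (valP x) (valP y).
  rewrite (lE x c (ConeRing hx)) // (lE y c (ConeRing hy)) //.
  rewrite (lE _ c (ConeRing hx - ConeRing hy)) //; last by rewrite cvalB fvalB mulrBr.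
  by rewrite rmorphB mulrBr.
have lM : monoid_morphism l.
  split=> [|x y].
    by rewrite (lE _ 1 1) ?oner_neq0 // ?invr1 ?rmorph1 ?mul1r.
  have [x0 hx] := chP x; have [y0 hy] := chP y.
  rewrite (lE (x * y) ((ch x).1 * (ch y).1) ((ch x).2 * (ch y).2)) ?mulf_neq0 //; last first.
    by rewrite cvalM fvalM hx hy gconstM mulrACA.
  by rewrite invfM !rmorphM mulrACA.
have [l' hl'] := rmorphism_of lB lM.
exists l'; split.
- move=> a; rewrite hl'; have e : val a = gconst 1 * val (i a) by rewrite vi; exact/esym/mul1r.
  by rewrite (lE _ _ _ (oner_neq0 _) e) invr1 rmorph1 mul1r.
- move=> c; rewrite hl'; have [->|c0] := eqVneq c 0.
    have e : val (0 : A) = gconst 1 * val (j 0) by rewrite vj /gconst monom0 mulr0.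
    by rewrite (lE _ _ _ (oner_neq0 _) e) !rmorph0 mulr0.
  have e : val (1 : A) = gconst c^-1 * val (j c) by rewrite vj -gconstM mulVf.
  by rewrite (lE _ _ _ _ e) ?invr_eq0 // invrK rmorph1 mulr1.
- move=> l2 l2i l2j b; rewrite hl'; have [c0 hb] := chP b.
  have -> : b = j (ch b).1^-1 * i (ch b).2.
    apply: val_inj; rewrite fvalM vi vj hb mulrA -gconstM mulVf //; exact/esym/mul1r.
  rewrite rmorphM l2i l2j; apply/esym/lE => //.
  by rewrite fvalM vi vj mulrA -gconstM mulfV //; exact/esym/mul1r.
Qed.

Definition cone_degree (w : M) := exists2 a : K, a != 0 & monom a w \in cone_ring_pred v sigma.

Lemma cone_degree_fibre (a : K) w : cone_degree w -> monom a w \in fibre_pred.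
Proof.
move=> [b b0 hb]; have [->|a0] := eqVneq a 0; first by rewrite monom0 rpred0.
apply/asboolP; exists (b / a); first by rewrite mulf_neq0 // invr_eq0.
by rewrite /gconst monomM add0r divfK.
Qed.

Lemma cone_degree0 : cone_degree 0.
Proof. by exists 1; [exact: oner_neq0 | exact: rpred1]. Qed.

Lemma cone_degreeD w t : cone_degree w -> cone_degree t -> cone_degree (w + t).
Proof.
move=> [a a0 ha] [b b0 hb]; exists (a * b); first by rewrite mulf_neq0.
by rewrite -monomM rpredM.
Qed.

Lemma cone_degreeMn w m : cone_degree w -> cone_degree (w *+ m).
Proof.
by move=> h; elim: m => [|m IH]; [exact: cone_degree0 | rewrite mulrS; apply: cone_degreeD].
Qed.

Lemma cone_degree_saturated w N : (0 < N)%N -> cone_degree (w *+ N) -> cone_degree w.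
Proof.
move=> N0 [a a0 /(monom_in_cone_ring _ _ _ a0) ha].
have [b [b0 hb]] : exists b, b != 0 /\ vr v a <= N%:R * vr v b.
  have [le|lt] := leP (vr v a) 0; first by exists 1; rewrite oner_neq0 vr1 mulr0.
  by exists a; split=> //; rewrite ler_peMl ?ler1n // ltW.
exists b => //; apply/(monom_in_cone_ring _ _ _ b0) => x sx x0.
have := ha x sx x0; rewrite /weight pairingMn => h.
have N0' : 0 < N%:R :> R by rewrite ltr0n.
rewrite -(pmulr_rge0 _ N0') mulrDr mulrCA; apply: le_trans h _.
by rewrite lerD2r ler_wpM2l.
Qed.

End GenericFibre.

Section ConeScheme.
Context (K : fieldType) (R : realType) (v : valuation K R) (n : nat).
Local Notation M := 'rV[int]_n.
Local Notation KM := (grpalg K M).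

Section Coaction.
Variable sigma : set ('rV[R]_n * R).
Local Notation A := (cone_ring v sigma).

Lemma coef_cone_coaction (a : A) u : coef (cone_coaction a) u = cone_component a u.
Proof.
rewrite coef_mk; case: ifPn => // ua; apply: val_inj => /=.
by rewrite coef_outdom // monom0.
Qed.

Let cvalMn (x : A) m : val (x *+ m) = val x *+ m :> KM.
Proof. exact: (rmorphMn (val : {rmorphism A -> KM})). Qed.

Lemma cone_coaction_over (r : valring v) :
  cone_coaction (cone_structure sigma r) = gconst (cone_structure sigma r).
Proof.
apply/grpalgP => u; rewrite coef_cone_coaction coef_monom; apply: val_inj.
rewrite cvalMn /= coef_monom /gconst.
by case: eqP => [<-|_]; rewrite ?mulr1n // mulr0n monom0.
Qed.

Lemma cone_coaction_assoc (a : A) :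
  gmap (@cone_coaction K R v n sigma) (cone_coaction a) = comul (cone_coaction a).
Proof.
apply/grpalgP => u; rewrite coef_gmap ?rmorph0 // coef_comul coef_cone_coaction.
apply/grpalgP => w; rewrite coef_cone_coaction coef_monom; apply: val_inj.
rewrite cvalMn /= coef_monom.
by case: eqP => [<-|_]; rewrite ?mulr1n // mulr0n monom0.
Qed.

Lemma cone_coaction_unit (a : A) : counit (cone_coaction a) = a.
Proof.
have sub : (supp (cone_coaction a) `<=` supp (val a))%fset.
  apply/fsubsetP => u; rewrite -!coef_neq0 coef_cone_coaction; apply: contra_neq => e.
  by apply: val_inj; rewrite /= e monom0.
rewrite /counit (big_fset_incl _ sub) /=; last by move=> u _ /coef_outdom.
apply: val_inj; rewrite (rmorph_sum (val : {rmorphism A -> KM})) [RHS]grpalgE.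
by apply: eq_bigr => u _; rewrite coef_cone_coaction.
Qed.

End Coaction.

Section Generators.
Context (k : nat) (u : 'I_k -> M) (c : 'I_k -> R).

Definition cone_of : set ('rV[R]_n * R) :=
  [set x | 0 <= x.2 /\ forall i, 0 <= pairing (u i) x.1 + x.2 * c i].

Lemma spanningP : ~ contains_line cone_of <-> spanning R u.
Proof.
split=> [nl d hd|sp [x [d [d0 hx]]]].
  apply: contrapT => d0; apply: nl; exists (0, 0), (d, 0); split; first by case.
  move=> t; split=> /= [|i]; first by rewrite mulr0 addr0.
  by rewrite pairing_line pairing0r hd !mulr0 !addr0 mul0r addr0.
have aff (a b : R) : (forall t, 0 <= a + t * b) -> b = 0.
  move=> h; have [//|b0] := eqVneq b 0.
  by have := h (- (a + 1) / b); rewrite divfK //; lra.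
have d2 : d.2 = 0 by apply: (aff x.2) => t; case: (hx t).
have d1 : d.1 = 0.
  apply: sp => i; apply: (aff (pairing (u i) x.1 + x.2 * c i)) => t.
  have [_ /(_ i)] := hx t; rewrite /= d2 mulr0 addr0 pairing_line; lra.
by apply: d0; case: d d1 d2 {hx} => /= ? ? -> ->.
Qed.

Hypothesis cG : forall i, value_group v (c i).
Hypothesis sp : spanning R u.

Local Notation A := (cone_ring v cone_of).

Lemma cone_gen : exists al : 'I_k -> K, forall i,
  [/\ al i != 0, vr v (al i) = c i & monom (al i) (u i) \in cone_ring_pred v cone_of].
Proof.
have /choice[al hal] : forall i, exists a : K, a != 0 /\ vr v a = c i.
  by move=> i; have [a a0 ha] := value_groupE (cG i); exists a.
exists al => i; have [a0 ha] := hal i; split=> //.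
by apply/(monom_in_cone_ring _ _ _ a0) => x [x0 hx] _; rewrite /weight ha addrC.
Qed.

Let m : M := \sum_i u i.

Let cone_degree_gen i : cone_degree v cone_of (u i).
Proof. by have [al /(_ i)[a0 _ ha]] := cone_gen; exists (al i). Qed.

Let cone_degree_sum (e : 'I_k -> nat) : cone_degree v cone_of (\sum_i u i *+ e i).
Proof.
apply: (big_ind (cone_degree v cone_of)) => [|x y|i _]; first exact: cone_degree0.
  exact: cone_degreeD.
by apply: cone_degreeMn.
Qed.

Let cone_degree_shift w : exists N, forall N', (N <= N')%N -> cone_degree v cone_of (w + m *+ N').
Proof.
have [N [z N0 hz]] := spanning_int w sp.
exists (\sum_i `|z i|)%N => N' hN; apply: (cone_degree_saturated N0).
rewrite mulrnDl hz -mulrnA /m -sumrMnl -big_split /=.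
rewrite (eq_bigr (fun i => u i *+ `|(z i + (N' * N)%:Z)%R|%N)); first exact: cone_degree_sum.
move=> i _; have zi : (`|z i| <= N' * N)%N.
  have h1 : (`|z i| <= \sum_i `|z i|)%N by rewrite (bigD1 i) //= leq_addr.
  by rewrite (leq_trans h1) // (leq_trans hN) // leq_pmulr.
rewrite [in RHS]pmulrn gez0_abs ?mulrzDr ?pmulrn //; lia.
Qed.

Lemma cone_toric_open : exists (B : comNzRingType) (i : {rmorphism A -> B})
    (j : {rmorphism K -> B}) (phi : {rmorphism B -> KM}),
  [/\ is_pushout (@cone_structure K R v n cone_of) (val : {rmorphism valring v -> K}) i j,
      (forall a, phi (i a) = val a),
      (forall c, phi (j c) = gconst c)
    & open_immersion phi].
Proof.
have [i [j [po vi vj]]] := fibre_pushout v cone_of.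
exists (fibre_ring v cone_of : comNzRingType), i, j, (val : {rmorphism fibre_ring v cone_of -> KM}).
split=> //.
have hm : cone_degree v cone_of m.
  apply: (big_ind (cone_degree v cone_of)) => [|x y|? _ //]; first exact: cone_degree0.
  exact: cone_degreeD.
apply: (@localization_open_immersion _ _ _ (FibreRing (cone_degree_fibre 1 hm)) (monom 1 (- m))).
- exact: val_inj.
- by rewrite /= monomM mulr1 subrr.
move=> f /=; have mX N : (monom 1 m : KM) ^+ N = monom 1 (m *+ N).
  elim: N => [|N IH]; first by rewrite expr0 mulr0n.
  by rewrite exprS IH monomM mulr1 mulrS.
suff [N hN] : exists N, forall w, w \in supp f -> cone_degree v cone_of (w + m *+ N).
  have fN : monom 1 m ^+ N * f \in fibre_pred v cone_of.
    rewrite mX [f]grpalgE mulr_sumr big_seq; apply: rpred_sum => w wf.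
    by rewrite monomM mul1r addrC; apply: cone_degree_fibre; apply: hN.
  by exists N, (FibreRing fN).
have /choice[N hN] := cone_degree_shift.
by exists (\max_(w <- supp f) N w)%N => w wf; apply: hN; apply: leq_bigmax_seq.
Qed.

Lemma cone_toric_scheme : toric_scheme (cone_scheme v cone_of).
Proof.
split.
- exact: cone_ring_flat.
- exact: cone_toric_open.
- exact: cone_coaction_over.
- exact: cone_coaction_assoc.
- exact: cone_coaction_unit.
- exact: gmap_cone_coaction.
Qed.

End Generators.

End ConeScheme.

(** * Finite generation *)

Lemma monom_expr (A : comNzRingType) (M : zmodType) (a : A) (u : M) e :
  monom a u ^+ e = monom (a ^+ e) (u *+ e).
Proof.
elim: e => [|e IH]; first by rewrite !expr0 mulr0n.
by rewrite !exprS IH monomM mulrS.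
Qed.

Lemma monom_prod (A : comNzRingType) (M : zmodType) (I : Type) (s : seq I)
    (a : I -> A) (u : I -> M) (e : I -> nat) :
  \prod_(i <- s) monom (a i) (u i) ^+ e i =
  monom (\prod_(i <- s) a i ^+ e i) (\sum_(i <- s) u i *+ e i).
Proof.
elim: s => [|i s IH]; first by rewrite !big_nil.
by rewrite !big_cons IH monom_expr monomM.
Qed.

Section FiniteType.
Context (K : fieldType) (R : realType) (v : valuation K R) (n k : nat).
Local Notation M := 'rV[int]_n.
Local Notation KM := (grpalg K M).
Variables (u : 'I_k -> M) (c : 'I_k -> R).
Local Notation sigma := (cone_of u c).
Local Notation A := (cone_ring v sigma).
Local Notation P := (polyhedron u c).

Lemma cone_ring_optimum (al : K) (u0 : M) : spanning R u -> P !=set0 -> al != 0 ->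
  monom al u0 \in cone_ring_pred v sigma ->
  exists w l, [/\ basic u c w, forall i, 0 <= l i, forall i, l i != 0 -> tight u c w i,
    (forall j, (u0 0 j)%:~R = \sum_i l i * (u i 0 j)%:~R :> rat) & 0 <= vr v al + pairing u0 w].
Proof.
move=> sp P0 al0 /(monom_in_cone_ring _ _ _ al0) h.
have ub w : P w -> 0 <= vr v al + pairing u0 w.
  move=> Pw; have := h (w, 1); rewrite /weight /= mul1r; apply=> //.
  by split=> //= i; rewrite mul1r.
have [|w bw hw] := @optimal_basic R n k u c u0 (- vr v al) _ sp P0.
  by move=> w /ub; lra.
have [l [l0 lt hl]] := optimal_cone bw.1 hw.
by exists w, l; split=> //; apply: ub; case: bw.
Qed.

Lemma cone_ring_recession (al : K) (u0 : M) : al != 0 ->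
  monom al u0 \in cone_ring_pred v sigma ->
  exists l : 'I_k -> rat, (forall i, 0 <= l i) /\
    forall j, (u0 0 j)%:~R = \sum_i l i * (u i 0 j)%:~R.
Proof.
move=> al0 /(monom_in_cone_ring _ _ _ al0) h.
have [|l [l0 _ hl]] := @cone_rat R n _ u xpredT u0; last by exists l.
move=> d hd; have := h (d, 0); rewrite /weight /= mul0r add0r; apply=> //.
by split=> //= i; rewrite mul0r addr0; apply: hd.
Qed.

Let B := (\sum_i \sum_j `|u i 0%R j|)%N.

(* The point g lies in the half-open parallelotope spanned by the u i. *)
Lemma gordan_decomposition (u0 : M) (l : 'I_k -> rat) : (forall i, 0 <= l i) ->
  (forall j, (u0 0 j)%:~R = \sum_i l i * (u i 0 j)%:~R) ->
  exists (e : 'I_k -> nat) (g : M) (fr : 'I_k -> rat),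
    [/\ u0 = g + \sum_i u i *+ e i, forall j, `|g 0 j| <= B%:Z,
      forall i, 0 <= fr i, forall i, l i = 0 -> e i = 0%N /\ fr i = 0
      & forall j, (g 0 j)%:~R = \sum_i fr i * (u i 0 j)%:~R].
Proof.
move=> l0 hl; pose e i := Num.truncn (l i); pose fr i := l i - (e i)%:R.
have fr0 i : 0 <= fr i by rewrite subr_ge0 truncn_le.
have fr1 i : fr i <= 1 by rewrite lerBlDr addrC natr1; apply/ltW/truncnS_gt.
pose g := u0 - \sum_i u i *+ e i.
have hg j : (g 0 j)%:~R = \sum_i fr i * (u i 0 j)%:~R.
  rewrite /g !mxE intrB hl summxE rmorph_sum -sumrB; apply: eq_bigr => i _.
  by rewrite mulmxnE /= rmorphMn /= -mulr_natl mulrBl.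
exists e, g, fr; split=> //.
- by rewrite subrK.
- move=> j; rewrite -(ler_int rat) intr_norm hg.
  apply: le_trans (ler_norm_sum _ _ _) _.
  rewrite -[_%:~R]/(B%:R) /B natr_sum; apply: ler_sum => i _.
  rewrite normrM ger0_norm // (bigD1 j) //= natrD natr_absz intr_norm.
  by rewrite -[X in X <= _]addr0 lerD // ler_piMl.
- by move=> i li; rewrite /fr /e li truncn0 subrr.
Qed.

Section Generation.
Variable T : set KM.
Hypotheses (TD : forall f g, T f -> T g -> T (f + g)) (TM : forall f g, T f -> T g -> T (f * g)).
Hypothesis TO : forall r, r \in valring_pred v -> T (gconst r).

Lemma closed_monom_scale a b w : b != 0 -> vr v b <= vr v a -> a != 0 -> T (monom b w) -> T (monom a w).
Proof.
move=> b0 le a0 Tb; rewrite -[a](divfK b0) -[w]add0r -monomM; apply: TM => //.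
by apply: TO; rewrite valringE vrM ?invr_eq0 // vrV // subr_ge0 le orbT.
Qed.

Let T1 : T 1.
Proof. by apply: TO; rewrite rpred1. Qed.

Lemma closed_expr f e : T f -> T (f ^+ e).
Proof. by move=> Tf; elim: e => [|e IH]; rewrite ?expr0 // exprS; apply: TM. Qed.

Lemma closed_prod (I : Type) (s : seq I) (F : I -> KM) (e : I -> nat) :
  (forall i, T (F i)) -> T (\prod_(i <- s) F i ^+ e i).
Proof. by move=> TF; apply: (big_ind T) => // i _; apply: closed_expr. Qed.

Lemma closed_const p a : p != 0 -> vr v p < 0 -> T (gconst p) -> T (gconst a).
Proof.
move=> p0 pn Tp; have [->|a0] := eqVneq a 0; first by apply: TO; rewrite rpred0.
pose N := (Num.truncn (`|vr v a| / - vr v p)).+1.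
apply: (@closed_monom_scale _ (p ^+ N)); rewrite ?expf_neq0 //; last first.
  by have := closed_expr N Tp; rewrite monom_expr mul0rn.
rewrite vrX //; have : `|vr v a| / - vr v p < N%:R by apply: truncnS_gt.
rewrite ltr_pdivrMr ?oppr_gt0 // mulrN; have := ler_norm (- vr v a); rewrite normrN; lra.
Qed.

End Generation.

Hypothesis cG : forall i, value_group v (c i).
Hypothesis sp : spanning R u.
Hypothesis hv : forall w, basic u c w -> forall i, value_group v (w 0 i).

Lemma cone_finite_type : finite_type (@cone_structure K R v n sigma).
Proof.
have [al hal] := cone_gen u cG.
have [ws hws] := basic_seq u c.
have [box hbox] := int_box n B.
pose Qv w g (a : A) := exists2 b, b != 0 /\ vr v b = - pairing g w & val a = monom b g.
pose gv w g : A := xget 1 [set a | Qv w g a].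
pose g1 g : A := xget 1 [set a | val a = monom 1 g].
pose gal i : A := ConeRing (let: And3 _ _ h := hal i in h).
pose gc i : A := xget 1 [set a | val a = gconst (al i)].
exists ([seq gal i | i <- enum 'I_k] ++ [seq gv w g | w <- ws, g <- box] ++
  [seq g1 g | g <- box] ++ [seq gc i | i <- enum 'I_k]).
move=> S SO Sg SD SM.
have Sal i : S (gal i) by apply: Sg; rewrite mem_cat map_f ?mem_enum.
have Sgv w g : w \in ws -> g \in box -> S (gv w g).
  by move=> wW gB; apply: Sg; rewrite !mem_cat allpairs_f ?orbT.
have Sg1 g : g \in box -> S (g1 g).
  by move=> gB; apply: Sg; rewrite !mem_cat (map_f g1) ?orbT.
have Sgc i : S (gc i) by apply: Sg; rewrite !mem_cat (map_f gc) ?mem_enum ?orbT.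
pose T : set KM := [set f | exists2 a, S a & val a = f].
have TD f g : T f -> T g -> T (f + g).
  move=> [a Sa <-] [b Sb <-]; exists (a + b); first exact: SD.
  exact: (rmorphD (val : {rmorphism A -> KM})).
have TM f g : T f -> T g -> T (f * g).
  move=> [a Sa <-] [b Sb <-]; exists (a * b); first exact: SM.
  exact: (rmorphM (val : {rmorphism A -> KM})).
have TO r : r \in valring_pred v -> T (gconst r).
  by move=> hr; exists (cone_structure sigma (ValRing hr)); [exact: SO|].
have Tal i : T (monom (al i) (u i)) by exists (gal i).
suff Tm a t : a != 0 -> monom a t \in cone_ring_pred v sigma -> T (monom a t).
  move=> x; suff : T (val x) by case=> y Sy /val_inj <-.
  rewrite [val x]grpalgE big_seq; apply: (big_ind T) => //.
    by rewrite -(monom0 0); apply: TO; rewrite rpred0.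
  move=> w wx; apply: Tm; first by rewrite coef_neq0.
  exact: monom_cone_ring (valP x) _.
move=> a0 ha.
have al0 i : al i != 0 by case: (hal i).
have val_al i : vr v (al i) = c i by case: (hal i).
have pal0 e : \prod_i al i ^+ e i != 0.
  by apply/prodf_neq0 => i _; rewrite expf_neq0.
have vpal e : vr v (\prod_i al i ^+ e i) = \sum_i (e i)%:R * c i.
  rewrite vr_prod => [|i]; last by rewrite expf_neq0.
  by apply: eq_bigr => i _; rewrite vrX // val_al.
have Tprod e : T (monom (\prod_i al i ^+ e i) (\sum_i u i *+ e i)).
  by rewrite -monom_prod; apply: closed_prod.
have [P0|Pempty] := pselect (P !=set0).
  have [w [l [bw l0 lt hl hw]]] := cone_ring_optimum sp P0 a0 ha.
  have [e [g [fr [eu gB fr0 lz hg]]]] := gordan_decomposition l0 hl.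
  have frt i : fr i != 0 -> tight u c w i.
    by move=> fi; apply: lt; apply: contra_neq fi => /lz[].
  have [b b0 vb] : exists2 b, b != 0 & vr v b = - pairing g w.
    by apply/value_groupE/value_groupN/value_group_pairing/hv.
  have hb : monom b g \in cone_ring_pred v sigma.
    apply/(monom_in_cone_ring _ _ _ b0) => x [x0 hx] _; rewrite /weight vb.
    rewrite (tight_value frt hg) opprK (pairing_ratr _ hg) mulr_sumr -big_split /=.
    apply: sumr_ge0 => i _; rewrite mulrCA -mulrDr mulr_ge0 ?ler0q //.
    by rewrite addrC.
  have [b' [b'0 vb'] Tb'] : exists2 b', b' != 0 /\ vr v b' = - pairing g w & T (monom b' g).
    have [b' hb' e'] : Qv w g (gv w g).
      rewrite /gv; case: xgetP => [a' _ //|/(_ (ConeRing hb)) []].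
      by exists b.
    by exists b' => //; exists (gv w g) => //; apply: Sgv; [apply: hws|apply: hbox].
  have Tp := TM _ _ Tb' (Tprod e); rewrite monomM in Tp.
  rewrite eu; apply: (closed_monom_scale TM TO _ _ a0 Tp).
    by rewrite mulf_neq0.
  rewrite vrM // vb' vpal; move: hw; rewrite eu pairingD pairing_sum.
  have -> : \sum_i pairing (u i *+ e i) w = - \sum_i (e i)%:R * c i.
    rewrite -sumrN; apply: eq_bigr => i _; rewrite pairingMn.
    have [/lz[-> _]|/lt/eqP ti] := eqVneq (l i) 0; first by rewrite !mul0r oppr0.
    by rewrite -mulrN; congr (_ * _); lra.
  lra.
have [l [l0 hl]] := cone_ring_recession a0 ha.
have [e [g [fr [eu gB fr0 lz hg]]]] := gordan_decomposition l0 hl.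
have cone0 x : sigma x -> x.2 = 0.
  move=> [x0 hx]; apply/eqP; rewrite eq_le x0 andbT leNgt; apply/negP => x2.
  apply: Pempty; exists (x.2^-1 *: x.1) => i; rewrite pairingZr.
  have := hx i; rewrite -(pmulr_rge0 _ (_ : 0 < x.2^-1)) ?invr_gt0 //.
  by rewrite mulrDr mulKf // gt_eqF.
have hg1 : monom 1 g \in cone_ring_pred v sigma.
  apply/(monom_in_cone_ring _ _ _ (oner_neq0 K)) => x sx _; rewrite /weight (cone0 x sx) mul0r add0r.
  rewrite (pairing_ratr _ hg); apply: sumr_ge0 => i _; rewrite mulr_ge0 ?ler0q //.
  by case: (sx) => _ /(_ i); rewrite (cone0 x sx) mul0r addr0.
have Tg : T (monom 1 g).
  exists (g1 g); first by apply: Sg1; apply: hbox.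
  by rewrite /g1; case: xgetP => [//|/(_ (ConeRing hg1))[]].
have [i ci] : exists i, c i < 0.
  apply: contrapT => nc; apply: Pempty; exists 0 => i; rewrite pairing0r add0r leNgt.
  by apply/negP => ci; apply: nc; exists i.
have hci : gconst (al i) \in cone_ring_pred v sigma.
  apply/(monom_in_cone_ring _ _ _ (al0 i)) => x sx _.
  by rewrite /weight (cone0 x sx) mul0r add0r pairing0.
have Tc b : T (gconst b).
  apply: (closed_const TM TO _ (al0 i)); first by rewrite val_al.
  exists (gc i); first exact: Sgc.
  by rewrite /gc; case: xgetP => [//|/(_ (ConeRing hci))[]].
have := TM _ _ (TM _ _ (Tc (a / \prod_i al i ^+ e i)) Tg) (Tprod e).
by rewrite /gconst !monomM add0r mulr1 -eu divfK.
Qed.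

End FiniteType.

Section ConeCorrespondence.
Context (K : fieldType) (R : realType) (v : valuation K R) (n : nat).
Implicit Types sigma tau : set ('rV[R]_n * R).
Local Notation M := 'rV[int]_n.

Lemma height1_cone_of k (u : 'I_k -> M) (c : 'I_k -> R) : height1 (cone_of u c) = polyhedron u c.
Proof.
apply/seteqP; split=> w; rewrite /height1 /polyhedron /=.
  by move=> [_ h] i; have := h i; rewrite /= mul1r.
by move=> h; split=> [|i]; rewrite /= ?mul1r.
Qed.

Lemma admissible_cone_of sigma : admissible v sigma ->
  exists k (u : 'I_k -> M) (c : 'I_k -> R),
    [/\ forall i, value_group v (c i), spanning R u & sigma = cone_of u c].
Proof.
move=> [nl [k [u [c [cG e]]]]]; exists k, u, c; split=> //.
by apply/(spanningP u c); rewrite /cone_of -e.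
Qed.

Lemma cone_scheme_normal_toric sigma : admissible v sigma ->
  (forall w, vertex (height1 sigma) w -> forall i, value_group v (w 0 i)) ->
  normal_toric_variety (cone_scheme v sigma).
Proof.
move=> /admissible_cone_of[k [u [c [cG sp ->]]]]; rewrite height1_cone_of => hv.
split; first exact: cone_toric_scheme.
  by apply: cone_finite_type => // w /vertex_basic; apply: hv.
exact: normal_cone_ring.
Qed.

Lemma cone_of_monomials sigma : admissible v sigma ->
  sigma = [set x | 0 <= x.2 /\ forall a u, a != 0 ->
    monom a u \in cone_ring_pred v sigma -> 0 <= weight v x a u].
Proof.
move=> /admissible_cone_of[k [u [c [cG sp ->]]]]; apply/seteqP; split=> x /=.
  move=> sx; split=> [|a w a0 /(monom_in_cone_ring _ _ _ a0)]; first by case: sx.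
  by apply=> //; case: sx.
move=> [x0 hx]; split=> // i; have [al /(_ i)[a0 va ha]] := cone_gen u cG.
by have := hx _ _ a0 ha; rewrite /weight va addrC.
Qed.

Lemma cone_scheme_inj sigma tau : admissible v sigma -> admissible v tau ->
  toric_iso (cone_scheme v sigma) (cone_scheme v tau) -> sigma = tau.
Proof.
move=> hs ht [psi [[psi' _ psiK'] _ _ hpsi]].
have e : cone_ring_pred v sigma =i cone_ring_pred v tau.
  move=> f; apply/idP/idP => hf.
    have := hpsi (psi' (ConeRing hf)); rewrite psiK' /= => ->; exact: valP.
  have := hpsi (ConeRing hf); rewrite /= => <-; exact: valP.
rewrite (cone_of_monomials hs) (cone_of_monomials ht).
apply/seteqP; split=> x [x0 hx]; split=> // a u a0 ha; apply: hx => //.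
  by rewrite e.
by rewrite -e.
Qed.

End ConeCorrespondence.

(** * Flatness and pushouts *)

Section RestrictScalars.
Context {R0 A : comNzRingType}.

Definition restrict_scalars (f : {rmorphism R0 -> A}) : Type := A.

Variable f : {rmorphism R0 -> A}.
Local Notation V := (restrict_scalars f).

HB.instance Definition _ := GRing.Zmodule.copy V A.

Let scale (r : R0) (x : V) : V := f r * (x : A).

Let scaleA r s x : scale r (scale s x) = scale (r * s) x.
Proof. by rewrite /scale rmorphM mulrA. Qed.

Let scale1 : left_id 1 scale.
Proof. by move=> x; rewrite /scale rmorph1 mul1r. Qed.

Let scaleDr : right_distributive scale +%R.
Proof. by move=> r x y; rewrite /scale; exact: mulrDr. Qed.

Let scaleDl x : {morph scale^~ x : r s / r + s}.
Proof. by move=> r s; rewrite /scale rmorphD; exact: mulrDl. Qed.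

HB.instance Definition _ := GRing.Zmodule_isLmodule.Build R0 V scaleA scale1 scaleDr scaleDl.

Lemma restrict_scalarsE r (x : V) : r *: x = f r * (x : A) :> A.
Proof. by []. Qed.

Lemma flat_regular r : flat f -> injective ( *%R r) -> f r != 0.
Proof.
move=> fl rinj; apply/eqP => fr0.
have lin : linear (fun x : R0^o => r *: x : R0^o).
  by move=> a x y; rewrite scalerDr !scalerA mulrC.
pose h : {linear R0^o -> R0^o} := HB.pack (fun x : R0^o => r *: x : R0^o)
  (GRing.isLinear.Build R0 R0^o R0^o _ _ lin).
have hinj : injective h by move=> x y /rinj.
have ht : tensor_eq0 f [seq (h xa.1, xa.2) | xa <- [:: (1 : R0^o, 1 : A)]].
  move=> P b [bDl bDr bZ bf]; rewrite big_seq1 /=.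
  rewrite (bZ r 1 1) -(bf r 1 1) fr0 mul0r.
  by apply: (addrI (b 1 0)); rewrite -bDr !addr0.
have bil : bilinear_map f (fun (x : R0^o) a => f x * a : V).
  split.
  - by move=> x y a; rewrite rmorphD; exact: mulrDl.
  - by move=> x a c; exact: mulrDr.
  - by move=> s x a; rewrite restrict_scalarsE [f _]rmorphM mulrA.
  - by move=> s x a; rewrite restrict_scalarsE mulrCA.
have := fl _ _ h hinj _ ht V _ bil.
by rewrite big_seq1 /= rmorph1 mulr1 => /eqP; rewrite oner_eq0.
Qed.

End RestrictScalars.

Section PushoutInduction.
Context {R0 A C B : comNzRingType} {f : {rmorphism R0 -> A}} {g : {rmorphism R0 -> C}}
  {i : {rmorphism A -> B}} {j : {rmorphism C -> B}}.
Hypothesis po : is_pushout f g i j.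
Variable S : set B.
Hypotheses (S1 : S 1) (SB : forall x y, S x -> S y -> S (x - y))
  (SM : forall x y, S x -> S y -> S (x * y)) (Si : forall a, S (i a)) (Sj : forall c, S (j c)).

Let S_pred : {pred B} := [pred x | `[< S x >]].

Let S_closed : subring_closed S_pred.
Proof.
split; first exact/asboolP.
  by move=> x y /asboolP hx /asboolP hy; apply/asboolP/SB.
by move=> x y /asboolP hx /asboolP hy; apply/asboolP/SM.
Qed.

HB.instance Definition _ := GRing.isSubringClosed.Build B S_pred S_closed.

Record pushout_subring := PushoutSubring { pushout_subring_val : B; _ : pushout_subring_val \in S_pred }.

HB.instance Definition _ := [isSub for pushout_subring_val].
HB.instance Definition _ := [Choice of pushout_subring by <:].
HB.instance Definition _ := [SubChoice_isSubComNzRing of pushout_subring by <:].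

Let valB (x y : pushout_subring) : val (x - y) = val x - val y :> B.
Proof. exact: (rmorphB (val : {rmorphism pushout_subring -> B})). Qed.

Let valM (x y : pushout_subring) : val (x * y) = val x * val y :> B.
Proof. exact: (rmorphM (val : {rmorphism pushout_subring -> B})). Qed.

Lemma pushout_ind x : S x.
Proof.
have Sip a : i a \in S_pred by apply/asboolP.
have Sjp c : j c \in S_pred by apply/asboolP.
have [||h hh] := @rmorphism_of A pushout_subring (fun a => PushoutSubring (Sip a)).
- by move=> a b; apply: val_inj; rewrite valB /= rmorphB.
- by split=> [|a b]; apply: val_inj; rewrite ?valM /= ?rmorph1 ?rmorphM.
have [||k hk] := @rmorphism_of C pushout_subring (fun c => PushoutSubring (Sjp c)).
- by move=> a b; apply: val_inj; rewrite valB /= rmorphB.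
- by split=> [|a b]; apply: val_inj; rewrite ?valM /= ?rmorph1 ?rmorphM.
have [comm univ] := po.
have [|l [lh lk _]] := univ pushout_subring h k.
  by move=> r; rewrite hh hk; apply: val_inj => /=.
have [l0 [_ _ uniq]] := univ B i j comm.
have e1 := uniq (val \o l) _ _ x; have e2 := uniq idfun (fun=> erefl) (fun=> erefl) x.
have -> : x = val (l x).
  rewrite -[LHS]/(idfun x) e2 -e1 // => [a|c] /=.
    by rewrite lh hh.
  by rewrite lk hk.
exact/asboolP/(valP (l x)).
Qed.

End PushoutInduction.

(** * Affine toric schemes *)

Section FractionOfValuationRing.
Context (K : fieldType) (R : realType) (v : valuation K R).
Local Notation O := (valring v).

Lemma valring_fraction (x : K) : exists r s : O, val s != 0 :> K /\ x * val s = val r.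
Proof.
have [xO|] := boolP (x \in valring_pred v).
  by exists (ValRing xO), 1; rewrite mulr1 oner_neq0.
rewrite valringE negb_or -ltNge => /andP[x0 vx].
have xO : x^-1 \in valring_pred v by rewrite valringE vrV // oppr_ge0 ltW ?orbT.
by exists 1, (ValRing xO); rewrite /= invr_eq0 mulfV.
Qed.

Lemma valring_eq0 (r : O) : (val r == 0 :> K) = (r == 0).
Proof. by []. Qed.

Lemma extend_to_fractions (F : fieldType) (f : {rmorphism O -> F}) :
  (forall r, r != 0 -> f r != 0) ->
  exists k : {rmorphism K -> F}, forall r, k (val r) = f r.
Proof.
move=> f0; have /choice[rs hrs] : forall x : K, exists p : O * O,
    val p.2 != 0 :> K /\ x * val p.2 = val p.1.
  by move=> x; have [r [s h]] := valring_fraction x; exists (r, s).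
pose k x := f (rs x).1 / f (rs x).2.
have valMO (a b : O) : val (a * b) = val a * val b :> K.
  exact: (rmorphM (val : {rmorphism O -> K})).
have valBO (a b : O) : val (a - b) = val a - val b :> K.
  exact: (rmorphB (val : {rmorphism O -> K})).
have kE x (r s : O) : val s != 0 :> K -> x * val s = val r -> k x = f r / f s.
  move=> s0 e; have [t0 et] := hrs x; rewrite /k.
  apply/eqP; rewrite eqr_div ?f0 // -?valring_eq0 // -!rmorphM; apply/eqP; congr (f _).
  by apply: val_inj; rewrite !valMO -e -et; ring.
have [||k' hk'] := @rmorphism_of K F k.
- move=> x y; have [s0 ex] := hrs x; have [t0 ey] := hrs y.
  rewrite (kE (x - y) ((rs x).1 * (rs y).2 - (rs y).1 * (rs x).2) ((rs x).2 * (rs y).2)).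
  + have fs : f (rs x).2 != 0 by rewrite f0 // -valring_eq0.
    have ft : f (rs y).2 != 0 by rewrite f0 // -valring_eq0.
    by rewrite rmorphB !rmorphM /k; field; rewrite fs ft.
  + by rewrite valMO mulf_neq0.
  + by rewrite valBO !valMO -ex -ey; ring.
- split=> [|x y].
    by rewrite (kE 1 1 1) ?rmorph1 ?divr1 ?oner_neq0 // mul1r.
  have [s0 ex] := hrs x; have [t0 ey] := hrs y.
  rewrite (kE (x * y) ((rs x).1 * (rs y).1) ((rs x).2 * (rs y).2)).
  + by rewrite !rmorphM /k mulf_div.
  + by rewrite valMO mulf_neq0.
  + by rewrite !valMO -ex -ey; ring.
exists k' => r; rewrite hk' (kE _ r 1) ?rmorph1 ?divr1 ?oner_neq0 //; exact: mulr1.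
Qed.

End FractionOfValuationRing.

Section ToricScheme.
Context (K : fieldType) (R : realType) (v : valuation K R) (n : nat).
Local Notation M := 'rV[int]_n.
Local Notation KM := (grpalg K M).
Local Notation O := (valring v).
Variable Y : affine_scheme_data v n.
Hypothesis tY : toric_scheme Y.
Local Notation fY := (structure_map Y).
Local Notation tau := (torus_map Y).

Lemma structure_map_neq0 r : r != 0 -> fY r != 0.
Proof.
move=> r0; apply: flat_regular; first exact: toric_flat.
move=> x y /(congr1 val); rewrite !(rmorphM (val : {rmorphism O -> K})) => h.
by apply/val_inj/(mulfI _ h).
Qed.

Lemma torus_map_structure r : tau (fY r) = gconst (val r).
Proof.
by have [B [i [j [phi [[po _] hi hj _]]]]] := toric_open tY; rewrite -hi po hj.
Qed.

Lemma torus_map_homogeneous a w : tau (coef (coaction Y a) w) = monom (coef (tau a) w) w.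
Proof.
have := congr1 (coef^~ w) (coaction_extends tY a).
by rewrite coef_comul coef_gmap ?rmorph0.
Qed.

Let generic_prime : prime_ideal [set f : KM | f = 0].
Proof.
split=> //=.
- by move=> x y -> ->; rewrite addr0.
- by move=> a x ->; rewrite mulr0.
- by move/eqP; rewrite oner_eq0.
- by move=> x y; apply: grpalg_integral.
Qed.

Let generic : spec KM := exist _ _ generic_prime.

Lemma torus_map_generic : injective tau /\
  (forall w : M, exists a b s t, [/\ a != 0, b != 0, s != 0, t != 0 &
     tau a * gconst s = monom 1 w * tau b * gconst t]).
Proof.
have [B [i [j [phi [po hi hj [_ _ /(_ generic) [stI stS]]]]]]] := toric_open tY.
have [comm univ] := po.
have [|k hk] := @extend_to_fractions K R v {fraction Y} (@tofrac Y \o fY : {rmorphism O -> {fraction Y}}).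
  by move=> r r0; rewrite /= tofrac_eq0 structure_map_neq0.
have iinj : injective i.
  have [|l [li _ _]] := univ {fraction Y} (@tofrac Y : {rmorphism Y -> {fraction Y}}) k.
    by move=> r; rewrite hk.
  by move=> a b /(congr1 l); rewrite !li => /eqP; rewrite tofrac_eq => /eqP.
have frac t : exists s : O, s != 0 /\ exists a, j (val s) * t = i a.
  move: t; apply: (@pushout_ind _ _ _ _ _ _ _ _ po
    (fun t => exists s : O, s != 0 /\ exists a, j (val s) * t = i a)).
  - by exists 1; split; [exact: oner_neq0|exists 1; rewrite !rmorph1 mulr1].
  - move=> x y [s [s0 [a ha]]] [t [t0 [b hb]]]; exists (s * t); split; first by rewrite mulf_neq0.
    exists (fY t * a - fY s * b).
    by rewrite rmorphB !rmorphM !comm -ha -hb /=; ring.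
  - move=> x y [s [s0 [a ha]]] [t [t0 [b hb]]]; exists (s * t); split; first by rewrite mulf_neq0.
    by exists (a * b); rewrite !rmorphM -ha -hb /= mulrACA.
  - by move=> a; exists 1; split; [exact: oner_neq0|exists a; rewrite !rmorph1 mul1r].
  - move=> c; have [r [s [s0 e]]] := valring_fraction v c.
    by exists s; split=> //; exists (fY r); rewrite comm mulrC -rmorphM; congr (j _); exact: e.
have gconst0 (x : K) : x != 0 -> gconst x != 0 :> KM.
  by move=> x0; apply: contra_neq x0 => /(congr1 (coef^~ 0)); rewrite coef_monom eqxx coef0.
have tinj a : tau a = 0 -> a = 0.
  move=> ta; have phi1 : ~ sval (spec_map phi generic) 1 by rewrite /= rmorph1 => /eqP; rewrite oner_eq0.
  have [|t /= pt] := stI (i a, 1) (0, 1) phi1 phi1.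
    by exists 1; rewrite /= ?hi ?ta ?rmorph0 ?rmorph1 ?subrr ?mulr0 //; move/eqP; rewrite oner_eq0.
  rewrite mulr1 mul0r subr0 => e.
  have [s [s0 [b hb]]] := frac t.
  have : b * a = 0 by apply: iinj; rewrite rmorphM rmorph0 -hb -mulrA e mulr0.
  move/eqP; rewrite mulf_eq0 => /orP[/eqP b0|/eqP //].
  case: pt; have /(congr1 phi) := hb; rewrite b0 !rmorph0 rmorphM hj => /grpalg_integral[/eqP|//].
  by rewrite (negbTE (gconst0 _ _)) // valring_eq0.
split=> [a b e|w].
  by apply/eqP; rewrite -subr_eq0; apply/eqP/tinj; rewrite rmorphB e subrr.
have [|[x1 x2] /= px [t /= t0 /grpalg_integral[//|e]]] := stS (monom 1 w, 1).
  by move/eqP; rewrite oner_eq0.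
have {}e : phi x1 = monom 1 w * phi x2 by apply/eqP; rewrite -subr_eq0 -{1}[phi x1]mulr1 e.
have [s [s0 [a ha]]] := frac x1; have [s' [s0' [b hb]]] := frac x2.
have ta : tau a = gconst (val s) * phi x1 by rewrite -hi -ha rmorphM hj.
have tb : tau b = gconst (val s') * phi x2 by rewrite -hi -hb rmorphM hj.
have tb0 : tau b != 0.
  by rewrite tb grpalg_mulf_neq0 ?gconst0 ?valring_eq0 //; apply/eqP.
have ta0 : tau a != 0.
  rewrite ta e !grpalg_mulf_neq0 ?gconst0 ?valring_eq0 //; last exact/eqP.
  by apply/eqP => /(congr1 (coef^~ w))/eqP; rewrite coef_monom eqxx coef0 oner_eq0.
exists a, b, (val s'), (val s); split; rewrite ?valring_eq0 //.
- by apply: contra_neq ta0 => ->; rewrite rmorph0.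
- by apply: contra_neq tb0 => ->; rewrite rmorph0.
- by rewrite ta tb e; ring.
Qed.

Lemma torus_map_inj : injective tau.
Proof. exact: torus_map_generic.1. Qed.

Definition torus_degree (w : M) := exists a al, al != 0 /\ tau a = monom al w.

Lemma torus_degree_coef a w : coef (tau a) w != 0 -> torus_degree w.
Proof. by move=> h; exists (coef (coaction Y a) w), (coef (tau a) w); rewrite torus_map_homogeneous. Qed.

Lemma torus_degree_diff w : exists w', torus_degree w' /\ torus_degree (w + w').
Proof.
have [a [b [s [t [a0 b0 s0 t0 e]]]]] := torus_map_generic.2 w.
have tb0 : tau b != 0 by rewrite -(rmorph0 tau) (inj_eq torus_map_inj).
have [w' hw'] := supp_neq0 tb0; exists w'; split.
  by apply: (@torus_degree_coef b); rewrite coef_neq0.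
have := congr1 (coef^~ (w + w')) e; rewrite -mulrA [LHS]/= mulrC [_ * gconst t]mulrC mulrCA.
rewrite !coef_gconstM => h; apply: (@torus_degree_coef a).
have : s * coef (tau a) (w + w') != 0.
  rewrite h mulf_neq0 // [tau b]grpalgE mulr_sumr coef_sum.
  rewrite (big_fsetD1 w') //= monomM mul1r coef_monom eqxx mulr1n.
  rewrite big1_fset ?addr0 ?coef_neq0 // => w2; rewrite in_fsetD1 => /andP[ne _] _.
  rewrite monomM coef_monom mul1r; case: eqP => // /addrI ew; by rewrite ew eqxx in ne.
by apply: contra_neq => ->; rewrite mulr0.
Qed.

End ToricScheme.

(** * Affine normal toric varieties *)

Section Classification.
Context (K : fieldType) (R : realType) (v : valuation K R) (n : nat).
Local Notation M := 'rV[int]_n.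
Local Notation KM := (grpalg K M).
Local Notation O := (valring v).
Variable Y : affine_scheme_data v n.
Hypothesis nY : normal_toric_variety Y.
Local Notation fY := (structure_map Y).
Local Notation tau := (torus_map Y).

Let tY : toric_scheme Y. Proof. by case: nY. Qed.
Let tau_inj : injective tau := torus_map_inj tY.

Let T : set KM := [set g | exists a, tau a = g].

Let TD f g : T f -> T g -> T (f + g).
Proof. by move=> [a <-] [b <-]; exists (a + b); rewrite rmorphD. Qed.

Let TM f g : T f -> T g -> T (f * g).
Proof. by move=> [a <-] [b <-]; exists (a * b); rewrite rmorphM. Qed.

Let TO r : r \in valring_pred v -> T (gconst r).
Proof. by move=> hr; exists (fY (ValRing hr)); rewrite torus_map_structure. Qed.

Let monom_neq0 (a : K) w : a != 0 -> monom a w != 0 :> KM.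
Proof. by apply: contra_neq => /(congr1 (coef^~ w)); rewrite coef_monom eqxx coef0. Qed.

Let monom_fraction a w : a != 0 -> exists a1 a2, a2 != 0 /\ tau a1 = monom a w * tau a2.
Proof.
move=> a0; have [w' [[b2 [be [be0 h2]]] [b1 [ga [ga0 h1]]]]] := torus_degree_diff tY w.
have [r [s [s0 e]]] := valring_fraction v (a * be / ga).
exists (fY r * b1), (fY s * b2); split.
  rewrite mulf_neq0 ?structure_map_neq0 -?valring_eq0 //.
  by rewrite -(inj_eq tau_inj) rmorph0 h2 monom_neq0.
rewrite !rmorphM !torus_map_structure // h1 h2 /gconst !monomM !add0r -e.
by congr monom; rewrite mulrCA [val s * _]mulrC mulrAC divfK // mulrCA mulrA.
Qed.

Lemma torus_image_root a w N : a != 0 -> (0 < N)%N -> T (monom a w ^+ N) -> T (monom a w).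
Proof.
move=> a0 N0 [z hz]; have [a1 [a2 [a20 h12]]] := monom_fraction w a0.
have ta2 : tofrac a2 != 0 by rewrite tofrac_eq0.
pose x := tofrac a1 / tofrac a2.
have xN : x ^+ N = tofrac z.
  apply: (mulIf (expf_neq0 N ta2)); rewrite -exprMn /x divfK //.
  rewrite -!rmorphXn -rmorphM; congr tofrac; apply: tau_inj.
  by rewrite rmorphM !rmorphXn h12 exprMn hz.
have [_ _ normY] := nY.
have [|i||z' hz'] := @normal_integral Y x ('X^N - (tofrac z)%:P) normY.
- by apply: monicXnsubC.
- rewrite poly.coefB coefXn coefC; exists ((i == N)%:R - (if i == 0%N then z else 0)).
  rewrite rmorphB rmorph_nat; congr (_ - _); by case: ifP => // _; rewrite rmorph0.
- by rewrite /root !hornerE xN subrr.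
exists z'; have : tau (z' * a2) = tau a1.
  congr (tau _); apply/eqP; rewrite -tofrac_eq rmorphM /= -hz' /x divfK //.
rewrite rmorphM h12 => e.
have /grpalg_integral[/eqP|/eqP] : (tau z' - monom a w) * tau a2 = 0.
- by rewrite mulrBl e subrr.
- by rewrite subr_eq0 => /eqP.
- by rewrite -(rmorph0 tau) (inj_eq tau_inj) (negbTE a20).
Qed.

(* al i chi^(u i) are the homogeneous components of the algebra generators. *)
Lemma homogeneous_generators : exists k (al : 'I_k -> K) (u : 'I_k -> M),
  [/\ forall i, al i != 0, forall i, T (monom (al i) (u i)) &
    forall a w, coef (tau a) w != 0 -> exists e : 'I_k -> nat,
      w = \sum_i u i *+ e i /\ \sum_i (e i)%:R * vr v (al i) <= vr v (coef (tau a) w)].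
Proof.
have [_ [s hs] _] := nY.
pose L := flatten [seq [seq (coef (tau a) w, w) | w <- supp (tau a)] | a <- s].
pose k := size L; pose al (i : 'I_k) := (tnth (in_tuple L) i).1.
pose u (i : 'I_k) := (tnth (in_tuple L) i).2.
have hL i : exists2 a, coef (tau a) (u i) != 0 & al i = coef (tau a) (u i).
  have : tnth (in_tuple L) i \in L by apply: mem_tnth.
  move=> /flatten_mapP[a as_ /mapP[w ws e]].
  by exists a; rewrite /al /u e //= coef_neq0.
have al0 i : al i != 0 by have [a h ->] := hL i.
exists k, al, u; split=> //.
  move=> i; have [a _ ->] := hL i; exists (coef (coaction Y a) (u i)).
  exact: torus_map_homogeneous.
pose reach (x : K) w := x = 0 \/ exists e : 'I_k -> nat,
      w = \sum_i u i *+ e i /\ \sum_i (e i)%:R * vr v (al i) <= vr v x.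
suff hr a : forall w, reach (coef (tau a) w) w.
  by move=> a w; case: (hr a w) => [->|//]; rewrite eqxx.
have reachD x y w : reach x w -> reach y w -> reach (x + y) w.
  move=> [->|hx]; first by rewrite add0r.
  move=> [->|hy]; first by rewrite addr0; right.
  have [->|x0] := eqVneq x 0; first by rewrite add0r; right.
  have [->|y0] := eqVneq y 0; first by rewrite addr0; right.
  have [xy|xy] := eqVneq (x + y) 0; [by left|right].
  have := vrD v x0 y0 xy; rewrite ge_min => /orP[le|le].
    by have [e [we he]] := hx; exists e; split=> //; apply: le_trans le.
  by have [e [we he]] := hy; exists e; split=> //; apply: le_trans le.
move: a; apply: hs => [r w|a aS w|a b ha hb w|a b ha hb w].
- rewrite torus_map_structure // coef_monom; case: eqP => [<-|_]; last by left.
  rewrite mulr1n; have [->|r0] := eqVneq (val r) 0; [by left|right].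
  exists (fun=> 0%N); split; first by rewrite big1.
  rewrite big1 => [|i _]; last by rewrite mul0r.
  by have := valP r; rewrite valringE (negbTE r0).
- have [->|c0] := eqVneq (coef (tau a) w) 0; [by left|right].
  have wL : (coef (tau a) w, w) \in L.
    by apply/flatten_mapP; exists a => //; apply/mapP; exists w; rewrite -?coef_neq0.
  have /tnthP[i hi] : (coef (tau a) w, w) \in in_tuple L by [].
  exists (fun j => (j == i) : nat); split.
    rewrite (bigD1 i) //= eqxx mulr1n big1 ?addr0 => [|j /negbTE ->//].
    by rewrite /u -hi.
  rewrite (bigD1 i) //= eqxx mul1r big1 ?addr0 => [|j /negbTE -> ]; last by rewrite mul0r.
  by rewrite /al -hi.
- by rewrite rmorphD coefD; apply: reachD.
- rewrite rmorphM coefM; apply: (big_ind (reach^~ w)) => [|x y|x _]; [by left|exact: reachD|].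
  apply: (big_ind (reach^~ w)) => [|y z|y _]; [by left|exact: reachD|].
  case: eqP => [<-|_]; last by left.
  rewrite mulr1n; case: (ha x) => [->|[e [xe he]]]; first by rewrite mul0r; left.
  case: (hb y) => [->|[e' [ye he']]]; first by rewrite mulr0; left.
  have [->|x0] := eqVneq (coef (tau a) x) 0; first by rewrite mul0r; left.
  have [->|y0] := eqVneq (coef (tau b) y) 0; first by rewrite mulr0; left.
  right; exists (fun i => (e i + e' i)%N); split.
    by rewrite xe ye -big_split; apply: eq_bigr => i _; rewrite mulrnDr.
  rewrite vrM //; apply: le_trans (lerD he he'); rewrite -big_split /=.
  by apply: ler_sum => i _; rewrite natrD mulrDl.
Qed.

End Classification.

Lemma clear_denominators_row n k (u : 'I_k -> 'rV[int]_n) (w : 'rV[int]_n) (l : 'I_k -> rat)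
    (N : nat) (m : 'I_k -> nat) :
  (forall j, (w 0 j)%:~R = \sum_i l i * (u i 0 j)%:~R) ->
  (forall i, N%:R * l i = (m i)%:R) -> w *+ N = \sum_i u i *+ m i.
Proof.
move=> hl hm; apply/rowP => j; rewrite mulmxnE summxE; apply: (@intr_inj rat).
rewrite rmorphMn /= -mulr_natl hl mulr_sumr rmorph_sum; apply: eq_bigr => i _.
by rewrite mulrA hm mulmxnE /= rmorphMn /= -[RHS]mulr_natl.
Qed.

Section ToricVarietyCone.
Context (K : fieldType) (R : realType) (v : valuation K R) (n : nat).
Local Notation M := 'rV[int]_n.
Local Notation KM := (grpalg K M).
Variable Y : affine_scheme_data v n.
Hypothesis nY : normal_toric_variety Y.
Local Notation tau := (torus_map Y).

Let tY : toric_scheme Y. Proof. by case: nY. Qed.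

Variables (k : nat) (al : 'I_k -> K) (u : 'I_k -> M).
Hypothesis al0 : forall i, al i != 0.
Let c i := vr v (al i).
Let T : set KM := [set g | exists a, tau a = g].
Hypothesis Tal : forall i, T (monom (al i) (u i)).
Hypothesis gen : forall a w, coef (tau a) w != 0 -> exists e : 'I_k -> nat,
  w = \sum_i u i *+ e i /\ \sum_i (e i)%:R * c i <= vr v (coef (tau a) w).

Local Notation sigma := (cone_of u c).

Let TD f g : T f -> T g -> T (f + g).
Proof. by move=> [a <-] [b <-]; exists (a + b); rewrite rmorphD. Qed.

Let TM f g : T f -> T g -> T (f * g).
Proof. by move=> [a <-] [b <-]; exists (a * b); rewrite rmorphM. Qed.

Let TO r : r \in valring_pred v -> T (gconst r).
Proof. by move=> hr; exists (structure_map Y (ValRing hr)); rewrite torus_map_structure. Qed.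

Let cG i : value_group v (c i).
Proof. exact: value_groupP. Qed.

Lemma generators_spanning : spanning R u.
Proof.
move=> d hd; have deg0 w : torus_degree Y w -> pairing w d = 0.
  move=> [a [b [b0 h]]]; have [|e [-> _]] := @gen a w.
    by rewrite h coef_monom eqxx.
  by rewrite pairing_sum big1 // => i _; rewrite pairingMn hd mulr0.
apply/rowP => j; rewrite -pairing_delta mxE.
have [w' [h' h]] := torus_degree_diff tY (delta_mx 0 j).
by have := deg0 _ h; rewrite pairingD (deg0 _ h') addr0.
Qed.

Let sp := generators_spanning.

Lemma torus_image_sub f : T f -> f \in cone_ring_pred v sigma.
Proof.
move=> [a <-]; apply/cone_ringP => x [x0 hx] _ w ws; rewrite -coef_neq0 in ws.
have [e [we he]] := gen ws; rewrite /weight {2}we pairing_sum.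
apply: (@le_trans _ _ (\sum_i (e i)%:R * (pairing (u i) x.1 + x.2 * c i))).
  by apply: sumr_ge0 => i _; rewrite mulr_ge0.
under eq_bigr do rewrite mulrDr.
rewrite big_split /= [leLHS]addrC; apply: lerD.
  under eq_bigr do rewrite mulrCA.
  by rewrite -mulr_sumr ler_wpM2l.
by apply: ler_sum => i _; rewrite pairingMn.
Qed.

Let Tprod (e : 'I_k -> nat) : T (monom (\prod_i al i ^+ e i) (\sum_i u i *+ e i)).
Proof. by rewrite -monom_prod; apply: (closed_prod TM TO). Qed.

Let prod0 (e : 'I_k -> nat) : \prod_i al i ^+ e i != 0.
Proof. by apply/prodf_neq0 => i _; rewrite expf_neq0. Qed.

Let vprod (e : 'I_k -> nat) : vr v (\prod_i al i ^+ e i) = \sum_i (e i)%:R * c i.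
Proof.
rewrite vr_prod => [|i]; last by rewrite expf_neq0.
by apply: eq_bigr => i _; rewrite vrX.
Qed.

Lemma cone_ring_sub f : f \in cone_ring_pred v sigma -> T f.
Proof.
suff Tm a w : a != 0 -> monom a w \in cone_ring_pred v sigma -> T (monom a w).
  move=> hf; rewrite [f]grpalgE big_seq; apply: (big_ind T) => //.
    by exists 0; rewrite rmorph0.
  move=> w wx; apply: Tm; first by rewrite coef_neq0.
  exact: monom_cone_ring hf _.
move=> a0 ha; have [P0|Pempty] := pselect (polyhedron u c !=set0).
  have [w0 [l [bw l0 lt hl hw]]] := cone_ring_optimum sp P0 a0 ha.
  have [N [m [N0 hm]]] := clear_denominators l0.
  have ew := clear_denominators_row hl hm.
  apply: (torus_image_root nY a0 N0); rewrite monom_expr ew.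
  apply: (closed_monom_scale TM TO _ _ _ (Tprod m)); rewrite ?expf_neq0 //.
  rewrite vprod vrX //.
  have : \sum_i (m i)%:R * c i = - pairing (w *+ N) w0.
    rewrite ew pairing_sum -sumrN; apply: eq_bigr => i _; rewrite pairingMn -mulrN.
    have [li|/lt/eqP ti] := eqVneq (l i) 0; last by congr (_ * _); lra.
    have /eqP := hm i; rewrite li mulr0 eq_sym pnatr_eq0 => /eqP ->; by rewrite !mul0r.
  rewrite pairingMn => ->; rewrite -mulrN ler_wpM2l //; lra.
have [l [l0 hl]] := cone_ring_recession a0 ha.
have [N [m [N0 hm]]] := clear_denominators l0.
have ew := clear_denominators_row hl hm.
have [|l' [l'0 hl' lt0]] := @empty_polyhedron_cert R n _ u c.
  by move=> w0 Pw0; apply: Pempty; exists w0.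
have [N' [m' [N'0 hm']]] := clear_denominators l'0.
have ew' : \sum_i u i *+ m' i = 0.
  rewrite -(@clear_denominators_row n k u 0 l' N' m') ?mul0rn // => j.
  by rewrite mxE hl'.
have Tc b : T (gconst b).
  apply: (closed_const TM TO _ (prod0 m')); last by rewrite /gconst -ew'.
  rewrite vprod; have -> : \sum_i (m' i)%:R * c i = N'%:R * \sum_i ratr (l' i) * c i.
    rewrite mulr_sumr; apply: eq_bigr => i _; rewrite mulrA; congr (_ * _).
    by rewrite -[(m' i)%:R](ratr_nat R) -hm' rmorphM /= ratr_nat.
  by rewrite pmulr_rlt0 // ltr0n.
apply: (torus_image_root nY a0 N0); rewrite monom_expr ew.
have := TM (Tc (a ^+ N / \prod_i al i ^+ m i)) (Tprod m).
by rewrite /gconst monomM add0r divfK.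
Qed.

Lemma torus_image_iso : toric_iso (cone_scheme v sigma) Y.
Proof.
have tA a : tau a \in cone_ring_pred v sigma by apply: torus_image_sub; exists a.
have vB (x y : cone_ring v sigma) : val (x - y) = val x - val y :> KM.
  exact: (rmorphB (val : {rmorphism cone_ring v sigma -> KM})).
have vM (x y : cone_ring v sigma) : val (x * y) = val x * val y :> KM.
  exact: (rmorphM (val : {rmorphism cone_ring v sigma -> KM})).
have [||psi hpsi] := @rmorphism_of Y (cone_ring v sigma) (fun a => ConeRing (tA a)).
- by move=> a b; apply: val_inj; rewrite vB /= rmorphB.
- by split=> [|a b]; apply: val_inj; rewrite ?vM /= ?rmorph1 ?rmorphM.
have vpsi a : val (psi a) = tau a by rewrite hpsi.
exists psi; split.
- have /choice[g hg] : forall x : cone_ring v sigma, exists a, tau a = val x.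
    by move=> x; apply: cone_ring_sub; apply: valP.
  exists g => [a|x].
    by apply: (torus_map_inj tY); rewrite hg vpsi.
  by apply: val_inj; rewrite vpsi hg.
- by move=> r; apply: val_inj; rewrite vpsi torus_map_structure.
- move=> a; apply/grpalgP => w; rewrite coef_gmap ?rmorph0 // [RHS]coef_cone_coaction.
  by apply: val_inj; rewrite vpsi torus_map_homogeneous //= vpsi.
- exact: vpsi.
Qed.

Lemma cone_admissible : admissible v sigma.
Proof. by split; [apply/spanningP; exact: sp | exists k, u, c]. Qed.

Section Vertex.
Hypothesis nd : ~ discrete_valuation v.
Variable w : 'rV[R]_n.
Hypothesis bw : basic u c w.

(* Monomials a chi^t with v(a) slightly above - <t, w> are products of
   generators; the tight ones among these have weight 0 at (w, 1), the others
   have weight bounded below, so only tight generators can occur. *)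
Let tight_value_group (t : M) (q : 'I_k -> rat) : (exists2 x, x != 0 & vr v x != 0) ->
  (forall i, 0 <= q i) -> (forall i, q i != 0 -> tight u c w i) ->
  (forall j, (t 0 j)%:~R = \sum_i q i * (u i 0 j)%:~R) -> value_group v (pairing t w).
Proof.
move=> nt q0 qt hq.
have [|d d0 hd] := @finite_pos_bound R _
    (fun i => if tight u c w i then 1 else pairing (u i) w + c i).
  by move=> i; case: ifPn => // ti; rewrite lt0r ti bw.1.
have [g gG /andP[g0 gd]] := value_group_dense nd nt d0.
pose z := Num.floor (- pairing t w / g).
have z1 : z%:~R * g <= - pairing t w by rewrite -ler_pdivlMr // ge_floor.
have z2 : - pairing t w < (z + 1)%:~R * g by rewrite -ltr_pdivrMr // lt_succ_floor.
have [a a0 va] : exists2 a, a != 0 & vr v a = (z + 1)%:~R * g.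
  by apply/value_groupE/value_groupMz.
have ha : monom a t \in cone_ring_pred v sigma.
  apply/(monom_in_cone_ring _ _ _ a0) => x [x0 hx] _; rewrite /weight va.
  apply: (@le_trans _ _ (x.2 * - pairing t w + pairing t x.1)); last first.
    by rewrite lerD2r ler_wpM2l // ltW.
  rewrite (tight_value qt hq) opprK (pairing_ratr _ hq) mulr_sumr -big_split /=.
  apply: sumr_ge0 => i _; rewrite mulrCA -mulrDr mulr_ge0 ?ler0q //.
  by rewrite addrC.
have [b hb] := cone_ring_sub ha.
have [|e [te he]] := @gen b t; first by rewrite hb coef_monom eqxx.
rewrite hb coef_monom eqxx mulr1n va in he.
have et i : e i != 0%N -> tight u c w i.
  move=> ei; apply: contraT => ti; have := hd i; rewrite (negbTE ti) => di.
  have : \sum_i (e i)%:R * (pairing (u i) w + c i) < d.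
    apply: (@le_lt_trans _ _ (pairing t w + (z + 1)%:~R * g)); last first.
      by move: z1; rewrite intrD mulrDl mul1r; lra.
    under eq_bigr do rewrite mulrDr.
    rewrite big_split lerD //= te pairing_sum.
    by apply: ler_sum => i' _; rewrite pairingMn.
  rewrite (bigD1 i) //= ltNge => /negP[]; rewrite -[d]addr0; apply: lerD.
    apply: le_trans di _; rewrite ler_peMl ?bw.1 // ler1n lt0n //.
  by apply: sumr_ge0 => i' _; rewrite mulr_ge0 // bw.1.
rewrite te pairing_sum; apply: value_group_sum => i; rewrite pairingMn.
have [->|/et/eqP ti] := eqVneq (e i) 0%N; first by rewrite mul0r; apply: value_group0.
rewrite -[(e i)%:R]/((Posz (e i))%:~R); apply: value_groupMz.
rewrite (_ : pairing (u i) w = - c i); last by lra.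
exact: value_groupN.
Qed.

Lemma basic_value_group j : value_group v (w 0 j).
Proof.
have [nt|tr] := pselect (exists2 x, x != 0 & vr v x != 0); last first.
  have c0 i : c i = 0.
    by apply/eqP; apply: contrapT => /negP h; apply: tr; exists (al i).
  rewrite (_ : w = 0) ?mxE; first exact: value_group0.
  by apply: bw.2 => i /eqP; rewrite c0 addr0.
rewrite -pairing_delta; set t := delta_mx 0 j.
pose u' i := if tight u c w i then u i else 0.
have [|N [z N0 hz]] := @spanning_int R n _ u' t.
  by move=> d hd; apply: bw.2 => i ti; have := hd i; rewrite /u' ti.
pose L := (\sum_i `|z i|)%N.
have zL i : `|z i| <= L%:Z.
  by rewrite -abszE lez_nat /L (bigD1 i) //= leq_addr.
pose m0 := \sum_i u' i.
have hm0 : value_group v (pairing m0 w).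
  apply: (@tight_value_group m0 (fun i => (tight u c w i)%:R)) => //.
  - by move=> i; case: (tight u c w i) => //; rewrite eqxx.
  - move=> l; rewrite /m0 summxE rmorph_sum; apply: eq_bigr => i _ /=; rewrite /u'.
    by case: ifP; rewrite ?mul1r // mxE mul0r.
suff : value_group v (pairing (t + m0 *+ L) w).
  rewrite pairingD pairingMn => h; rewrite -[pairing t w](addrK (L%:R * pairing m0 w)).
  apply: value_groupB => //.
  by rewrite -[L%:R]/((Posz L)%:~R); apply: value_groupMz.
have Nq0 : (N%:R : rat) != 0 by rewrite pnatr_eq0 -lt0n.
apply: (@tight_value_group _ (fun i => if tight u c w i then (z i)%:~R / N%:R + L%:R else 0)) => //.
- move=> i; case: ifP => // _; rewrite -(pmulr_lge0 _ (_ : 0 < N%:R)) ?ltr0n //.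
  rewrite mulrDl divfK // -natrM -[(L * N)%:R]/((Posz (L * N))%:~R) -intrD ler0z.
  have : (L <= L * N)%N by rewrite leq_pmulr.
  have := zL i; lia.
- by move=> i; case: ifP; rewrite ?eqxx.
move=> l; rewrite mxE intrD mulmxnE rmorphMn /=.
have -> : (t 0 l)%:~R = \sum_i ((z i)%:~R / N%:R) * (u' i 0 l)%:~R :> rat.
  apply: (mulfI Nq0); rewrite mulr_natl -(rmorphMn (intr : {rmorphism int -> rat})) /=.
  rewrite -mulmxnE hz summxE rmorph_sum mulr_sumr; apply: eq_bigr => i _ /=.
  rewrite -scaler_int mxE /= intrM intz mulrA; congr (_ * _).
  by rewrite mulrCA mulfV // mulr1.
rewrite /m0 summxE rmorph_sum -[X in _ + X]mulr_natl mulr_sumr -big_split /=; apply: eq_bigr => i _.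
rewrite -mulrDl /u'; case: ifP => // _.
by rewrite mxE mulr0 mul0r.
Qed.

End Vertex.

End ToricVarietyCone.

Theorem theorem1 (R : realType) (K : fieldType) (v : valuation K R) (n : nat)
    (v_not_discrete : ~ discrete_valuation v) :
  let C : set (set ('rV[R]_n * R)) :=
    [set sigma | admissible v sigma /\
       forall w, vertex (height1 sigma) w -> forall i, value_group v (w 0 i)] in
  [/\ (forall sigma, C sigma -> normal_toric_variety (cone_scheme v sigma)),
      (forall sigma tau, C sigma -> C tau ->
         toric_iso (cone_scheme v sigma) (cone_scheme v tau) -> sigma = tau)
    & (forall Y : affine_scheme_data v n, normal_toric_variety Y ->
         exists2 sigma, C sigma & toric_iso (cone_scheme v sigma) Y)].
Proof.
move=> C; split.
- by move=> sigma [ha hv]; apply: cone_scheme_normal_toric.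
- by move=> sigma tau [hs _] [ht _]; apply: cone_scheme_inj.
move=> Y nY; have [k [al [u [al0 Tal gen]]]] := homogeneous_generators nY.
exists (cone_of u (fun i => vr v (al i))); last exact: torus_image_iso.
split; first exact: (cone_admissible nY al0 gen).
move=> w; rewrite height1_cone_of => /vertex_basic bw.
exact: (basic_value_group nY al0 Tal gen v_not_discrete bw).
Qed.
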